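(* For every $i=0,\dots,l$, $$\mathrm{Ker}\, f_{\lambda_i}=I_{\lambda_i},$$ or equivalently, $$\mathrm{Ker}\,\pi_{\lambda_i}=I_{\lambda_i}\cdot v^N_{\lambda_i}.$$
   Context: Let $\mathfrak{g}$ be a finite-dimensional complex simple Lie algebra of type $A$, $D$ or $E$ of rank $l$, with Cartan subalgebra $\mathfrak{h}$, simple roots $\alpha_1,\dots,\alpha_l$, set of roots $\Delta$, set of positive roots $\Delta_+$, and invariant form $\langle\cdot,\cdot\rangle$ normalized so that $\langle\alpha,\alpha\rangle=2$ for $\alpha\in\Delta$; identify $\mathfrak{h}$ with $\mathfrak{h}^*$ via this form. Let $\lambda_1,\dots,\lambda_l$ be the fundamental weights ($\langle\lambda_i,\alpha_j\rangle=\delta_{ij}$), $\lambda_0=0$, $Q=\sum_i\mathbb{Z}\alpha_i$ and $P=\sum_i\mathbb{Z}\lambda_i$ the root and weight lattices. For each root $\alpha$ let $x_\alpha$ be a root vector (normalized below). Let $\widehat{\mathfrak{g}}=\mathfrak{g}\otimes\mathbb{C}[t,t^{-1}]\oplus\mathbb{C}\mathbf{k}$, $\mathbf{k}$ central, $[x\otimes t^m,y\otimes t^n]=[x,y]\otimes t^{m+n}+m\langle x,y\rangle\delta_{m+n,0}\mathbf{k}$. Write $x(m)$ for $x\otimes t^m$ and for its action on a module. Let $\mathfrak{n}=\coprod_{\alpha\in\Delta_+}\mathbb{C}x_\alpha$, $\bar{\mathfrak{n}}=\mathfrak{n}\otimes\mathbb{C}[t,t^{-1}]$, $\bar{\mathfrak{n}}_+=\mathfrak{n}\otimes\mathbb{C}[t]$.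 The module $V_P$. Fix $s>0$ and a 2-cocycle $\epsilon:P\times P\to\mathbb{C}^\times$ with values in the $s$-th roots of unity, normalized by $\epsilon(\alpha,0)=\epsilon(0,\alpha)=1$, whose commutator map $c(\alpha,\beta)=\epsilon(\alpha,\beta)/\epsilon(\beta,\alpha)$ (alternating and $\mathbb{Z}$-bilinear) satisfies $c(\alpha,\beta)=(-1)^{\langle\alpha,\beta\rangle}$ for $\alpha,\beta\in Q$; such data exist. Let $M(1)=S(\mathfrak{h}\otimes t^{-1}\mathbb{C}[t^{-1}])$ be the level one Fock module for $\widehat{\mathfrak{h}}=\mathfrak{h}\otimes\mathbb{C}[t,t^{-1}]\oplus\mathbb{C}\mathbf{k}$ on which $\mathfrak{h}\otimes\mathbb{C}[t]$ annihilates the vacuum, and $V_P=M(1)\otimes\mathbb{C}[P]$, where $\mathbb{C}[P]$ has basis $e^\beta$, $\beta\in P$. For $h\in\mathfrak{h}$, $h(n)$ ($n\ne0$) acts on the factor $M(1)$ and $h(0)(v\otimes e^\beta)=\langle h,\beta\rangle v\otimes e^\beta$. For $\lambda\in P$ put $e_\lambda(v\otimes e^\beta)=\epsilon(\lambda,\beta)v\otimes e^{\lambda+\beta}$, $x^\lambda(v\otimes e^\beta)=x^{\langle\lambda,\beta\rangle}v\otimes e^\beta$, $E^\pm(-\lambda,x)=\exp\left(\sum_{\pm n>0}\frac{-\lambda(n)}{n}x^{-n}\right)$ and $Y(e^\lambda,x)=E^-(-\lambda,x)E^+(-\lambda,x)e_\lambda x^\lambda$. For $\alpha\in\Delta$ write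 $Y(e^\alpha,x)=\sum_{m\in\mathbb{Z}}x_\alpha(m)x^{-m-1}$. With suitably normalized root vectors $x_\alpha$, these operators together with the $\widehat{\mathfrak{h}}$-action make $V_P$ a $\widehat{\mathfrak{g}}$-module of level one in which $x_\alpha\otimes t^m$ acts as $x_\alpha(m)$; this normalization of the $x_\alpha$ is fixed. Write $e^\lambda$ for $1\otimes e^\lambda\in V_P$. Principal-like subspaces. For $i=0,\dots,l$ let $v_{\lambda_i}=e^{\lambda_i}\in V_P$ and $W(\lambda_i)=U(\bar{\mathfrak{n}})\cdot v_{\lambda_i}\subset V_P$. Let $f_{\lambda_i}:U(\bar{\mathfrak{n}})\to W(\lambda_i)$, $a\mapsto a\cdot v_{\lambda_i}$. The vector $v_{\lambda_i}$ is annihilated by $\bar{\mathfrak{n}}_+$. Let $W^N(\lambda_i)=U(\bar{\mathfrak{n}})\otimes_{U(\bar{\mathfrak{n}}_+)}\mathbb{C}v^N_{\lambda_i}$, where $\bar{\mathfrak{n}}_+$ acts trivially on the one-dimensional space $\mathbb{C}v^N_{\lambda_i}$, and let $\pi_{\lambda_i}:W^N(\lambda_i)\to W(\lambda_i)$ be the natural map $a\cdot v^N_{\lambda_i}\mapsto a\cdot v_{\lambda_i}$ ($a\in U(\bar{\mathfrak{n}})$). Ideals. For $t\in\mathbb{Z}$ and $j=1,\dots,l$ set $$R^j_{-1,t}=\sum_{m_1,m_2\le-1,\ m_1+m_2=-t}x_{\alpha_j}(m_1)x_{\alpha_j}(m_2)\in U(\bar{\mathfrak{n}})$$ (zero unless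 $t\ge2$). Let $J=\sum_{j=1}^l\sum_{t\ge2}U(\bar{\mathfrak{n}})R^j_{-1,t}$, and define the left ideals $I_{\lambda_0}=J+U(\bar{\mathfrak{n}})\bar{\mathfrak{n}}_+$ and $I_{\lambda_i}=I_{\lambda_0}+U(\bar{\mathfrak{n}})x_{\alpha_i}(-1)$ for $i=1,\dots,l$. *)

(* Defs.v *)
From HB Require Import structures.
From mathcomp Require Import all_boot all_order all_fingroup all_algebra.
From mathcomp Require Import finmap boolp classical_sets functions cardinality.
From mathcomp Require Import fsbigop reals complex.
From mathcomp Require Import generic_quotient ring_quotient monalg.

Set Implicit Arguments.
Unset Strict Implicit.
Unset Printing Implicit Defensive.

Import Order.TTheory GRing.Theory Num.Theory.
Local Open Scope ring_scope.
Local Open Scope classical_set_scope.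

(* {malg K[T]} is the vector space with basis T, and << t >> is the basis     *)
(* vector t. When T is a monoid it is the monoid algebra.                     *)
Section LinearExtension.
Variables (K : fieldType) (T : choiceType) (M : lmodType K) (f : T -> M).

Definition lext (u : {malg K[T]}) : M := \sum_(t <- msupp u) u@_t *: f t.

Lemma lextEw (d : {fset T}) (u : {malg K[T]}) :
  (msupp u `<=` d)%fset -> lext u = \sum_(t <- d) u@_t *: f t.
Proof.
move=> le_ud; rewrite /lext (big_fset_incl _ le_ud) // => t _ /mcoeff_outdom ->.
by rewrite scale0r.
Qed.

Lemma lext_is_linear : linear lext.
Proof.
move=> a u v; set d := (msupp u `|` msupp v `|` msupp (a *: u + v))%fset.
rewrite !(@lextEw d) ?fsubsetUr //; first last.
- by rewrite /d -fsetUA fsubsetUl.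
- by rewrite /d [(msupp u `|` _)%fset]fsetUC -fsetUA fsubsetUl.
rewrite scaler_sumr -big_split; apply: eq_bigr => t _ /=.
by rewrite mcoeffD mcoeffZ scalerDl scalerA.
Qed.

HB.instance Definition _ :=
  GRing.isLinear.Build K {malg K[T]} M *:%R lext lext_is_linear.

Lemma lextU t : lext << t >> = f t.
Proof.
rewrite (@lextEw [fset t]%fset) ?msuppU_le // big_seq_fset1.
by rewrite mcoeffUU scale1r.
Qed.
End LinearExtension.

Lemma malg_scalerAr (K : fieldType) (T : monomType) (a : K)
    (u v : {malg K[T]}) : a *: (u * v) = u * (a *: v).
Proof.
have comm_u : a%:MP * u = u * a%:MP.
  rewrite [u]monalgE mulr_sumr mulr_suml; apply: eq_bigr => t _.
  by rewrite !malgM_def !fgmulUU mulm1 mul1m mulrC.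
by rewrite -2!mul_malgC 2!mulrA comm_u.
Qed.

Section QuotientModule.
Variables (K : fieldType) (V : lmodType K) (S : set V).

Definition in_span (v : V) : Prop :=
  exists2 r : seq (K * V),
    forall p, p \in r -> S p.2 & v = \sum_(p <- r) p.1 *: p.2.

Definition span_pred : {pred V} := fun v => `[< in_span v >].

Lemma in_span0 : in_span 0.
Proof. by exists [::]; rewrite ?big_nil. Qed.

Lemma in_spanP a u v : in_span u -> in_span v -> in_span (a *: u + v).
Proof.
move=> [r Sr ->] [q Sq ->].
exists ([seq (a * p.1, p.2) | p <- r] ++ q) => [p|].
  by rewrite mem_cat => /orP[/mapP[{}p /Sr Sp ->]|/Sq].
rewrite big_cat big_map scaler_sumr; congr (_ + _).
by apply: eq_bigr => p _; rewrite scalerA.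
Qed.

Lemma in_spanZ a u : in_span u -> in_span (a *: u).
Proof. by move=> Su; rewrite -[_ *: _]addr0; apply: in_spanP in_span0. Qed.

Lemma mem_span u : S u -> in_span u.
Proof.
move=> Su; exists [:: (1, u)]; last by rewrite big_seq1 scale1r.
by move=> p; rewrite inE => /eqP ->.
Qed.

Lemma span_zmod_closed : zmod_closed span_pred.
Proof.
split=> [|u v /asboolP Su /asboolP Sv]; apply/asboolP; first exact: in_span0.
by rewrite addrC -scaleN1r; apply: in_spanP.
Qed.

HB.instance Definition _ := GRing.isZmodClosed.Build V span_pred
  span_zmod_closed.

Definition qmod := @Quotient.quot V span_pred.
HB.instance Definition _ := GRing.Zmodule.on qmod.

Definition qpi (v : V) : qmod := \pi_(@Quotient.quot V span_pred)%qT v.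

Lemma qpi_eq u v : qpi u = qpi v <-> in_span (u - v).
Proof.
rewrite /qpi; split=> [/eqP|S_uv].
  by rewrite -Quotient.idealrBE => /asboolP.
by apply/eqP; rewrite -Quotient.idealrBE; apply/asboolP.
Qed.

Lemma qpi_repr x : qpi (repr x) = x.
Proof. exact: reprK. Qed.

Lemma qpiD u v : qpi (u + v) = qpi u + qpi v.
Proof. by rewrite /qpi !piE. Qed.

Lemma qpi0 : qpi 0 = 0.
Proof. by apply: (addrI (qpi 0)); rewrite -qpiD !addr0. Qed.

Definition qscale (a : K) (x : qmod) : qmod := qpi (a *: repr x).

Lemma qscaleE a v : qscale a (qpi v) = qpi (a *: v).
Proof.
apply/qpi_eq; rewrite -scalerBr; apply: in_spanZ; apply/qpi_eq.
exact: qpi_repr.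
Qed.

Fact qscaleA a b x : qscale a (qscale b x) = qscale (a * b) x.
Proof. by rewrite -[x]qpi_repr !qscaleE scalerA. Qed.
Fact qscale1 : left_id 1 qscale.
Proof. by move=> x; rewrite -[x]qpi_repr qscaleE scale1r. Qed.
Fact qscaleDr : right_distributive qscale +%R.
Proof.
move=> a x y; rewrite -[x]qpi_repr -[y]qpi_repr -qpiD !qscaleE.
by rewrite scalerDr qpiD.
Qed.
Fact qscaleDl x : {morph qscale^~ x : a b / a + b}.
Proof. by move=> a b; rewrite -[x]qpi_repr !qscaleE scalerDl qpiD. Qed.

HB.instance Definition _ := GRing.Zmodule_isLmodule.Build K qmod
  qscaleA qscale1 qscaleDr qscaleDl.

Lemma qpi_is_linear : linear qpi.
Proof. by move=> a u v; rewrite qpiD -qscaleE. Qed.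

HB.instance Definition _ :=
  GRing.isLinear.Build K V qmod *:%R qpi qpi_is_linear.

Lemma qpiZ a v : qpi (a *: v) = a *: qpi v.
Proof. by rewrite -qscaleE. Qed.

(* The map induced on the quotient by a linear map that vanishes on S.        *)
Definition qlift (M : Type) (f : V -> M) (x : qmod) : M := f (repr x).

Lemma qliftE (M : lmodType K) (f : V -> M) (v : V) :
  linear f -> (forall s, S s -> f s = 0) -> qlift f (qpi v) = f v.
Proof.
move=> f_lin fS.
have f0 : f 0 = 0.
  have := f_lin (-1) 0 0.
  by rewrite scaler0 addr0 scaleN1r addNr.
have fspan u : in_span u -> f u = 0.
  move=> [r Sr ->]; elim: r Sr => [|p r IHr] Sr; first by rewrite big_nil.
  rewrite big_cons f_lin (fS p.2) ?IHr ?scaler0 ?addr0 //.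
    by move=> q qr; apply: Sr; rewrite inE qr orbT.
  by apply: Sr; rewrite mem_head.
apply/eqP; rewrite -subr_eq0 addrC -scaleN1r -f_lin scaleN1r addrC.
apply/eqP/fspan/qpi_eq; exact: qpi_repr.
Qed.
End QuotientModule.

Arguments qpi {K V S} v.
Arguments qlift {K V S M} f x.

(* The product of the quotient of an algebra by a two-sided ideal.            *)
Section QuotientAlgebra.
Variables (K : fieldType) (A : algType K) (S : set A).

Definition ideal_gen : set A :=
  [set a | exists u r v, S r /\ a = u * r * v].

Lemma idealMl u a : in_span ideal_gen a -> in_span ideal_gen (u * a).
Proof.
move=> [r Sr ->]; exists [seq (p.1, u * p.2) | p <- r].
  move=> p /mapP[{}p /Sr[w [s [v [rs def_p]]]] ->] /=.
  by exists (u * w), s, v; rewrite def_p !mulrA.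
by rewrite big_map mulr_sumr; apply: eq_bigr => p _; rewrite scalerAr.
Qed.

Lemma idealMr u a : in_span ideal_gen a -> in_span ideal_gen (a * u).
Proof.
move=> [r Sr ->]; exists [seq (p.1, p.2 * u) | p <- r].
  move=> p /mapP[{}p /Sr[w [s [v [rs def_p]]]] ->] /=.
  by exists w, s, (v * u); rewrite def_p !mulrA.
by rewrite big_map mulr_suml; apply: eq_bigr => p _; rewrite scalerAl.
Qed.

Local Notation qalg := (qmod ideal_gen).

Definition qmul (x y : qalg) : qalg := qpi (repr x * repr y).

Lemma qmulE (u v : A) : qmul (qpi u) (qpi v) = qpi (u * v).
Proof.
rewrite /qmul; apply/qpi_eq.
set u' := repr _; set v' := repr _.
have Su : in_span ideal_gen (u' - u) by apply/qpi_eq; exact: qpi_repr.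
have Sv : in_span ideal_gen (v' - v) by apply/qpi_eq; exact: qpi_repr.
have -> : u' * v' - u * v = 1 *: ((u' - u) * v') + u * (v' - v).
  by rewrite scale1r mulrBl mulrBr addrA subrK.
by apply: in_spanP; [apply: idealMr | apply: idealMl].
Qed.

Lemma qmulA : associative qmul.
Proof.
move=> x y z; rewrite -[x]qpi_repr -[y]qpi_repr -[z]qpi_repr.
by rewrite !qmulE mulrA.
Qed.
Lemma qmul1 : left_id (qpi 1) qmul.
Proof. by move=> x; rewrite -[x]qpi_repr qmulE mul1r. Qed.
Lemma qmulr1 : right_id (qpi 1) qmul.
Proof. by move=> x; rewrite -[x]qpi_repr qmulE mulr1. Qed.
Lemma qmulDl : left_distributive qmul +%R.
Proof.
move=> x y z; rewrite -[x]qpi_repr -[y]qpi_repr -[z]qpi_repr.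
by rewrite -qpiD !qmulE mulrDl qpiD.
Qed.
Lemma qmulDr : right_distributive qmul +%R.
Proof.
move=> x y z; rewrite -[x]qpi_repr -[y]qpi_repr -[z]qpi_repr.
by rewrite -qpiD !qmulE mulrDr qpiD.
Qed.
Lemma qscaleAl a x y : a *: qmul x y = qmul (a *: x) y.
Proof.
by rewrite -[x]qpi_repr -[y]qpi_repr -qpiZ !qmulE -qpiZ scalerAl.
Qed.
Lemma qscaleAr a x y : a *: qmul x y = qmul x (a *: y).
Proof.
by rewrite -[x]qpi_repr -[y]qpi_repr -qpiZ !qmulE -qpiZ scalerAr.
Qed.
End QuotientAlgebra.

Section ScalarMorphism.
Variables (K : fieldType) (A : algType K) (aug : A -> K).
Hypotheses (aug_lin : scalar aug) (augM : {morph aug : a b / a * b}).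

Lemma scalar_morphE :
  [/\ aug 0 = 0, forall c a, aug (c *: a) = c * aug a,
      {morph aug : a b / a + b} &
      forall x y z, aug x = 0 -> aug y = 0 -> aug z = 0 ->
        aug (z - (x * y - y * x)) = 0].
Proof.
have aug0 : aug 0 = 0.
  have /= := aug_lin (-1) 0 0; rewrite scaler0 addr0 mulN1r addNr.
  exact: id.
have augZ c a : aug (c *: a) = c * aug a.
  by have := aug_lin c a 0; rewrite addr0 aug0 addr0.
have augD a b : aug (a + b) = aug a + aug b.
  by have := aug_lin 1 a b; rewrite scale1r mul1r.
have augB a b : aug (a - b) = aug a - aug b.
  by rewrite augD -scaleN1r augZ mulN1r.
split=> // x y z x0 y0 z0.
by rewrite !augB !augM x0 y0 z0 mulr0 !subr0.
Qed.

Lemma scalar_morph_linear c x y z :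
  aug x = 0 -> aug y = 0 -> aug z = 0 -> aug (z - (c *: x + y)) = 0.
Proof.
have [_ augZ augD _] := scalar_morphE => x0 y0 z0.
by rewrite augD -scaleN1r augZ augD augZ x0 y0 z0 mulr0 addr0 mulr0 addr0.
Qed.
End ScalarMorphism.

(* The universal enveloping algebra is the free associative algebra on the    *)
(* set L modulo linearity of the generators and x y - y x = [x, y].           *)
Section FreeAlgebra.
Variables (K : fieldType) (L : choiceType).

Definition free_alg := {malg K[{fmonom L}]}.
HB.instance Definition _ := GRing.Lalgebra.on free_alg.
HB.instance Definition _ := GRing.Lalgebra_isAlgebra.Build K free_alg
  (@malg_scalerAr K {fmonom L}).

Definition free_word (w : {fmonom L}) : free_alg := << w >>.
Definition free_gen (x : L) : free_alg := free_word (fmu x).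

Definition free_aug (a : free_alg) : K := mcoeff (fmone L) a.

Lemma free_aug_linear : scalar free_aug.
Proof. by move=> c a b; rewrite /free_aug mcoeffD mcoeffZ. Qed.

Lemma free_augM a b : free_aug (a * b) = free_aug a * free_aug b.
Proof. exact: (mcoeff1g_is_multiplicative _ _).1. Qed.

Lemma free_aug1 : free_aug 1 = 1.
Proof. exact: (mcoeff1g_is_multiplicative _ _).2. Qed.

Lemma free_aug_gen x : free_aug (free_gen x) = 0.
Proof.
rewrite /free_aug /free_gen /free_word mcoeffU mulrb.
by case: eqP => // /eqP; rewrite fmP /= fmuE fmoneE.
Qed.

Lemma free_wordM w w' : free_word w * free_word w' = free_word (fmmul w w').
Proof. by apply: etrans (malgM_def _ _) _; rewrite fgmulUU mulr1. Qed.

Lemma free_algE (a : free_alg) : a = \sum_(w <- msupp a) a@_w *: free_word w.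
Proof.
rewrite {1}[a]monalgE; apply: eq_bigr => w _; apply/malgP => k.
by rewrite [RHS]mcoeffZ [LHS]mcoeffU [X in _ * X]mcoeffU mulrnAr mulr1.
Qed.

Lemma free_alg_ind (Q : free_alg -> Prop) :
  Q 0 -> (forall c w a, Q a -> Q (c *: free_word w + a)) -> forall a, Q a.
Proof.
move=> Q0 QD a; rewrite [a]free_algE.
elim: (msupp a : seq _) => [|w s IHs]; first by rewrite big_nil.
by rewrite big_cons; apply: QD.
Qed.
End FreeAlgebra.

Section Enveloping.
Variables (K : fieldType) (L : lmodType K) (br : L -> L -> L).
Local Notation F := (free_alg K L).

Variant env_rel : F -> Prop :=
| EnvLinear a x y :
    env_rel (free_gen K (a *: x + y) - (a *: free_gen K x + free_gen K y))
| EnvBracket x y :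
    env_rel (free_gen K (br x y)
             - (free_gen K x * free_gen K y - free_gen K y * free_gen K x)).

Local Notation I := (@ideal_gen K (free_alg K L) env_rel).

Definition envalg := qmod I.

Definition env_in (x : L) : envalg := qpi (free_gen K x).

Fact env_oner_neq0 : (qpi 1 : envalg) != 0.
Proof.
apply/eqP; rewrite -qpi0 => /qpi_eq; rewrite subr0 => -[r Sr def1].
have [aug [aug_lin augM aug1 aug_gen]] : exists aug : F -> K,
    [/\ scalar aug, {morph aug : a b / a * b}, aug 1 = 1 &
        forall x, aug (free_gen K x) = 0].
  exists (@free_aug K L); split.
  - exact: free_aug_linear.
  - exact: free_augM.
  - exact: free_aug1.
  - exact: free_aug_gen.
have [aug0 augZ augD augC] := scalar_morphE aug_lin augM.
have aug_rel a : env_rel a -> aug a = 0.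
  case=> [c x y|x y]; last by apply: augC.
  by apply: scalar_morph_linear.
suff: aug 1 = 0 by rewrite aug1 => /eqP; rewrite oner_eq0.
rewrite def1; elim: r Sr {def1} => [|p r IHr] Sr; first by rewrite big_nil.
rewrite big_cons augD augZ IHr => [|q qr]; last first.
  by apply: Sr; rewrite inE qr orbT.
have [u [s [v [rs ->]]]] : I p.2 by apply: Sr; rewrite mem_head.
by rewrite !augM (aug_rel s rs) mulr0 mul0r mulr0 addr0.
Qed.

HB.instance Definition _ := GRing.Zmodule_isNzRing.Build (qmod I)
  (@qmulA K (free_alg K L) env_rel) (@qmul1 K (free_alg K L) env_rel)
  (@qmulr1 K (free_alg K L) env_rel) (@qmulDl K (free_alg K L) env_rel)
  (@qmulDr K (free_alg K L) env_rel) env_oner_neq0.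
HB.instance Definition _ := GRing.Lmodule_isLalgebra.Build K (qmod I)
  (@qscaleAl K (free_alg K L) env_rel).
HB.instance Definition _ := GRing.Lalgebra_isAlgebra.Build K (qmod I)
  (@qscaleAr K (free_alg K L) env_rel).

(* The action of the enveloping algebra on an L-module M, by lifting the      *)
(* action of words in the generators (see env_actE).                          *)
Definition lie_module (M : lmodType K) (rho : L -> M -> M) : Prop :=
  [/\ forall m, linear (rho^~ m), forall x, linear (rho x) &
      forall x y m, rho (br x y) m = rho x (rho y m) - rho y (rho x m)].

Definition free_act (M : lmodType K) (rho : L -> M -> M) (m : M) : F -> M :=
  lext (fun w : {fmonom L} => foldr rho m w).

Definition env_act (M : lmodType K) (rho : L -> M -> M) (a : envalg) (m : M) :
    M :=
  qlift (free_act rho m) a.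

Section EnvelopingAction.
Variables (M : lmodType K) (rho : L -> M -> M) (rhoP : lie_module rho).
Local Notation act a m := (free_act rho m a).

Lemma free_act_linear m : linear (free_act rho m).
Proof. exact: lext_is_linear. Qed.

Lemma free_act_linearr a : linear (fun m => act a m).
Proof.
case: rhoP => _ rho_lin _ c m m'.
rewrite /free_act /lext scaler_sumr -big_split /=; apply: eq_bigr => w _.
have -> : foldr rho (c *: m + m') w = c *: foldr rho m w + foldr rho m' w.
  by elim: (w : seq L) => //= x s ->; rewrite rho_lin.
by rewrite scalerDr !scalerA mulrC.
Qed.

Lemma free_act_word w m : act (free_word K w) m = foldr rho m w.
Proof. exact: lextU. Qed.

Lemma free_act_gen x m : act (free_gen K x) m = rho x m.
Proof. by rewrite free_act_word fmuE. Qed.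

Lemma free_act0 m : act 0 m = 0.
Proof.
have /= := free_act_linear m (-1) 0 0; rewrite scaler0 addr0 scaleN1r addNr.
exact: id.
Qed.

Lemma free_actr0 a : act a 0 = 0.
Proof.
have /= := free_act_linearr a (-1) 0 0; rewrite scaler0 addr0 scaleN1r addNr.
exact: id.
Qed.

Lemma free_actB a b m : act (a - b) m = act a m - act b m.
Proof.
have -> : a - b = (-1) *: b + a by rewrite scaleN1r addrC.
by rewrite free_act_linear scaleN1r addrC.
Qed.

Lemma free_actM a b m : act (a * b) m = act a (act b m).
Proof.
elim/free_alg_ind: a => [|c w a IHa]; first by rewrite mul0r !free_act0.
rewrite mulrDl -scalerAl.
transitivity (c *: act (free_word K w * b) m + act (a * b) m).
  exact: free_act_linear.
apply: etrans; last by symmetry; apply: free_act_linear.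
congr (_ + _); last exact: IHa.
congr (_ *: _).
elim/free_alg_ind: b {IHa} => [|d w' b IHb].
  by rewrite mulr0 !free_act0 free_actr0.
rewrite mulrDr -scalerAr.
transitivity (d *: act (free_word K w * free_word K w') m
              + act (free_word K w * b) m); first exact: free_act_linear.
have -> : act (d *: free_word K w' + b) m = d *: act (free_word K w') m + act b m.
  exact: free_act_linear.
apply: etrans; last by symmetry; apply: free_act_linearr.
congr (_ + _); last exact: IHb.
congr (_ *: _).
by rewrite free_wordM !free_act_word fmmulE foldr_cat.
Qed.

Lemma env_actE (a : F) m : env_act rho (qpi a) m = act a m.
Proof.
apply: qliftE => [|_ [u [r [v [rs ->]]]]]; first exact: free_act_linear.
rewrite !free_actM; set m1 := act v m.
suff -> : act r m1 = 0 by exact: free_actr0.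
case: rhoP => rho_linl _ rho_br; case: rs => [c x y|x y].
  apply: etrans (free_actB _ _ _) _; apply/eqP; rewrite subr_eq0; apply/eqP.
  rewrite free_act_gen rho_linl; symmetry.
  by apply: etrans (free_act_linear _ _ _ _) _; rewrite !free_act_gen.
apply: etrans (free_actB _ _ _) _; apply/eqP; rewrite subr_eq0; apply/eqP.
rewrite free_act_gen rho_br; symmetry; apply: etrans (free_actB _ _ _) _.
by congr (_ - _); apply: etrans (free_actM _ _ _) _; rewrite !free_act_gen.
Qed.
End EnvelopingAction.
End Enveloping.

Section TensorProduct.
Variables (K : fieldType) (S : Type) (M N : lmodType K).
Variables (ract : M -> S -> M) (lact : S -> N -> N).

Definition free_tensor (m : M) (n : N) : {malg K[(M * N)%type]} := << (m, n) >>.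

Variant tensor_rel : {malg K[(M * N)%type]} -> Prop :=
| TensorLinearl a m m' n :
    tensor_rel (free_tensor (a *: m + m') n
                - (a *: free_tensor m n + free_tensor m' n))
| TensorLinearr a m n n' :
    tensor_rel (free_tensor m (a *: n + n')
                - (a *: free_tensor m n + free_tensor m n'))
| TensorBalanced m s n :
    tensor_rel (free_tensor (ract m s) n - free_tensor m (lact s n)).

Definition tensor := qmod tensor_rel.

Definition pure_tensor (m : M) (n : N) : tensor := qpi (free_tensor m n).

(* The map m (x) n |-> f m n induced by a balanced bilinear map f.            *)
Definition tensor_lift (P : lmodType K) (f : M -> N -> P) : tensor -> P :=
  qlift (lext (fun mn : M * N => f mn.1 mn.2)).
End TensorProduct.

(* V (x) K[T] for an additive monoid T: the Laurent polynomials V[t, t^-1]    *)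
(* for T = int, the polynomials V[t] for T = nat. << v *g m >> is v (x) t^m.  *)
Section Loops.
Variables (K : fieldType) (V : lmodType K) (T : choiceType).

Definition loops := {malg V[T]}.
HB.instance Definition _ := GRing.Zmodule.on loops.

Definition loop_scale (a : K) (u : loops) : loops :=
  \sum_(m <- msupp u) << a *: u@_m *g m >>.

Lemma loop_scaleE a u m : (loop_scale a u)@_m = a *: u@_m.
Proof.
rewrite {2}[u]monalgE /loop_scale !raddf_sum; apply: eq_bigr => k _ /=.
by rewrite !mcoeffU scalerMnr.
Qed.

Fact loop_scaleA a b u : loop_scale a (loop_scale b u) = loop_scale (a * b) u.
Proof. by apply/malgP => m; rewrite !loop_scaleE scalerA. Qed.
Fact loop_scale1 : left_id 1 loop_scale.
Proof. by move=> u; apply/malgP => m; rewrite loop_scaleE scale1r. Qed.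
Fact loop_scaleDr : right_distributive loop_scale +%R.
Proof.
by move=> a u v; apply/malgP => m; rewrite mcoeffD !loop_scaleE mcoeffD scalerDr.
Qed.
Fact loop_scaleDl u : {morph loop_scale^~ u : a b / a + b}.
Proof.
by move=> a b; apply/malgP => m; rewrite mcoeffD !loop_scaleE scalerDl.
Qed.

HB.instance Definition _ := GRing.Zmodule_isLmodule.Build K loops
  loop_scaleA loop_scale1 loop_scaleDr loop_scaleDl.
End Loops.

Definition loop_map (K : fieldType) (V W : lmodType K) (T T' : choiceType)
    (f : V -> W) (d : T -> T') (u : loops V T) : loops W T' :=
  \sum_(m <- msupp u) << f u@_m *g d m >>.

Definition loop_bracket (K : fieldType) (V : lmodType K) (T : nmodType)
    (br : V -> V -> V) (u v : loops V T) : loops V T :=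
  \sum_(m <- msupp u) \sum_(n <- msupp v) << br u@_m v@_n *g m + n >>.

Section LieNotions.
Variables (K : fieldType) (g : vectType K) (br : g -> g -> g).

Definition lie_bracket : Prop :=
  [/\ forall x, linear (br x), forall y, linear (br^~ y),
      forall x, br x x = 0 &
      forall x y z, br x (br y z) + br y (br z x) + br z (br x y) = 0].

Definition lie_ideal (I : {vspace g}) : Prop :=
  forall x y, y \in I -> br x y \in I.

Definition simple_lie : Prop :=
  (exists x y, br x y <> 0) /\
  (forall I, lie_ideal I -> I = 0%VS \/ I = fullv).

Definition diagonalizable (f : g -> g) : Prop :=
  exists2 b : seq g, basis_of fullv b & forall v, v \in b -> exists c, f v = c *: v.

(* The usual definition for a complex semisimple Lie algebra: h is abelian,   *)
(* self-centralizing and consists of ad-diagonalizable elements.              *)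
Definition cartan_subalgebra (h : {vspace g}) : Prop :=
  [/\ forall x y, x \in h -> y \in h -> br x y = 0,
      forall x, (forall y, y \in h -> br y x = 0) -> x \in h &
      forall y, y \in h -> diagonalizable (br y)].

Definition invariant_form (form : g -> g -> K) : Prop :=
  [/\ forall x, scalar (form x), forall x y, form x y = form y x,
      forall x, (forall y, form x y = 0) -> x = 0 &
      forall x y z, form (br x y) z = form x (br y z)].

(* h is identified with its dual by the form, so that roots lie in h.         *)
Definition root_vector (h : {vspace g}) (form : g -> g -> K) (v x : g) : Prop :=
  x != 0 /\ forall y, y \in h -> br y x = form v y *: x.

Definition is_root (h : {vspace g}) (form : g -> g -> K) (v : g) : Prop :=
  [/\ v \in h, v != 0 & exists x, root_vector h form v x].

Definition nonneg_comb (l : nat) (alpha : 'I_l -> g) (v : g) : Prop :=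
  exists c : 'I_l -> nat, v = \sum_j alpha j *+ c j.

Definition simple_roots (h : {vspace g}) (form : g -> g -> K) (l : nat)
    (alpha : 'I_l -> g) : Prop :=
  [/\ basis_of h [seq alpha j | j : 'I_l],
      forall j, is_root h form (alpha j) &
      forall v, is_root h form v ->
        nonneg_comb alpha v \/ nonneg_comb alpha (- v)].
End LieNotions.

(* Dynkin diagrams on the nodes 0, ..., l - 1. A branched diagram is a chain  *)
(* 0 - 1 - ... - (l - 2) whose node k is also joined to the node l - 1.       *)
Definition chain_edge (i j : nat) : bool := j == i.+1.
Definition branched_edge (l k i j : nat) : bool :=
  (j == i.+1) && (j < l.-1)%N || (i == k) && (j == l.-1).

Variant ade_diagram (l : nat) : (nat -> nat -> bool) -> Prop :=
| TypeA of (0 < l)%N : ade_diagram l chain_edge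
| TypeD of (4 <= l)%N : ade_diagram l (branched_edge l (l - 3))
| TypeE of (6 <= l <= 8)%N : ade_diagram l (branched_edge l 2).

Definition diagram_entry (e : nat -> nat -> bool) (i j : nat) : int :=
  if i == j then 2 else if e i j || e j i then -1 else 0.

Definition ade_matrix (l : nat) (A : 'M[int]_l) : Prop :=
  exists2 e, ade_diagram l e &
    exists s : 'S_l, forall i j, A i j = diagram_entry e (s i) (s j).

(* The coordinates of a weight in the basis of fundamental weights.           *)
Definition weights (l : nat) := 'rV[int]_l.

(* For a realType R, R[i] is the field of complex numbers. A weight is given  *)
(* by its coordinates, so that Q and Delta are predicates on weights.         *)
Record ade_lie_algebra (R : realType) := AdeLieAlgebra {
  lie : vectType R[i];
  br : lie -> lie -> lie;
  brP : lie_bracket br;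
  br_simple : simple_lie br;
  csa : {vspace lie};
  csaP : cartan_subalgebra br csa;
  invform : lie -> lie -> R[i];
  formP : invariant_form br invform;
  form_normalized : forall v, is_root br csa invform v -> invform v v = 2;
  rank : nat;
  alpha : 'I_rank -> lie;
  alphaP : simple_roots br csa invform alpha;
  cartan_mx : 'M[int]_rank;
  cartan_mxP : forall i j, invform (alpha i) (alpha j) = (cartan_mx i j)%:~R;
  cartan_mx_ade : ade_matrix cartan_mx;
  fweight : 'I_rank -> lie;
  fweight_csa : forall i, fweight i \in csa;
  fweightP : forall i j, invform (fweight i) (alpha j) = (i == j)%:R;
  pos_roots : seq (weights rank);
  pos_rootsP : forall b : weights rank,
    let v := \sum_i fweight i *~ b 0 i in
    b \in pos_roots <-> is_root br csa invform v /\ nonneg_comb alpha v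
}.

Arguments br {R} D x y : rename.
Arguments invform {R} D x y : rename.
Arguments alpha {R} D j : rename.
Arguments fweight {R} D i : rename.

Section WeightLattice.
Variables (R : realType) (D : ade_lie_algebra R).
Local Notation C := R[i].
Local Notation P := (weights (rank D)).

Definition wt (b : P) : lie D := \sum_i fweight D i *~ b 0 i.

Definition wt_form (b c : P) : C := invform D (wt b) (wt c).

Definition root_wt (b : P) : Prop := is_root (br D) (csa D) (invform D) (wt b).

Definition in_root_lattice (b : P) : Prop :=
  exists c : 'I_(rank D) -> int, wt b = \sum_j alpha D j *~ c j.

(* alpha_j = sum_i <alpha_j, alpha_i> lambda_i *)
Definition alpha_wt (j : 'I_(rank D)) : P := row j (cartan_mx D).

(* The index 0 stands for lambda_0 = 0, and j + 1 for the j-th fundamental    *)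
(* weight (counting from 0).                                                  *)
Definition lambda_wt (i : 'I_(rank D).+1) : P :=
  if unlift ord0 i is Some j then delta_mx 0 j else 0.

Record weight_cocycle := WeightCocycle {
  eps :> P -> P -> C;
  eps_order : nat;
  eps_order_gt0 : (0 < eps_order)%N;
  eps_root : forall a b, eps a b ^+ eps_order = 1;
  eps_cocycle : forall a b c,
    eps a b * eps (a + b) c = eps b c * eps a (b + c);
  eps0r : forall a, eps a 0 = 1;
  eps0l : forall a, eps 0 a = 1;
  eps_commDl : forall a b c,
    eps (a + b) c / eps c (a + b) = (eps a c / eps c a) * (eps b c / eps c b);
  eps_commDr : forall a b c,
    eps a (b + c) / eps (b + c) a = (eps a b / eps b a) * (eps a c / eps c a);
  eps_comm_root : forall a b (n : int),
    in_root_lattice a -> in_root_lattice b -> wt_form a b = n%:~R ->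
    eps a b / eps b a = (-1) ^ n
}.
End WeightLattice.

(* V_P = M(1) (x) C[P]. A monomial in the variables (j, k), where (j, k)      *)
(* stands for alpha_j (x) t^(- k - 1), is a basis vector of the symmetric     *)
(* algebra M(1), and (mu, b) stands for mu (x) e^b.                           *)
Section VertexOperators.
Variables (R : realType) (D : ade_lie_algebra R) (E : weight_cocycle D).
Local Notation C := R[i].
Local Notation P := (weights (rank D)).

Definition fock_monomial := {cmonom ('I_(rank D) * nat)%type}.

Definition VP := {malg C[(fock_monomial * P)%type]}.

Definition fock_vec (mu : fock_monomial) (b : P) : VP := << (mu, b) >>.

Definition expv (b : P) : VP := fock_vec (onecm _) b.

(* h(m), for h in the Cartan subalgebra: for m < 0, multiplication by         *)
(* h (x) t^m = \sum_j <h, lambda_j> alpha_j (x) t^m, and for m > 0 the        *)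
(* derivation of M(1) mapping alpha_j (x) t^-m to m <h, alpha_j>.             *)
Definition heis_op (h : lie D) (m : int) : VP -> VP :=
  lext (fun mb : fock_monomial * P =>
    match m with
    | Posz 0 => invform D h (wt mb.2) *: fock_vec mb.1 mb.2
    | Posz k.+1 =>
        \sum_j (k.+1%:R * invform D h (alpha D j) * (mb.1 (j, k))%:R)
                 *: fock_vec (divcm mb.1 (ucm (j, k))) mb.2
    | Negz k =>
        \sum_j invform D h (fweight D j) *: fock_vec (mulcm (ucm (j, k)) mb.1) mb.2
    end).

(* Coefficients of A(x)^k and of exp A(x), for A(x) = \sum_(n > 0) A_n x^n    *)
(* with coefficients A_n in End V_P.                                          *)
Fixpoint series_pow (A : nat -> VP -> VP) (k a : nat) (v : VP) : VP :=
  if k is k'.+1 then \sum_(1 <= n < a.+1) A n (series_pow A k' (a - n) v)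
  else if a == 0%N then v else 0.

Definition series_exp (A : nat -> VP -> VP) (a : nat) (v : VP) : VP :=
  \sum_(k < a.+1) (k`!%:R : C)^-1 *: series_pow A k a v.

(* The coefficient of x^a in E^-(-b, x) and that of x^-a in E^+(-b, x).       *)
Definition Eminus (b : P) : nat -> VP -> VP :=
  series_exp (fun n v => - ((- n%:Z)%:~R : C)^-1 *: heis_op (wt b) (- n%:Z) v).
Definition Eplus (b : P) : nat -> VP -> VP :=
  series_exp (fun n v => - (n%:Z%:~R : C)^-1 *: heis_op (wt b) n%:Z v).

(* The coefficient of x^(- m - 1) in Y(e^b, x) = E^- E^+ e_b x^b, for b a     *)
(* root: x^b multiplies mu (x) e^c by x^<b, c>. Only finitely many terms of   *)
(* the sum are nonzero, because E^+ is locally finite.                        *)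
Definition vertex_op (b : P) (m : int) : VP -> VP :=
  lext (fun mc : fock_monomial * P =>
    \sum_(pq \in [set pq : nat * nat |
             (pq.1%:Z - pq.2%:Z)%:~R + wt_form b mc.2 = (- m - 1)%:~R :> C])
      Eminus b pq.1 (Eplus b pq.2 (E b mc.2 *: fock_vec mc.1 (b + mc.2)))).

Definition affine := (loops (lie D) int * C^o)%type.

Definition affine_bracket (u v : affine) : affine :=
  (loop_bracket (br D) u.1 v.1,
   \sum_(m <- msupp u.1) \sum_(n <- msupp v.1)
     if m + n == 0 then m%:~R * invform D u.1@_m v.1@_n else 0).

Definition affine_elt (x : lie D) (m : int) : affine := (<< x *g m >>, 0).

(* The normalization of the root vectors rvec: the operators above make V_P   *)
(* a level one module, with action aact, over the affine algebra.             *)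
Record affine_action := AffineAction {
  rvec : P -> lie D;
  rvecP : forall b, root_wt b ->
    root_vector (br D) (csa D) (invform D) (wt b) (rvec b);
  aact : affine -> VP -> VP;
  aact_module : lie_module affine_bracket aact;
  aact_level : forall v, aact (0, 1) v = v;
  aact_heis : forall h m v, h \in csa D ->
    aact (affine_elt h m) v = heis_op h m v;
  aact_rvec : forall b m v, root_wt b ->
    aact (affine_elt (rvec b) m) v = vertex_op b m v
}.
End VertexOperators.

Section PrincipalSubspaces.
Variables (R : realType) (D : ade_lie_algebra R) (E : weight_cocycle D).
Variable X : affine_action E.
Local Notation C := R[i].

Definition nilrad : {vspace lie D} := <<[seq rvec X b | b <- pos_roots D]>>%VS.
Definition nilpart := subvs_of nilrad.

(* nilrad is closed under the bracket, so that the projection is immaterial.  *)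
Definition nil_bracket (x y : nilpart) : nilpart :=
  vsproj nilrad (br D (vsval x) (vsval y)).

Definition nbar := loops nilpart int.
Definition nbar_bracket : nbar -> nbar -> nbar := loop_bracket nil_bracket.

Definition nbarp := loops nilpart nat.
Definition nbarp_bracket : nbarp -> nbarp -> nbarp := loop_bracket nil_bracket.

Definition nbarp_in (u : nbarp) : nbar := loop_map id Posz u.
Definition nbar_in (u : nbar) : affine D := (loop_map vsval id u, 0).

Definition Unbar := envalg nbar_bracket.
Definition Unbarp := envalg nbarp_bracket.

Definition U_in (u : nbar) : Unbar := env_in nbar_bracket u.

Definition xalpha (j : 'I_(rank D)) (m : int) : Unbar :=
  U_in << vsproj nilrad (rvec X (alpha_wt j)) *g m >>.

Definition U_act : Unbar -> VP D -> VP D :=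
  env_act (fun u : nbar => aact X (nbar_in u)).

Definition vlambda (i : 'I_(rank D).+1) : VP D := expv (lambda_wt i).

(* The common codomain of f_ and pi_ below. These are defined with values in   *)
(* V_P, which does not affect their kernels.                                  *)
Definition W_ (i : 'I_(rank D).+1) : set (VP D) :=
  [set w | exists a, w = U_act a (vlambda i)].

Definition f_ (i : 'I_(rank D).+1) (a : Unbar) : VP D := U_act a (vlambda i).

(* The algebra morphism U(nbar_+) -> U(nbar).                                 *)
Definition Unbarp_in (a : Unbarp) : Unbar :=
  env_act (fun (u : nbarp) (b : Unbar) => U_in (nbarp_in u) * b) a 1.

(* W^N = U(nbar) (x)_(U(nbar_+)) C v^N, where C v^N is C with nbar_+ acting   *)
(* by 0; it is the same module for all the lambda_i.                          *)
Definition triv_act : Unbarp -> C^o -> C^o :=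
  env_act (fun (_ : nbarp) (_ : C^o) => 0).

Definition WN := tensor (fun (a : Unbar) (s : Unbarp) => a * Unbarp_in s) triv_act.

Definition vN : WN := pure_tensor _ _ 1 1.

Definition WN_act (a : Unbar) : WN -> WN :=
  tensor_lift (fun b z => pure_tensor _ _ (a * b) z : WN).

Definition pi_ (i : 'I_(rank D).+1) : WN -> VP D :=
  tensor_lift (fun a (z : C^o) => z *: U_act a (vlambda i)).

Definition lideal (S : set Unbar) : set Unbar :=
  [set a | exists2 r : seq (Unbar * Unbar),
     forall p, p \in r -> S p.2 & a = \sum_(p <- r) p.1 * p.2].

(* k runs over - m_1; then m_2 = - (t - k). *)
Definition Rrel (j : 'I_(rank D)) (t : nat) : Unbar :=
  \sum_(1 <= k < t) xalpha j (- k%:Z) * xalpha j (- (t - k)%N%:Z).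

Definition Jideal : set Unbar :=
  lideal [set r | exists j t, (2 <= t)%N /\ r = Rrel j t].

Definition Uplus : set Unbar :=
  lideal [set r | exists u : nbarp, r = U_in (nbarp_in u)].

Definition I0 : set Unbar := [set a + b | a in Jideal & b in Uplus].

Definition I_ (i : 'I_(rank D).+1) : set Unbar :=
  if unlift ord0 i is Some j then
    [set a + b * xalpha j (-1) | a in I0 & b in [set: Unbar]]
  else I0.
End PrincipalSubspaces.

(* Main.v *)
(* Write x_j(m) for x_{alpha_j}(m); these generate U(nbar). The translation   *)
(* e_lambda intertwines, up to signs, the action of a on e^lambda with that   *)
(* on e^0 of its twist by x_b(m) |-> x_b(m + <lambda, b>): everything reduces *)
(* to K = Ker f_{lambda_0} and I = I_{lambda_0}. The relations R_t e^0 = 0,   *)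
(* hence I <= K, follow by induction on t: h(n) R_t e^0 is a multiple of      *)
(* R_{t-n} e^0, so R_t e^0 is a multiple of e^{2 alpha} and conformal weight  *)
(* leaves only t = 4.                                                         *)
(*   For K <= I, let a in K be homogeneous of content s (number of letters of *)
(* each simple root), and let tau_i be the twist by the fundamental weight i: *)
(* x_i(m) |-> x_i(m + 1). On words of fixed content tau_i is an elementary    *)
(* symmetric function of the degree shifts, whose power sums are the action of*)
(* lambda_i(n), so by Newton's identities tau_i preserves K. If i occurs in s *)
(* then tau_i^N a lies in I for N large, as the letters x_i(m + N) can be     *)
(* moved to the right into nbar_+. Descend on N: if tau_i a in I, then        *)
(* a = b + c x_i(-1) with b in I, and since x_i(-1) e^0 = e^{alpha_i}, the    *)
(* twist of c by alpha_i is an element of K with one letter fewer; by         *)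
(* induction it is in I, and this implies c x_i(-1) in I.                     *)

From HB Require Import structures.
From mathcomp Require Import all_boot all_order all_fingroup all_algebra.
From mathcomp Require Import finmap boolp classical_sets functions cardinality.
From mathcomp Require Import fsbigop reals complex.
From mathcomp Require Import generic_quotient ring_quotient monalg.
From mathcomp Require Import zify ring lra.
Require Import Defs.

Set Implicit Arguments.
Unset Strict Implicit.
Unset Printing Implicit Defensive.

Import Order.TTheory GRing.Theory Num.Theory.
Local Open Scope ring_scope.
Local Open Scope classical_set_scope.

(** * Linear maps, enveloping algebras, tensor products and loops *)

(** That the ideal annihilates the highest weight vector is a computation in the Fock space.
    [heis_square] shows how the Heisenberg modes move the quadratic relations among each other, and
    [square_vacuum] concludes that all of them vanish on the vacuum, the exceptional weight 4 being
    settled by hand in [square_vac4].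

    The converse uses no basis or character of $W(\lambda_i)$. In [homogeneous_ann] a homogeneous
    element of the annihilator is raised by fundamental weight twists. It remains in the annihilator
    ([ann_shift], a consequence of Newton's identities) and finally lies in the ideal
    ([I0_shift_large]). It is then lowered one step at a time. Each step costs only a left multiple
    of $x_i(-1)$ ([I0_untwist_weight]); the cofactor annihilates $e^{\alpha_i}$, hence its twist by
    $\alpha_i$ annihilates the vacuum and has one letter fewer. The induction hypothesis puts that
    twist in the ideal, and [I0_untwist_root] brings the cofactor times $x_i(-1)$ back into the
    ideal. General elements reduce to homogeneous ones, because the zero modes separate contents.

    This argument is carried out for an abstract algebra in [PrincipalCore]. Its hypotheses come
    from two sources. All roots have norm 2, which gives one-dimensional root spaces, the brackets
    of simple root vectors and generation by them ([root_space1], [br_weight0], [pos_root_ind]). The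
    vertex operators give the Heisenberg commutators ([heis_mode]) and the translation between
    $e^\lambda$ and the vacuum ([U_act_expv]). [vacuum_annihilators] puts the two together.

    The statement on $\pi_{\lambda_i}$ follows from the one on $f_{\lambda_i}$, since every element
    of the induced module has the form $a\otimes 1$ ([WN_pure]). *)

Section LinearFunctions.
Variables (K : fieldType) (V W : lmodType K) (f : V -> W).
Hypothesis f_lin : linear f.

Lemma lin0 : f 0 = 0.
Proof. by have := f_lin (-1) 0 0; rewrite scaler0 addr0 scaleN1r addNr. Qed.

Lemma linD u v : f (u + v) = f u + f v.
Proof. by rewrite -[u in LHS]scale1r f_lin scale1r. Qed.

Lemma linZ a v : f (a *: v) = a *: f v.
Proof. by rewrite -[a *: v]addr0 f_lin lin0 addr0. Qed.

Lemma linN v : f (- v) = - f v.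
Proof. by rewrite -!scaleN1r linZ. Qed.

Lemma linB u v : f (u - v) = f u - f v.
Proof. by rewrite linD linN. Qed.

Lemma lin_sum (I : Type) (r : seq I) (P : pred I) (F : I -> V) :
  f (\sum_(i <- r | P i) F i) = \sum_(i <- r | P i) f (F i).
Proof. exact: (big_morph f linD lin0). Qed.
End LinearFunctions.

Lemma comp_lin (K : fieldType) (U V W : lmodType K) (f : V -> W) (g : U -> V) :
  linear f -> linear g -> linear (fun u => f (g u)).
Proof. by move=> f_lin g_lin a u v; rewrite g_lin f_lin. Qed.

Lemma lin_scaler (K : fieldType) (V W : lmodType K) (f : V -> W) (c : K) :
  linear f -> linear (fun v => c *: f v).
Proof. by move=> f_lin a u v; rewrite f_lin scalerDr !scalerA mulrC. Qed.

Lemma lin_sumf (K : fieldType) (V W : lmodType K) (I : Type) (r : seq I)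
    (P : pred I) (f : I -> V -> W) :
  (forall i, linear (f i)) -> linear (fun v => \sum_(i <- r | P i) f i v).
Proof.
move=> f_lin a u v; rewrite scaler_sumr -big_split.
by apply: eq_bigr => i _; rewrite f_lin.
Qed.

Section Subspaces.
Variables (K : fieldType) (V : lmodType K).

Definition subspace (S : V -> Prop) : Prop :=
  S 0 /\ forall a u v, S u -> S v -> S (a *: u + v).

Variable S : V -> Prop.
Hypothesis S_sub : subspace S.

Lemma subspaceD u v : S u -> S v -> S (u + v).
Proof. by rewrite -{2}[u]scale1r; apply: S_sub.2. Qed.

Lemma subspaceZ a u : S u -> S (a *: u).
Proof. by move=> Su; rewrite -[_ *: _]addr0; apply: S_sub.2 Su S_sub.1. Qed.

Lemma subspaceN u : S u -> S (- u).
Proof. by rewrite -scaleN1r; apply: subspaceZ. Qed.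

Lemma subspaceB u v : S u -> S v -> S (u - v).
Proof. by move=> Su /subspaceN; apply: subspaceD. Qed.

Lemma subspaceKr u v : S v -> S (u + v) -> S u.
Proof. by move=> Sv Suv; rewrite -(addrK v u); apply: subspaceB. Qed.

Lemma subspaceKl u v : S u -> S (u + v) -> S v.
Proof. by rewrite addrC; apply: subspaceKr. Qed.

Lemma subspace_sum (I : eqType) (r : seq I) (F : I -> V) :
  (forall i, i \in r -> S (F i)) -> S (\sum_(i <- r) F i).
Proof.
move=> SF; rewrite big_seq_cond; elim/big_rec: _ => [|i u].
  exact: S_sub.1.
by rewrite andbT => /SF; apply: subspaceD.
Qed.

Lemma subspaceZr c u : c != 0 -> S (c *: u) -> S u.
Proof. by move=> c0 /(subspaceZ c^-1); rewrite scalerA mulVf ?scale1r. Qed.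

(* Applying T - e_n kills the last eigenvector; then induct.                  *)
Lemma eigen_separate (T : V -> V) (e : nat -> K) (F : nat -> V) (n : nat) :
  linear T -> (forall v, S v -> S (T v)) -> injective e ->
  (forall k, T (F k) = e k *: F k) ->
  S (\sum_(k < n) F k) -> forall k, (k < n)%N -> S (F k).
Proof.
move=> T_lin ST e_inj; elim: n F => // n IHn F TF SF.
have SF' k : (k < n)%N -> S (F k).
  move=> ltkn; have /subspaceZr: S ((e k - e n) *: F k).
    apply: (IHn (fun k => (e k - e n) *: F k)) => // [j|].
      by rewrite (linZ T_lin) TF !scalerA mulrC.
    have := subspaceB (ST _ SF) (subspaceZ (e n) SF).
    rewrite !big_ord_recr /= (linD T_lin) TF scalerDr opprD addrACA subrr addr0.
    rewrite (lin_sum T_lin) scaler_sumr -sumrB => SF'; congr (S _): SF'.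
    by apply: eq_bigr => i _; rewrite TF -scalerBl.
  by apply; rewrite subr_eq0; apply/eqP => /e_inj def_k; rewrite def_k ltnn in ltkn.
move=> k; rewrite ltnS leq_eqVlt => /orP[/eqP->|]; last exact: SF'.
have -> : F n = \sum_(k < n.+1) F k - \sum_(k < n) F k.
  by rewrite big_ord_recr /= [_ + F n]addrC addrK.
by apply: subspaceB => //; apply: subspace_sum => i _; apply: SF'.
Qed.
End Subspaces.

Lemma qpiB (K : fieldType) (V : lmodType K) (S : set V) (u v : V) :
  (qpi (u - v) : qmod S) = qpi u - qpi v.
Proof. exact: linB (@qpi_is_linear K V S) u v. Qed.

Lemma equalizer_subspace (K : fieldType) (V W : lmodType K) (f g : V -> W) :
  linear f -> linear g -> subspace (fun v => f v = g v).
Proof.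
move=> f_lin g_lin; split=> [|a u v fgu fgv]; first by rewrite (lin0 f_lin) (lin0 g_lin).
by rewrite f_lin g_lin fgu fgv.
Qed.

Section EnvelopingTheory.
Variables (K : fieldType) (L : lmodType K) (br : L -> L -> L).
Local Notation F := (free_alg K L).
Local Notation U := (envalg br).
Local Notation inU := (env_in br).

Lemma qpi_rel (r : F) : env_rel br r -> (qpi r : U) = 0.
Proof.
move=> rel_r; rewrite -qpi0; apply/qpi_eq; rewrite subr0; apply: mem_span.
by exists 1, r, 1; rewrite mul1r mulr1.
Qed.

Lemma qpiM (u v : F) : (qpi (u * v) : U) = qpi u * qpi v.
Proof. by rewrite -qmulE. Qed.

Lemma env_in_lin : linear inU.
Proof.
move=> a x y; apply/eqP; rewrite -subr_eq0; apply/eqP.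
have := qpi_rel (EnvLinear br a x y) => <-.
by rewrite (linB (@qpi_is_linear _ _ _)) qpiD qpiZ.
Qed.

Lemma env_in_br x y : inU (br x y) = inU x * inU y - inU y * inU x.
Proof.
apply/eqP; rewrite -subr_eq0; apply/eqP.
apply: etrans (qpi_rel (EnvBracket br x y)); rewrite /env_in.
have mulE u v : qpi (free_gen K u * free_gen K v) =
    qpi (free_gen K u) * qpi (free_gen K v) :> U by exact: qpiM.
rewrite -(mulE x y) -(mulE y x).
have subE := @qpiB K F (ideal_gen (env_rel br)).
by symmetry; rewrite subE; congr (_ - _); apply: subE.
Qed.

Lemma env_ind (Q : U -> Prop) :
  subspace Q -> Q 1 -> (forall x a, Q a -> Q (inU x * a)) -> forall a, Q a.
Proof.
move=> Q_sub Q1 QM a; rewrite -[a]qpi_repr.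
elim/free_alg_ind: (repr a) => [|c w u Qu]; first by rewrite qpi0; exact: Q_sub.1.
rewrite qpiD qpiZ; apply: Q_sub.2 => // {u Qu}.
case: w => w; elim: w => [|x w IHw]; first by rewrite -fmoneE; exact: Q1.
have -> : FMonom (x :: w) = fmmul (fmu x) (FMonom w) by rewrite fmmulE fmuE.
by rewrite -free_wordM qpiM; exact: QM.
Qed.

Section Action.
Variables (M : lmodType K) (rho : L -> M -> M).
Hypothesis rhoP : lie_module br rho.
Local Notation act := (@env_act K L br M rho).

Lemma env_act_linl m : linear (act^~ m).
Proof.
move=> c a b; rewrite -[a]qpi_repr -[b]qpi_repr -qpiZ -qpiD.
by rewrite !(env_actE rhoP) free_act_linear.
Qed.

Lemma env_act_linr a : linear (act a).
Proof.
by move=> c m n; rewrite -[a]qpi_repr !(env_actE rhoP) (free_act_linearr rhoP).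
Qed.

Lemma env_actM a b m : act (a * b) m = act a (act b m).
Proof.
rewrite -[a]qpi_repr -[b]qpi_repr -qpiM !(env_actE rhoP).
exact: (free_actM rhoP).
Qed.

Lemma env_act1 m : act 1 m = m.
Proof.
rewrite (env_actE rhoP); apply: etrans (free_act_word rho (fmone L) m) _.
by rewrite fmoneE.
Qed.

Lemma env_act_in x m : act (inU x) m = rho x m.
Proof. by rewrite (env_actE rhoP) free_act_gen. Qed.
End Action.

Section Lift.
Variables (A : algType K) (f : L -> A).
Hypothesis f_lin : linear f.
Hypothesis f_br : forall x y, f (br x y) = f x * f y - f y * f x.

(** The universal property is obtained from the action: the Lie algebra acts on [A] by left
    multiplication through [f], and the morphism is the orbit map of 1. *)
Definition env_lift (a : U) : A := @env_act K L br A (fun x b => f x * b) a 1.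

Lemma lift_module : lie_module br (fun x (b : A) => f x * b).
Proof.
split=> [b c x y|x c a b|x y b].
- by rewrite f_lin mulrDl scalerAl.
- by rewrite mulrDr scalerAr.
by rewrite f_br mulrBl !mulrA.
Qed.

Lemma env_lift_act a b :
  @env_act K L br A (fun x c => f x * c) a b = env_lift a * b.
Proof.
rewrite /env_lift; elim/env_ind: a => [|| x a IHa].
- split=> [|c u v IHu IHv].
    by rewrite !(lin0 (env_act_linl lift_module _)) mul0r.
  by rewrite !(env_act_linl lift_module) mulrDl -scalerAl IHu IHv.
- by rewrite !(env_act1 lift_module) mul1r.
by rewrite !(env_actM lift_module) IHa !(env_act_in lift_module) mulrA.
Qed.

Lemma env_lift_lin : linear env_lift.
Proof. exact: env_act_linl lift_module 1. Qed.

Lemma env_liftM a b : env_lift (a * b) = env_lift a * env_lift b.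
Proof. by rewrite {1}/env_lift (env_actM lift_module) env_lift_act. Qed.

Lemma env_lift1 : env_lift 1 = 1.
Proof. exact: env_act1 lift_module 1. Qed.

Lemma env_lift_in x : env_lift (inU x) = f x.
Proof. by rewrite /env_lift (env_act_in lift_module) mulr1. Qed.
End Lift.
End EnvelopingTheory.

Section TensorTheory.
Variables (K : fieldType) (S : Type) (M N : lmodType K).
Variables (ract : M -> S -> M) (lact : S -> N -> N).
Local Notation pure := (pure_tensor ract lact).

Lemma tensor_rel0 (r : {malg K[(M * N)%type]}) :
  tensor_rel ract lact r -> (qpi r : tensor ract lact) = 0.
Proof.
by move=> rel_r; rewrite -qpi0; apply/qpi_eq; rewrite subr0; apply: mem_span.
Qed.

Lemma pure_linl n : linear (pure^~ n).
Proof.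
move=> a m m'; apply/eqP; rewrite -subr_eq0; apply/eqP.
have := tensor_rel0 (TensorLinearl ract lact a m m' n).
by rewrite (linB (@qpi_is_linear _ _ _)) qpiD qpiZ.
Qed.

Lemma pure_linr m : linear (pure m).
Proof.
move=> a n n'; apply/eqP; rewrite -subr_eq0; apply/eqP.
have := tensor_rel0 (TensorLinearr ract lact a m n n').
by rewrite (linB (@qpi_is_linear _ _ _)) qpiD qpiZ.
Qed.

Lemma tensor_ind (Q : tensor ract lact -> Prop) :
  subspace Q -> (forall m n, Q (pure m n)) -> forall w, Q w.
Proof.
move=> Q_sub Qpure w; rewrite -[w]qpi_repr.
rewrite [repr w]monalgE (lin_sum (@qpi_is_linear _ _ _)).
apply: subspace_sum => // -[m n] _.
have -> : (<< (repr w)@_(m, n) *g (m, n) >> : {malg K[(M * N)%type]}) =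
    (repr w)@_(m, n) *: free_tensor m n.
  by apply/malgP => k; rewrite mcoeffZ !mcoeffU mulrnAr mulr1.
by rewrite qpiZ; apply: (subspaceZ Q_sub); apply: Qpure.
Qed.

Lemma tensor_liftE (P : lmodType K) (f : M -> N -> P) m n :
  (forall n, linear (f^~ n)) -> (forall m, linear (f m)) ->
  (forall m s n, f (ract m s) n = f m (lact s n)) ->
  tensor_lift f (pure m n) = f m n.
Proof.
move=> f_linl f_linr f_bal; rewrite /tensor_lift /pure_tensor.
have f0 r : tensor_rel ract lact r ->
    lext (fun mn : M * N => f mn.1 mn.2) r = 0; last first.
  by rewrite (qliftE _ _ f0) ?lextU //; apply: lext_is_linear.
case=> [a u v k|a u k k'|u s k].
- rewrite (linB (@lext_is_linear _ _ _ _)) lext_is_linear !lextU f_linl.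
  exact: subrr.
- rewrite (linB (@lext_is_linear _ _ _ _)) lext_is_linear !lextU f_linr.
  exact: subrr.
by rewrite (linB (@lext_is_linear _ _ _ _)) !lextU f_bal subrr.
Qed.
End TensorTheory.

Section LoopTheory.
Variables (K : fieldType) (V : lmodType K) (T : choiceType).
Local Notation loops := (loops V T).

Lemma loop_coefZ (a : K) (u : loops) m : (a *: u)@_m = a *: u@_m.
Proof. exact: loop_scaleE. Qed.

Lemma loopU_lin (m : T) : linear (fun x : V => << x *g m >> : loops).
Proof.
move=> a x y; apply/malgP => k; rewrite mcoeffD loop_coefZ !mcoeffU.
by case: eqP; rewrite ?mulr1n ?mulr0n ?scaler0 ?addr0.
Qed.

Lemma loop_ind (Q : loops -> Prop) :
  subspace Q -> (forall x m, Q << x *g m >>) -> forall u, Q u.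
Proof.
move=> Q_sub QU u; rewrite [u]monalgE.
by apply: (subspace_sum Q_sub) => m _; apply: QU.
Qed.

Section Extension.
Variables (W : lmodType K) (f : T -> V -> W).
Hypothesis f_lin : forall m, linear (f m).

Definition loop_ext (u : loops) : W := \sum_(m <- msupp u) f m u@_m.

Lemma loop_extEw (d : {fset T}) (u : loops) :
  (msupp u `<=` d)%fset -> loop_ext u = \sum_(m <- d) f m u@_m.
Proof.
move=> le_ud; rewrite /loop_ext (big_fset_incl _ le_ud) // => m _.
by move=> /mcoeff_outdom ->; rewrite (lin0 (f_lin m)).
Qed.

Lemma loop_ext_lin : linear loop_ext.
Proof.
move=> a u v; set d := (msupp u `|` msupp v `|` msupp (a *: u + v))%fset.
rewrite !(@loop_extEw d) ?fsubsetUr //; first last.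
- by rewrite /d -fsetUA fsubsetUl.
- by rewrite /d [(msupp u `|` _)%fset]fsetUC -fsetUA fsubsetUl.
rewrite scaler_sumr -big_split; apply: eq_bigr => m _ /=.
by rewrite mcoeffD loop_coefZ f_lin.
Qed.

Lemma loop_extU x m : loop_ext << x *g m >> = f m x.
Proof. by rewrite (@loop_extEw [fset m]%fset) ?msuppU_le // big_seq_fset1 mcoeffUU. Qed.
End Extension.

Lemma loop_eq (W : lmodType K) (f g : loops -> W) :
  linear f -> linear g -> (forall x m, f << x *g m >> = g << x *g m >>) -> f =1 g.
Proof.
move=> f_lin g_lin fg; apply: loop_ind fg; split=> [|a u v fgu fgv].
  by rewrite (lin0 f_lin) (lin0 g_lin).
by rewrite f_lin g_lin fgu fgv.
Qed.
End LoopTheory.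

Section LoopMaps.
Variables (K : fieldType) (V W : lmodType K) (T T' : choiceType).
Variables (f : V -> W) (d : T -> T').
Hypothesis f_lin : linear f.

Let ext_lin m : linear (fun x : V => << f x *g d m >> : loops W T').
Proof. by move=> a x y; rewrite f_lin loopU_lin. Qed.

Lemma loop_map_lin : linear (loop_map f d : loops V T -> loops W T').
Proof. exact: (loop_ext_lin ext_lin). Qed.

Lemma loop_mapU x m :
  loop_map f d (<< x *g m >> : loops V T) = << f x *g d m >> :> loops W T'.
Proof. exact: (loop_extU ext_lin). Qed.
End LoopMaps.

Section LoopBracket.
Variables (K : fieldType) (V : lmodType K) (T : nmodType) (br : V -> V -> V).
Hypothesis br_linl : forall y, linear (br^~ y).
Hypothesis br_linr : forall x, linear (br x).
Local Notation lbr := (@loop_bracket K V T br).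

Let extr_lin x m n : linear (fun y => << br x y *g m + n >> : loops V T).
Proof. by move=> a y z; rewrite br_linr loopU_lin. Qed.

Let extl_lin (v : loops V T) m :
  linear (fun x => loop_ext (fun n y => << br x y *g m + n >> : loops V T) v).
Proof.
by apply: lin_sumf => n a x y; rewrite br_linl loopU_lin.
Qed.

Lemma loop_bracket_linl v : linear (lbr^~ v).
Proof. exact: (loop_ext_lin (extl_lin v)). Qed.

Lemma loop_bracket_linr u : linear (lbr u).
Proof. by apply: lin_sumf => m; apply: (loop_ext_lin (extr_lin _ m)). Qed.

Lemma loop_bracketU x m y n :
  lbr << x *g m >> << y *g n >> = << br x y *g m + n >>.
Proof.
apply: etrans (loop_extU (extl_lin _) x m) _.
exact: (loop_extU (extr_lin x m)).
Qed.
End LoopBracket.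

Lemma loop_eq2 (K : fieldType) (V W : lmodType K) (T : choiceType)
    (f g : loops V T -> loops V T -> W) :
  (forall v, linear (f^~ v)) -> (forall u, linear (f u)) ->
  (forall v, linear (g^~ v)) -> (forall u, linear (g u)) ->
  (forall x m y n, f << x *g m >> << y *g n >> = g << x *g m >> << y *g n >>) ->
  forall u v, f u v = g u v.
Proof.
move=> f1 f2 g1 g2 fg u v.
apply: (loop_eq (f1 v) (g1 v)) => x m {u}.
by apply: (loop_eq (f2 _) (g2 _)) => y n; apply: fg.
Qed.

(** * Roots of simply laced Lie algebras *)

(** Lagrange interpolation: the projection is the product of the factors $(f-e)/(c-e)$ over the
    eigenvalues $e\ne c$. A functional that is an eigenvector of the transpose for $c$ is unchanged
    by each factor, and so is the property of commuting with [f]. *)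
Lemma eigen_projection (K : fieldType) (g : vectType K) (f : g -> g) (c : K) :
  linear f -> diagonalizable f ->
  exists p : g -> g, [/\ linear p, forall y, f (p y) = c *: p y,
    forall phi : g -> K, scalar phi -> (forall y, phi (f y) = c * phi y) ->
      forall y, phi (p y) = phi y &
    forall k : g -> g, linear k -> (forall y, k (f y) = f (k y)) ->
      forall y, k (p y) = p (k y)].
Proof.
move=> f_lin [b b_basis b_eig].
pose ev v := xget 0 [set a | f v = a *: v].
have evP v : v \in b -> f v = ev v *: v.
  by move=> /b_eig[a fv]; rewrite /ev; case: xgetP => // /(_ a).
pose q e z : g := (c - e)^-1 *: (f z - e *: z).
have q_lin e : linear (q e).
  move=> a u v; rewrite /q f_lin !scalerA [a * _]mulrC -scalerA -scalerDr.
  congr (_ *: _); rewrite scalerDr opprD addrACA scalerBr.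
  by rewrite !scalerA [a * e]mulrC.
pose s := [seq e <- [seq ev v | v <- b] | e != c].
have s_c e : e \in s -> e != c by rewrite mem_filter => /andP[].
pose p r y := foldr q y r.
have p_lin r : linear (p r).
  by elim: r => [//|e r IHr] a u v; rewrite /= -q_lin -IHr.
exists (p s); split=> [||phi phi_lin phif y|k k_lin kf y]; first exact: p_lin.
- have p_eig v : v \in b -> f (p s v) = c *: p s v.
    move=> vb; have qv e a : q e (a *: v) = ((c - e)^-1 * (ev v - e) * a) *: v.
      rewrite /q (linZ f_lin) evP // !scalerA -scalerBl scalerA.
      by rewrite [a * _]mulrC -mulrBl mulrA.
    have [a [pv a0]] : exists a, p s v = a *: v /\ (ev v \in s -> a = 0).
      elim: (s) => [|e r [a [pr ar]]]; first by exists 1; rewrite scale1r.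
      exists ((c - e)^-1 * (ev v - e) * a); split; first by rewrite /= pr qv.
      rewrite inE => /orP[/eqP->|/ar->]; last by rewrite mulr0.
      by rewrite subrr mulr0 mul0r.
    rewrite pv (linZ f_lin) evP //; have [->|nec] := eqVneq (ev v) c.
      by rewrite !scalerA mulrC.
    by rewrite a0 ?scale0r ?scaler0 // mem_filter nec map_f.
  move=> y; rewrite (coord_span (X := in_tuple b) (v := y)); last first.
    by rewrite (span_basis b_basis) memvf.
  rewrite (lin_sum (p_lin s)) (lin_sum f_lin) scaler_sumr.
  apply: eq_bigr => i _; rewrite (linZ (p_lin s)) (linZ f_lin) p_eig ?mem_nth //.
  by rewrite !scalerA mulrC.
- have phi_q e z : e != c -> phi (q e z) = phi z.
    move=> nec; rewrite /q [X in _ = X](_ : _ = (c - e)^-1 * ((c - e) * phi z)).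
      have phiZ := linZ (W := K^o) phi_lin; have phiB := linB (W := K^o) phi_lin.
      by rewrite phiZ phiB phif phiZ mulrBl.
    by rewrite mulKf // subr_eq0 eq_sym.
  elim: (s) s_c => //= e r IHr s_c; rewrite phi_q ?s_c ?mem_head //.
  by apply: IHr => e' re'; apply: s_c; rewrite inE re' orbT.
by elim: (s) => //= e r IHr; rewrite /q (linZ k_lin) (linB k_lin) kf (linZ k_lin) IHr.
Qed.

Section RootSpaces.
Variables (K : numFieldType) (g : vectType K) (br : g -> g -> g).
Variables (h : {vspace g}) (form : g -> g -> K).
Hypotheses (brP : lie_bracket br) (csaP : cartan_subalgebra br h).
Hypothesis formP : invariant_form br form.
Hypothesis root_norm : forall v, is_root br h form v -> form v v = 2.

Let br_linr x : linear (br x). Proof. by case: brP. Qed.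
Let br_linl y : linear (br^~ y). Proof. by case: brP. Qed.
Let form_linr x : linear (form x : g -> K^o). Proof. by case: formP. Qed.
Let formC x y : form x y = form y x. Proof. by case: formP. Qed.
Let form_linl y : linear (form^~ y : g -> K^o).
Proof. by move=> a u v; rewrite !(formC _ y) form_linr. Qed.

Let formZl a x y : form (a *: x) y = a * form x y.
Proof. exact: (linZ (form_linl y)). Qed.
Let formZr a x y : form x (a *: y) = a * form x y.
Proof. exact: (linZ (form_linr x)). Qed.
Let formNl x y : form (- x) y = - form x y.
Proof. exact: (linN (form_linl y)). Qed.
Let formDl x y z : form (x + y) z = form x z + form y z.
Proof. exact: (linD (form_linl z)). Qed.
Let formDr x y z : form z (x + y) = form z x + form z y.
Proof. exact: (linD (form_linr z)). Qed.
Let form0l y : form 0 y = 0. Proof. exact: (lin0 (form_linl y)). Qed.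
Let form0r y : form y 0 = 0. Proof. exact: (lin0 (form_linr y)). Qed.

Lemma br_anti x y : br x y = - br y x.
Proof.
case: brP => _ _ alt _; apply/eqP; rewrite -addr_eq0; apply/eqP.
have := alt (x + y).
by rewrite (linD (br_linr _)) !(linD (br_linl _)) !alt addr0 add0r addrC.
Qed.

Lemma br_der x y z : br x (br y z) = br (br x y) z + br y (br x z).
Proof.
case: brP => _ _ _ /(_ x y z)/eqP; rewrite -addrA addr_eq0 => /eqP ->.
rewrite opprD addrC [br z _]br_anti opprK; congr (_ + _).
by rewrite [br z x]br_anti (linN (br_linr _)) opprK.
Qed.

Definition weight_vector (v x : g) : Prop :=
  forall y, y \in h -> br y x = form v y *: x.

Lemma weightZ v a x : weight_vector v x -> weight_vector v (a *: x).
Proof.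
by move=> wx H hH; rewrite (linZ (br_linr _)) wx // !scalerA mulrC.
Qed.

Lemma weight_br v w x y : weight_vector v x -> weight_vector w y ->
  weight_vector (v + w) (br x y).
Proof.
move=> wx wy H hH; rewrite br_der (wx _ hH) (wy _ hH) (linZ (br_linl _)).
by rewrite (linZ (br_linr _)) -scalerDl formDl.
Qed.

Lemma weight0_csa x : weight_vector 0 x -> x \in h.
Proof.
case: csaP => _ centr _ wx; apply: centr => y hy.
by rewrite wx // form0l scale0r.
Qed.

(** The functional $\langle x,\cdot\rangle$ is an eigenvector for the transpose of each
    $\mathrm{ad}\,H$ by invariance, so projecting [w] successively for the [H] of a basis of the
    Cartan subalgebra does not change its value. The operators $\mathrm{ad}\,H$ commute, so a later
    projection keeps the earlier eigenvalue equations. *)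
Lemma weight_project v x w : weight_vector v x ->
  exists2 y, weight_vector (- v) y & form x y = form x w.
Proof.
move=> wx; case: csaP => abel _ diag.
have [y wy xy] : exists2 y, forall H, H \in (vbasis h : seq g) ->
    br H y = form (- v) H *: y & form x y = form x w.
  have: {subset (vbasis h : seq g) <= h} by move=> H /vbasis_mem.
  elim: (vbasis h : seq g) => [|H s IHs] sh; first by exists w.
  have [|y' wy' xy'] := IHs; first by move=> H' sH'; apply: sh; rewrite inE sH' orbT.
  have hH : H \in h by apply: sh; rewrite mem_head.
  have [p [p_lin p_eig p_phi p_comm]] :=
    eigen_projection (form (- v) H) (br_linr H) (diag H hH).
  exists (p y').
    move=> H'; rewrite inE => /orP[/eqP->|sH']; first exact: p_eig.
    rewrite (p_comm _ (br_linr H')) ?wy' ?(linZ p_lin) // => z.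
    have hH' : H' \in h by apply: sh; rewrite inE sH' orbT.
    by rewrite br_der (abel H' H) // (lin0 (br_linl _)) add0r.
  rewrite p_phi // => z; case: formP => _ _ _ inv.
  rewrite -inv br_anti wx // formNl formZl.
  by rewrite formNl mulNr.
exists y => // H hH; rewrite (coord_vbasis hH).
rewrite (lin_sum (br_linl y)) (lin_sum (form_linr _)) scaler_suml.
apply: eq_bigr => i _; rewrite (linZ (br_linl y)) formZr.
by rewrite wy ?mem_nth ?size_tuple // scalerA.
Qed.

Lemma weight_dual v x : weight_vector v x -> x != 0 ->
  exists2 y, weight_vector (- v) y & form x y = 1.
Proof.
move=> wx x0; have [w xw0] : exists w, form x w != 0.
  apply: contrapT => /forallNP no_w; case/eqP: x0; case: formP => _ _ nd _.
  by apply: nd => w; apply/eqP/negPn/negP/no_w.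
have [y wy xy] := weight_project w wx.
exists ((form x w)^-1 *: y); first exact: weightZ.
by rewrite formZr xy; apply: mulVf.
Qed.

(** An element of the Cartan subalgebra has weight 0, so its dual partner from [weight_dual] has
    weight 0 too and lies in the self-centralizing subalgebra. *)
Lemma csa_nondegenerate z :
  z \in h -> (forall y, y \in h -> form z y = 0) -> z = 0.
Proof.
move=> hz z_orth; apply/eqP/negPn/negP => z0; case: csaP => abel _ _.
have wz : weight_vector 0 z.
  by move=> y hy; rewrite abel // form0l scale0r.
have [y wy /eqP] := weight_dual wz z0; rewrite z_orth 1?eq_sym ?oner_eq0 //.
by apply: weight0_csa; rewrite -oppr0.
Qed.

(** Both sides lie in the Cartan subalgebra and, by invariance, pair equally with each of its
    elements. *)
Lemma br_dual v x y : v \in h -> weight_vector v x -> weight_vector (- v) y ->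
  br x y = form x y *: v.
Proof.
move=> hv wx wy; apply/eqP; rewrite -subr_eq0; apply/eqP.
have hxy : br x y \in h by apply: weight0_csa; rewrite -(subrr v); apply: weight_br.
apply: csa_nondegenerate => [|H hH]; first by rewrite rpredB ?rpredZ.
case: formP => _ _ _ inv; rewrite (linB (form_linl H)) formZl inv.
rewrite br_anti wy // formNl scaleNr opprK formZr.
by rewrite mulrC subrr.
Qed.

Lemma weight_vanish v x :
  v \in h -> v != 0 -> form v v != 2 -> weight_vector v x -> x = 0.
Proof.
move=> hv v0 v2 wx; apply/eqP/negPn/negP => x0; case/eqP: v2.
by apply: root_norm; split=> //; exists x.
Qed.

Lemma form_add v w : form (v + w) (v + w) = form v v + form w w + form v w *+ 2.
Proof.
rewrite formDr !formDl (formC w v) mulr2n.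
by rewrite addrACA [form v w + _]addrC addrACA addrA [_ + form w w]addrC; ring.
Qed.

(* The sum of the roots v and w has norm 4 + 2 <v, w>, hence is not a root.   *)
Lemma br_weight0 v w x y : is_root br h form v -> is_root br h form w ->
  form v w != -1 -> form v w != -2 ->
  weight_vector v x -> weight_vector w y -> br x y = 0.
Proof.
move=> rv rw vw1 vw2 wx wy; have [hv _ _] := rv; have [hw _ _] := rw.
have nvw : form (v + w) (v + w) = 4 + form v w *+ 2.
  by rewrite form_add !root_norm //; ring.
apply: (@weight_vanish (v + w)); [exact: rpredD | | | exact: weight_br].
  apply: contra_neq vw2 => vw0; have := nvw; rewrite vw0 form0r => e.
  apply: (mulIf (x := 2)); first by rewrite pnatr_eq0.
  by transitivity (4 + form v w *+ 2 - 4); [ring | rewrite -e; ring].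
rewrite nvw; apply: contra_neq vw1 => e.
apply: (mulIf (x := 2)); first by rewrite pnatr_eq0.
by transitivity (4 + form v w *+ 2 - 4); [ring | rewrite e; ring].
Qed.

(** Since $2v$ has norm 8, it is not a root and $[x,x']=0$. Bracketing with the dual vector [y]
    turns this, by Jacobi and [br_dual], into $2x'=2\langle x',y\rangle x$. *)
Lemma root_space1 v x x' : is_root br h form v -> x != 0 ->
  weight_vector v x -> weight_vector v x' -> exists c, x' = c *: x.
Proof.
move=> rv x0 wx wx'; have [hv v0 _] := rv.
have xx' : br x x' = 0.
  have neg_neq2 k : (2 : K) != - k.+1%:R.
    by rewrite -subr_eq0 opprK -natrD pnatr_eq0.
  apply: (br_weight0 rv rv) => //; rewrite root_norm //.
    exact: (neg_neq2 0).
have [y wy xy] := weight_dual wx x0; exists (form x' y).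
have := br_der y x x'; rewrite xx' (lin0 (br_linr y)).
have -> : br y x = - v by rewrite br_anti (br_dual hv wx wy) xy scale1r.
have -> : br y x' = - (form x' y *: v) by rewrite br_anti (br_dual hv wx' wy).
rewrite (linN (br_linl _)) (linN (br_linr _)) (linZ (br_linr _)).
rewrite [br x v]br_anti wx // wx' // root_norm // scalerN opprK => /eqP.
rewrite eq_sym addrC subr_eq0 scalerA mulrC -scalerA => /eqP.
move/(congr1 (fun z => 2^-1 *: z)); rewrite !scalerA mulVf ?pnatr_eq0 //.
by rewrite scale1r mulKf ?pnatr_eq0.
Qed.

(** As $v+w$ is not a root, $[y,x]=0$. For [y'] dual to [y], Jacobi gives $[y,[y',x]]=[w,x]=\langle
    v,w\rangle x$, and the scalar can be divided out. *)
Lemma root_descent v w x y : is_root br h form v -> is_root br h form w ->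
  form v w != -1 -> form v w != -2 -> form v w != 0 -> y != 0 ->
  weight_vector v x -> weight_vector w y ->
  exists2 z, weight_vector (v - w) z & x = br y z.
Proof.
move=> rv rw vw1 vw2 vw0 y0 wx wy; have [hw _ _] := rw.
have [y' wy' yy'] := weight_dual wy y0.
exists ((form v w)^-1 *: br y' x).
  by apply: weightZ; rewrite addrC; apply: weight_br.
rewrite (linZ (br_linr y)) br_der (br_dual hw wy wy') yy' scale1r wx //.
have -> : br y x = 0.
  by apply: (br_weight0 rw rv _ _ wy wx); rewrite formC.
rewrite (lin0 (br_linr _)) addr0.
by rewrite scalerA mulVf ?scale1r.
Qed.
End RootSpaces.

Section Roots.
Variables (R : realType) (D : ade_lie_algebra R).
Local Notation C := R[i].
Local Notation P := (weights (rank D)).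
Local Notation form := (invform D).
Implicit Types (b c : P) (j k : 'I_(rank D)).

Lemma form_linr x : linear (form x : lie D -> C^o).
Proof. by case: (formP D). Qed.
Lemma formC x y : form x y = form y x.
Proof. by case: (formP D). Qed.
Lemma form_linl y : linear (form^~ y : lie D -> C^o).
Proof. by move=> a u v; rewrite !(formC _ y) form_linr. Qed.
Lemma form0l y : form 0 y = 0. Proof. exact: (lin0 (form_linl y)). Qed.
Lemma formDl x y z : form (x + y) z = form x z + form y z.
Proof. exact: (linD (form_linl z)). Qed.
Lemma formBl x y z : form (x - y) z = form x z - form y z.
Proof. exact: (linB (form_linl z)). Qed.
Lemma formDr x y z : form z (x + y) = form z x + form z y.
Proof. exact: (linD (form_linr z)). Qed.
Lemma formZl a x y : form (a *: x) y = a * form x y.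
Proof. exact: (linZ (form_linl y)). Qed.
Lemma formZr a x y : form x (a *: y) = a * form x y.
Proof. exact: (linZ (form_linr x)). Qed.

Lemma wt_csa b : wt b \in csa D.
Proof. by apply: rpred_sum => k _; apply/rpredMz/fweight_csa. Qed.

Lemma alpha_csa j : alpha D j \in csa D.
Proof. by case: (alphaP D) => _ /(_ j)[]. Qed.

Lemma form_wt_alpha b j : form (wt b) (alpha D j) = (b 0 j)%:~R.
Proof.
rewrite (lin_sum (form_linl _)) (bigD1 j) //= big1 => [|k nkj].
  by rewrite -scaler_int formZl fweightP eqxx mulr1 addr0.
by rewrite -scaler_int formZl fweightP (negbTE nkj) mulr0.
Qed.

Lemma form_fweight_sum k (c : 'I_(rank D) -> nat) :
  form (fweight D k) (\sum_j alpha D j *+ c j) = (c k)%:R.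
Proof.
rewrite (lin_sum (form_linr _)) (bigD1 k) //= big1 => [|j njk].
  by rewrite -scaler_nat formZr fweightP eqxx mulr1 addr0.
by rewrite -scaler_nat formZr fweightP eq_sym (negbTE njk) mulr0.
Qed.

Lemma csa_eq x y : x \in csa D -> y \in csa D ->
  (forall j, form x (alpha D j) = form y (alpha D j)) -> x = y.
Proof.
move=> hx hy xy; apply/eqP; rewrite -subr_eq0; apply/eqP.
apply: (csa_nondegenerate (brP D) (csaP D) (formP D)) => [|z hz].
  exact: rpredB.
have [h_basis _ _] := alphaP D.
have : z \in <<[seq alpha D j | j : 'I_(rank D)]>>%VS by rewrite (span_basis h_basis).
move/(@coord_span _ _ _ (in_tuple [seq alpha D j | j : 'I_(rank D)]))=> ->.
rewrite (lin_sum (form_linr _)) big1 // => i _.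
rewrite formZr; have /mapP[j _ ->] := mem_nth 0 (ltn_ord i).
by rewrite formBl xy subrr mulr0.
Qed.

Lemma wt_inj : injective (@wt R D).
Proof.
move=> b c bc; apply/rowP => j; apply: (@intr_inj C).
by rewrite -!form_wt_alpha bc.
Qed.

Lemma wt_lin : {morph @wt R D : b c / b + c}.
Proof.
move=> b c; rewrite /wt -big_split /=; apply: eq_bigr => k _.
by rewrite mxE mulrzDr.
Qed.

Lemma wt0 : wt (0 : P) = 0.
Proof. by apply: (addrI (wt (0 : P))); rewrite -wt_lin !addr0. Qed.

Lemma wtB b c : wt (b - c) = wt b - wt c.
Proof. by apply/eqP; rewrite eq_sym subr_eq -wt_lin subrK. Qed.

Lemma wt_alpha j : wt (alpha_wt j) = alpha D j.
Proof.
apply: csa_eq => [||k]; [exact: wt_csa | exact: alpha_csa |].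
by rewrite form_wt_alpha mxE cartan_mxP.
Qed.

Lemma root_alpha j : root_wt (alpha_wt j).
Proof. by rewrite /root_wt wt_alpha; case: (alphaP D) => _ /(_ j). Qed.

Lemma cartan_diag j : cartan_mx D j j = 2.
Proof.
by have [e _ [s ->]] := cartan_mx_ade D; rewrite /diagram_entry eqxx.
Qed.

Lemma cartan_offdiag j k : j != k -> cartan_mx D j k = 0 \/ cartan_mx D j k = -1.
Proof.
have [e _ [s ->]] := cartan_mx_ade D => njk.
rewrite /diagram_entry (inj_eq val_inj) (inj_eq perm_inj) (negbTE njk).
by case: ifP; [right | left].
Qed.

Lemma cartan_sym j k : cartan_mx D j k = cartan_mx D k j.
Proof. by apply: (@intr_inj C); rewrite -!cartan_mxP formC. Qed.

Lemma pos_root b : b \in pos_roots D -> root_wt b.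
Proof. by move=> /pos_rootsP[]. Qed.

Lemma pos_alpha j : alpha_wt j \in pos_roots D.
Proof.
apply/pos_rootsP; rewrite -/(wt _); split; first exact: root_alpha.
exists (fun k => (k == j) : nat); rewrite wt_alpha (bigD1 j) //= big1 => [|k nkj].
  by rewrite eqxx mulr1n addr0.
by rewrite (negbTE nkj) mulr0n.
Qed.

(** The coefficients are chosen, but for a positive root [form_fweight_wt] shows that they are
    determined as pairings with the fundamental weights. *)
Definition root_coef b j : nat :=
  xget (fun=> 0%N) [set c | wt b = \sum_j alpha D j *+ c j] j.

Lemma root_coefP b : b \in pos_roots D ->
  wt b = \sum_j alpha D j *+ root_coef b j.
Proof.
move=> /pos_rootsP[_ [c def_b]]; rewrite /root_coef.
by case: xgetP => [? _ //|/(_ c)].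
Qed.

Lemma form_fweight_wt b j : b \in pos_roots D ->
  form (fweight D j) (wt b) = (root_coef b j)%:R.
Proof. by move=> /root_coefP {1}->; apply: form_fweight_sum. Qed.

Lemma root_coef_alpha j k : root_coef (alpha_wt j) k = (k == j).
Proof.
apply/eqP; rewrite -(eqr_nat C) -form_fweight_wt ?pos_alpha //.
by rewrite wt_alpha fweightP.
Qed.

Lemma root_coefD b c j :
  b \in pos_roots D -> c \in pos_roots D -> b + c \in pos_roots D ->
  root_coef (b + c) j = (root_coef b j + root_coef c j)%N.
Proof.
move=> pb pc pbc; apply/eqP; rewrite -(eqr_nat C) natrD.
by rewrite -!form_fweight_wt // wt_lin formDr.
Qed.

Lemma pos_rootD b c : b \in pos_roots D -> c \in pos_roots D ->
  root_wt (b + c) -> b + c \in pos_roots D.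
Proof.
move=> /pos_rootsP[_ [cb def_b]] /pos_rootsP[_ [cc def_c]] rbc.
apply/pos_rootsP; split=> //; rewrite -/(wt _) wt_lin.
exists (fun j => (cb j + cc j)%N); rewrite /wt def_b def_c -big_split /=.
by apply: eq_bigr => j _; rewrite mulrnDr.
Qed.

Lemma pos_rootD_neq0 b c : b \in pos_roots D -> c \in pos_roots D -> wt (b + c) != 0.
Proof.
move=> pb pc; apply/eqP => bc0; have [_ /eqP wb0 _] := pos_root pb.
apply: wb0; rewrite (root_coefP pb) big1 // => j _.
have /eqP : (root_coef b j + root_coef c j)%:R = 0 :> C.
  by rewrite natrD -!form_fweight_wt // -formDr -wt_lin bc0 formC form0l.
by rewrite pnatr_eq0 addn_eq0 => /andP[/eqP-> _]; rewrite mulr0n.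
Qed.

(** Otherwise every term of $\langle b,b\rangle=\sum_j c_j\langle b,\alpha_j\rangle$ would be
    nonpositive, whereas the norm is 2. *)
Lemma pos_root_gt0 b : b \in pos_roots D ->
  exists2 j, (0 < root_coef b j)%N & 0 < b 0 j.
Proof.
move=> pb; apply: contrapT => no_j.
have : \sum_j (b 0 j) *+ root_coef b j <= 0.
  apply: sumr_le0 => j _; case: (posnP (root_coef b j)) => [->|cj]; first by rewrite mulr0n.
  by rewrite mulrn_wle0 // leNgt; apply/negP => bj; apply: no_j; exists j.
rewrite -(ler_int C).
have -> : (\sum_j (b 0 j) *+ root_coef b j)%:~R = form (wt b) (wt b) :> C.
  rewrite {2}(root_coefP pb) (lin_sum (form_linr _)) rmorph_sum /=.
  by apply: eq_bigr => j _; rewrite -scaler_nat formZr form_wt_alpha rmorphMn mulr_natl.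
by rewrite (form_normalized (pos_root pb)) (ler_nat _ 2 0).
Qed.
End Roots.

Section RootVectors.
Variables (R : realType) (D : ade_lie_algebra R) (E : weight_cocycle D).
Variable X : affine_action E.
Local Notation C := R[i].
Local Notation P := (weights (rank D)).
Local Notation form := (invform D).
Implicit Types (b c : P) (j k : 'I_(rank D)).

Let br0 x : br D x 0 = 0.
Proof. by case: (brP D) => /(_ x)/lin0. Qed.

Lemma rvec_weight b : root_wt b -> weight_vector (br D) (csa D) form (wt b) (rvec X b).
Proof. by move=> /(rvecP X)[]. Qed.

Lemma rvec_neq0 b : root_wt b -> rvec X b != 0.
Proof. by move=> /(rvecP X)[]. Qed.

Lemma rvec_space b x : root_wt b ->
  weight_vector (br D) (csa D) form (wt b) x -> exists a, x = a *: rvec X b.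
Proof.
move=> rb; apply: (root_space1 (brP D) (csaP D) (formP D) (@form_normalized _ D) rb).
- exact: rvec_neq0.
exact: rvec_weight.
Qed.

Lemma br_rvec b c : b \in pos_roots D -> c \in pos_roots D ->
  br D (rvec X b) (rvec X c) != 0 ->
  b + c \in pos_roots D /\
  exists a, br D (rvec X b) (rvec X c) = a *: rvec X (b + c).
Proof.
move=> pb pc n0.
have w_bc : weight_vector (br D) (csa D) form (wt (b + c)) (br D (rvec X b) (rvec X c)).
  rewrite wt_lin; apply: (weight_br (brP D) (formP D));
  by apply: rvec_weight; apply: pos_root.
have r_bc : root_wt (b + c).
  split; [exact: wt_csa | exact: pos_rootD_neq0 |].
  by exists (br D (rvec X b) (rvec X c)); split.
by split; [exact: pos_rootD | exact: rvec_space].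
Qed.

Lemma br_rvec0 b c (n : int) : root_wt b -> root_wt c ->
  form (wt b) (wt c) = n%:~R -> 0 <= n ->
  br D (rvec X b) (rvec X c) = 0.
Proof.
move=> rb rc bc n0; apply: (br_weight0 (brP D) (formP D) (@form_normalized _ D) rb rc).
- by rewrite bc -[-1]/((-1)%:~R) eqr_int; apply/eqP => def_n; rewrite def_n in n0.
- rewrite bc -[-2]/((-2)%:~R) eqr_int; apply/eqP => def_n; by rewrite def_n in n0.
- exact: rvec_weight.
exact: rvec_weight.
Qed.

(** Induction on the height. A positive root has positive pairing with some simple root $\alpha_j$
    occurring in it; unless it equals $\alpha_j$, [root_descent] writes its root vector as a bracket
    of $x_{\alpha_j}$ with a vector of weight $b-\alpha_j$. This is how the simple root vectors
    generate the nilpotent part. *)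
Lemma pos_root_ind (Q : P -> Prop) : (forall j, Q (alpha_wt j)) ->
  (forall b j a, b \in pos_roots D -> b + alpha_wt j \in pos_roots D ->
     rvec X (b + alpha_wt j) = a *: br D (rvec X (alpha_wt j)) (rvec X b) ->
     Q b -> Q (b + alpha_wt j)) ->
  forall b, b \in pos_roots D -> Q b.
Proof.
move=> Q_alpha QD b; have [n] := ubnP (\sum_j root_coef b j).
elim: n b => // n IHn b; rewrite ltnS => le_n pb.
have [j cj bj] := pos_root_gt0 pb.
have [->|n_alpha] := eqVneq b (alpha_wt j); first exact: Q_alpha.
have rb := pos_root pb; have raj := root_alpha j.
have b_j : form (wt b) (wt (alpha_wt j)) = (b 0 j)%:~R.
  by rewrite wt_alpha form_wt_alpha.
have neqm (m : int) : m <= 0 -> form (wt b) (wt (alpha_wt j)) != m%:~R.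
  by move=> m0; rewrite b_j eqr_int; apply: contraTneq bj => ->; rewrite -leNgt.
have [z wz def_b] := root_descent (brP D) (csaP D) (formP D)
  (@form_normalized _ D) rb raj (neqm (-1) isT) (neqm (-2) isT) (neqm 0 isT)
  (rvec_neq0 raj) (rvec_weight rb) (rvec_weight raj).
rewrite -wtB in wz.
have z0 : z != 0.
  by apply: contra_eq_neq def_b => ->; rewrite br0; apply: rvec_neq0.
have r_b' : root_wt (b - alpha_wt j).
  split; [exact: wt_csa | | by exists z].
  by rewrite -wt0 (inj_eq (@wt_inj _ D)) subr_eq0.
(* The truncated subtraction is exact, because $\alpha_j$ occurs in [b]; hence $b-\alpha_j$ is again
   a nonnegative combination. *)
have wt_b' : wt (b - alpha_wt j) =
    \sum_k alpha D k *+ (root_coef b k - (k == j))%N.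
  rewrite wtB wt_alpha (root_coefP pb) (bigD1 j) //= [RHS](bigD1 j) //= eqxx.
  rewrite mulrnBr // mulr1n addrAC; congr (_ + _); apply: eq_bigr => k nkj.
  by rewrite (negbTE nkj) subn0.
have p_b' : b - alpha_wt j \in pos_roots D.
  by apply/pos_rootsP; split=> //; exists (fun k => root_coef b k - (k == j))%N.
have [a def_z] := rvec_space r_b' wz.
rewrite -(subrK (alpha_wt j) b); apply: (QD _ _ a) => //; rewrite ?subrK //.
  by rewrite def_b def_z; case: (brP D) => /(_ (rvec X (alpha_wt j)))/linZ->.
apply: IHn => //; apply: leq_trans le_n.
have def_coef k : root_coef (b - alpha_wt j) k = (root_coef b k - (k == j))%N.
  by apply/eqP; rewrite -(eqr_nat C) -form_fweight_wt // wt_b' form_fweight_sum.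
rewrite (bigD1 j) //= [X in (_ < X)%N](bigD1 j) //= def_coef eqxx -addSn.
apply: leq_add; first by lia.
by apply: leq_sum => k nkj; rewrite def_coef (negbTE nkj) subn0.
Qed.

(** A vector of weight $-b$ is orthogonal, by invariance, to every weight vector whose weight is not
    [b]; so one normalized dual vector separates $x_b$ from all other positive root vectors. *)
Lemma rvec_dual b : b \in pos_roots D ->
  exists y, forall c, c \in pos_roots D -> form (rvec X c) y = (c == b)%:R.
Proof.
move=> pb; have rb := pos_root pb.
have [y wy xy] := weight_dual (brP D) (csaP D) (formP D) (rvec_weight rb)
  (rvec_neq0 rb).
exists y => c pc; case: eqVneq => [-> //|ncb].
apply/eqP/negPn/negP => xy0; case/eqP: ncb; apply: wt_inj.
apply: csa_eq => [||j]; [exact: wt_csa | exact: wt_csa |].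
have hj := alpha_csa j; case: (formP D) => _ _ _ inv.
have := inv (rvec X c) (alpha D j) y.
rewrite (wy _ hj) (br_anti (brP D)) (rvec_weight (pos_root pc) hj).
rewrite -scaleNr formZl formZr -[- wt b]sub0r formBl form0l sub0r.
by move/(mulIf xy0)/oppr_inj.
Qed.
End RootVectors.

(** * The algebra U(nbar) and its twists *)

Section NilpotentPart.
Variables (R : realType) (D : ade_lie_algebra R) (E : weight_cocycle D).
Variable X : affine_action E.
Local Notation C := R[i].
Local Notation P := (weights (rank D)).
Local Notation form := (invform D).
Local Notation n := (nilpart X).
Local Notation nbr := (@nil_bracket R D E X).
Implicit Types (b c : P) (j k : 'I_(rank D)).

Definition nvec b : n := vsproj (nilrad X) (rvec X b).

Lemma vsval_nvec b : b \in pos_roots D -> vsval (nvec b) = rvec X b.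
Proof. by move=> pb; apply/vsprojK/memv_span/map_f. Qed.

Definition rdual b : lie D :=
  xget 0 [set y | forall c, c \in pos_roots D -> form (rvec X c) y = (c == b)%:R].

Lemma rdualP b c : b \in pos_roots D -> c \in pos_roots D ->
  form (rvec X c) (rdual b) = (c == b)%:R.
Proof.
move=> /(rvec_dual X)[y hy]; rewrite /rdual.
by case: xgetP => [z _ hz|/(_ y) []] //; apply: hz.
Qed.

Definition ncoord b (x : n) : C := form (vsval x) (rdual b).

Lemma ncoord_lin b : linear (ncoord b : n -> C^o).
Proof. by move=> a x y; rewrite /ncoord linearP form_linl. Qed.

Lemma ncoord_nvec b c : b \in pos_roots D -> c \in pos_roots D ->
  ncoord b (nvec c) = (c == b)%:R.
Proof. by move=> pb pc; rewrite /ncoord vsval_nvec // rdualP. Qed.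

Lemma nil_ind (Q : n -> Prop) :
  subspace Q -> (forall b, b \in pos_roots D -> Q (nvec b)) -> forall x, Q x.
Proof.
move=> Q_sub Qv x; rewrite -[x](vsvalK x).
have := coord_span (X := in_tuple [seq rvec X b | b <- pos_roots D]) (valP x).
move=> /= ->; rewrite linear_sum; apply: (subspace_sum Q_sub) => i _.
rewrite linearZ; apply: (subspaceZ Q_sub).
have /mapP[b pb ->] := mem_nth 0 (ltn_ord i); exact: Qv.
Qed.

Lemma nbr_linl y : linear (nbr^~ y).
Proof.
by move=> a x x'; rewrite /nil_bracket linearP (let: And4 _ l _ _ := brP D in l _) linearP.
Qed.

Lemma nbr_linr x : linear (nbr x).
Proof.
by move=> a y y'; rewrite /nil_bracket linearP (let: And4 l _ _ _ := brP D in l _) linearP.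
Qed.

Lemma nbr_nvec b c : b \in pos_roots D -> c \in pos_roots D ->
  nbr (nvec b) (nvec c) = vsproj (nilrad X) (br D (rvec X b) (rvec X c)).
Proof. by move=> pb pc; rewrite /nil_bracket !vsval_nvec. Qed.

Lemma nbr_nvec_cases b c : b \in pos_roots D -> c \in pos_roots D ->
  nbr (nvec b) (nvec c) = 0 \/ b + c \in pos_roots D /\
  exists a, nbr (nvec b) (nvec c) = a *: nvec (b + c).
Proof.
move=> pb pc; rewrite nbr_nvec //.
have [->|n0] := eqVneq (br D (rvec X b) (rvec X c)) 0; first by left; rewrite linear0.
have [pbc [a ->]] := br_rvec pb pc n0.
by right; split=> //; exists a; rewrite linearZ.
Qed.

Lemma nil_eq2 (W : lmodType C) (f g : n -> n -> W) :
  (forall y, linear (f^~ y)) -> (forall x, linear (f x)) ->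
  (forall y, linear (g^~ y)) -> (forall x, linear (g x)) ->
  (forall b c, b \in pos_roots D -> c \in pos_roots D ->
     f (nvec b) (nvec c) = g (nvec b) (nvec c)) ->
  forall x y, f x y = g x y.
Proof.
move=> f1 f2 g1 g2 fg x y; elim/nil_ind: x => [|b pb].
  split=> [|a u v IHu IHv]; first by rewrite (lin0 (f1 y)) (lin0 (g1 y)).
  by rewrite f1 g1 IHu IHv.
elim/nil_ind: y => [|c pc]; last exact: fg.
split=> [|a u v IHu IHv]; first by rewrite (lin0 (f2 _)) (lin0 (g2 _)).
by rewrite f2 g2 IHu IHv.
Qed.

Lemma vsval_lin : linear (vsval : n -> lie D).
Proof. exact: linearP. Qed.

(** A nonzero bracket of two positive root vectors is a multiple of a positive root vector, so the
    projection in [nil_bracket] loses nothing. *)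
Lemma vsval_nbr x y : vsval (nbr x y) = br D (vsval x) (vsval y).
Proof.
have [br_linr br_linl _ _] := brP D.
apply: (nil_eq2 (f := fun x y => vsval (nbr x y))
  (g := fun x y => br D (vsval x) (vsval y))) => [z|z|z|z|b c pb pc].
- exact: comp_lin vsval_lin (nbr_linl z).
- exact: comp_lin vsval_lin (nbr_linr z).
- exact: comp_lin (br_linl _) vsval_lin.
- exact: comp_lin (br_linr _) vsval_lin.
rewrite nbr_nvec // !vsval_nvec //; apply: vsprojK.
have [->|n0] := eqVneq (br D (rvec X b) (rvec X c)) 0; first exact: mem0v.
have [pbc [a ->]] := br_rvec pb pc n0.
by apply/memvZ/memv_span/map_f.
Qed.

Local Notation nbbr := (@nbar_bracket R D E X).

Definition nterm (x : n) (m : int) : nbar X := << x *g m >>.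

Lemma nterm_lin m : linear (nterm^~ m).
Proof. exact: (@loopU_lin C n int m). Qed.

Lemma ntermZ (a : C) x m : nterm (a *: x) m = a *: nterm x m.
Proof. exact: (linZ (nterm_lin m) a x). Qed.

Lemma nbbr_linl v : linear (nbbr^~ v).
Proof. exact: (loop_bracket_linl nbr_linl). Qed.

Lemma nbbr_linr u : linear (nbbr u).
Proof. exact: (loop_bracket_linr nbr_linr). Qed.

Lemma nbbr_nterm x (m : int) y (k : int) : nbbr (nterm x m) (nterm y k) = nterm (nbr x y) (m + k).
Proof. exact: (loop_bracketU nbr_linl nbr_linr). Qed.

Lemma nbar_ind (Q : nbar X -> Prop) : subspace Q ->
  (forall b m, b \in pos_roots D -> Q (nterm (nvec b) m)) -> forall u, Q u.
Proof.
move=> Q_sub QU u; elim/loop_ind: u => // x m; rewrite -/(nterm x m).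
elim/nil_ind: x => [|b /QU //]; split=> [|a x y Qx Qy].
  by rewrite (lin0 (nterm_lin m)); apply: Q_sub.1.
by rewrite nterm_lin; apply: Q_sub.2.
Qed.
End NilpotentPart.

Section Twist.
#[local] Opaque nterm nvec.
Variables (R : realType) (D : ade_lie_algebra R) (E : weight_cocycle D).
Variable X : affine_action E.
Variables (q : 'I_(rank D) -> R[i]) (ell : 'I_(rank D) -> int).
Local Notation C := R[i].
Local Notation P := (weights (rank D)).
Local Notation n := (nilpart X).
Local Notation nbr := (@nil_bracket R D E X).
Local Notation nbbr := (@nbar_bracket R D E X).
Implicit Types (b c : P) (j k : 'I_(rank D)).

Definition root_char b : C := \prod_j q j ^+ root_coef b j.
Definition root_shift b : int := \sum_j ell j *+ root_coef b j.

Lemma root_charD b c : b \in pos_roots D -> c \in pos_roots D ->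
  b + c \in pos_roots D -> root_char (b + c) = root_char b * root_char c.
Proof.
move=> pb pc pbc; rewrite /root_char -big_split /=; apply: eq_bigr => j _.
by rewrite root_coefD // exprD.
Qed.

Lemma root_shiftD b c : b \in pos_roots D -> c \in pos_roots D ->
  b + c \in pos_roots D -> root_shift (b + c) = root_shift b + root_shift c.
Proof.
move=> pb pc pbc; rewrite /root_shift -big_split /=; apply: eq_bigr => j _.
by rewrite root_coefD // mulrnDr.
Qed.

Lemma root_char_alpha j : root_char (alpha_wt j) = q j.
Proof.
rewrite /root_char (bigD1 j) //= big1 => [|k nkj].
  by rewrite root_coef_alpha eqxx mulr1.
by rewrite root_coef_alpha (negbTE nkj).
Qed.

Lemma root_shift_alpha j : root_shift (alpha_wt j) = ell j.
Proof.
rewrite /root_shift (bigD1 j) //= big1 => [|k nkj].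
  by rewrite root_coef_alpha eqxx addr0.
by rewrite root_coef_alpha (negbTE nkj).
Qed.

(** This is $x_b\otimes t^m\mapsto q(b)\,x_b\otimes t^{m+\ell(b)}$, extended linearly through the
    coordinates of the nilpotent part; [undup] guards against a positive root being listed twice. *)
Definition twist_loop (u : nbar X) : nbar X :=
  loop_ext (fun (m : int) (x : n) => \sum_(b <- undup (pos_roots D))
    (root_char b * ncoord b x) *: nterm (nvec X b) (m + root_shift b)) u.

Let ext_lin (m : int) : linear (fun x : n => \sum_(b <- undup (pos_roots D))
    (root_char b * ncoord b x) *: nterm (nvec X b) (m + root_shift b)).
Proof.
apply: lin_sumf => b a x y.
have -> : ncoord b (a *: x + y) = a * ncoord b x + ncoord b y by apply: ncoord_lin.
by rewrite mulrDr scalerDl scalerA mulrCA.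
Qed.

Lemma twist_loop_lin : linear twist_loop.
Proof. exact: loop_ext_lin ext_lin. Qed.

Lemma twist_loopZ (a : C) u : twist_loop (a *: u) = a *: twist_loop u.
Proof. exact: (linZ twist_loop_lin a u). Qed.

Lemma twist_loop_nvec b (m : int) : b \in pos_roots D ->
  twist_loop (nterm (nvec X b) m) =
  root_char b *: nterm (nvec X b) (m + root_shift b).
Proof.
move=> pb; rewrite /twist_loop; apply: etrans (loop_extU ext_lin _ m) _.
rewrite (bigD1_seq b) ?mem_undup ?undup_uniq //= ncoord_nvec // eqxx mulr1.
rewrite big1_seq ?addr0 // => c /andP[ncb]; rewrite mem_undup => pc.
by rewrite ncoord_nvec // eq_sym (negbTE ncb) mulr0 scale0r.
Qed.

(** On root vectors this is the multiplicativity of $q(b)$ and the additivity of $\ell(b)$ whenever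
    the sum of the two roots is a root; otherwise both brackets vanish. *)
Lemma twist_loop_br u v : twist_loop (nbbr u v) = nbbr (twist_loop u) (twist_loop v).
Proof.
pose f u v := twist_loop (nbbr u v); pose g u v := nbbr (twist_loop u) (twist_loop v).
have f1 w : linear (f^~ w) by exact: comp_lin twist_loop_lin (nbbr_linl w).
have f2 w : linear (f w) by exact: comp_lin twist_loop_lin (nbbr_linr w).
have g1 w : linear (g^~ w) by exact: comp_lin (nbbr_linl _) twist_loop_lin.
have g2 w : linear (g w) by exact: comp_lin (nbbr_linr _) twist_loop_lin.
rewrite -/(f u v) -/(g u v).
elim/nbar_ind: u => [|b m pb].
  split=> [|a u u' IHu IHu']; first by rewrite (lin0 (f1 v)) (lin0 (g1 v)).
  by rewrite f1 g1 IHu IHu'.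
elim/nbar_ind: v => [|c k pc].
  split=> [|a v v' IHv IHv']; first by rewrite (lin0 (f2 _)) (lin0 (g2 _)).
  by rewrite f2 g2 IHv IHv'.
rewrite /f /g nbbr_nterm !twist_loop_nvec //.
rewrite (linZ (nbbr_linl _)) (linZ (nbbr_linr _)) nbbr_nterm scalerA.
have [->|[pbc [a ->]]] := nbr_nvec_cases X pb pc.
  by rewrite !(lin0 (nterm_lin _)) (lin0 twist_loop_lin) scaler0.
rewrite ntermZ twist_loopZ ntermZ (twist_loop_nvec _ pbc).
rewrite (root_charD pb pc pbc) (root_shiftD pb pc pbc) addrACA !scalerA.
by rewrite [a * _]mulrC.
Qed.
End Twist.

Lemma commutator_mulr (A : pzRingType) (x y z : A) :
  (x * y - y * x) * z = x * (y * z) - y * (x * z).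
Proof. by rewrite mulrBl !mulrA. Qed.

Section UNbar.
Variables (R : realType) (D : ade_lie_algebra R) (E : weight_cocycle D).
Variable X : affine_action E.
Local Notation C := R[i].
Local Notation P := (weights (rank D)).
Local Notation U := (Unbar X).
Local Notation nbr := (@nil_bracket R D E X).
Local Notation nbbr := (@nbar_bracket R D E X).
Implicit Types (b c : P) (i j : 'I_(rank D)).

Lemma U_in_lin : linear (@U_in R D E X).
Proof. exact: env_in_lin. Qed.

Lemma U_inZ (a : C) (u : nbar X) : U_in (a *: u) = a *: U_in u.
Proof. exact: (linZ U_in_lin a u). Qed.

Lemma U_in_br (u v : nbar X) : U_in (nbbr u v) = U_in u * U_in v - U_in v * U_in u.
Proof. exact: env_in_br. Qed.

Definition Uvec b (m : int) : U := U_in (nterm (nvec X b) m).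
Definition Ubr b c (m : int) : U := U_in (nterm (nbr (nvec X b) (nvec X c)) m).

Lemma xalphaE j m : xalpha X j m = Uvec (alpha_wt j) m.
Proof. by []. Qed.

Lemma Uvec_br b c m n : Uvec b m * Uvec c n = Uvec c n * Uvec b m + Ubr b c (m + n).
Proof. by rewrite /Ubr -nbbr_nterm U_in_br addrC subrK. Qed.

Lemma Ubr0 b c m : br D (rvec X b) (rvec X c) = 0 ->
  b \in pos_roots D -> c \in pos_roots D -> Ubr b c m = 0.
Proof.
move=> bc0 pb pc; rewrite /Ubr nbr_nvec // bc0 linear0.
by rewrite (lin0 (nterm_lin m)) (lin0 U_in_lin).
Qed.

Lemma Ubr_cases b c m : b \in pos_roots D -> c \in pos_roots D ->
  Ubr b c m = 0 \/ b + c \in pos_roots D /\ exists a, Ubr b c m = a *: Uvec (b + c) m.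
Proof.
move=> pb pc; rewrite /Ubr; have [->|[pbc [a ->]]] := nbr_nvec_cases X pb pc.
  by left; rewrite (lin0 (nterm_lin m)) (lin0 U_in_lin).
by right; split=> //; exists a; rewrite ntermZ U_inZ.
Qed.

(** The commutator formula holds for every splitting $m+n$ of the degree, so that a later use may
    give the simple root vector degree 0. *)
Lemma Uvec_ind (Q : P -> Prop) : (forall j, Q (alpha_wt j)) ->
  (forall b j, b \in pos_roots D -> Q b ->
     (exists a, forall m n, Uvec (b + alpha_wt j) (m + n) =
        a *: (xalpha X j m * Uvec b n - Uvec b n * xalpha X j m)) ->
     Q (b + alpha_wt j)) ->
  forall b, b \in pos_roots D -> Q b.
Proof.
move=> Q_alpha QD; apply: (pos_root_ind (X := X) Q_alpha) => b j a pb pbj def_bj Qb.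
have def_n : a *: nbr (nvec X (alpha_wt j)) (nvec X b) = nvec X (b + alpha_wt j).
  by rewrite (nbr_nvec X (pos_alpha j) pb) -linearZ -def_bj.
apply: (QD _ _ pb Qb); exists a => m n.
have -> : Uvec (b + alpha_wt j) (m + n) = a *: Ubr (alpha_wt j) b (m + n).
  by rewrite /Uvec -def_n ntermZ U_inZ.
by congr (_ *: _); rewrite xalphaE Uvec_br [RHS]addrAC subrr add0r.
Qed.

Lemma U_ind (Q : U -> Prop) : subspace Q -> Q 1 ->
  (forall j m a, Q a -> Q (xalpha X j m * a)) -> forall a, Q a.
Proof.
move=> Q_sub Q1 Qx; apply: env_ind => // u; elim/nbar_ind: u => [|b m pb].
  split=> [a _|c u v IHu IHv a Qa].
    have -> : env_in nbbr 0 = 0 by apply: lin0 U_in_lin.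
    by rewrite mul0r; apply: Q_sub.1.
  have -> : env_in nbbr (c *: u + v) = c *: env_in nbbr u + env_in nbbr v.
    exact: U_in_lin.
  by rewrite mulrDl -scalerAl; apply: Q_sub.2; [apply: IHu | apply: IHv].
rewrite -[env_in _ _]/(Uvec b m).
elim/Uvec_ind: pb m => [j|{}b j pb IHb [a def_bj]] m c Qc; first exact: Qx.
rewrite -[m]add0r def_bj -scalerAl; apply: (subspaceZ Q_sub).
rewrite commutator_mulr; apply: (subspaceB Q_sub).
  by apply: Qx; apply: IHb.
by apply: IHb; apply: Qx.
Qed.

Section TwistU.
Variables (q : 'I_(rank D) -> C) (ell : 'I_(rank D) -> int).

Definition twist : U -> U := env_lift (fun u => U_in (twist_loop q ell u)).

Let tw_lin : linear (fun u : nbar X => U_in (twist_loop q ell u)).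
Proof. by move=> a u v; rewrite twist_loop_lin U_in_lin. Qed.

Let tw_br u v : U_in (twist_loop q ell (nbbr u v)) =
  U_in (twist_loop q ell u) * U_in (twist_loop q ell v) -
  U_in (twist_loop q ell v) * U_in (twist_loop q ell u).
Proof. by rewrite twist_loop_br U_in_br. Qed.

Lemma twist_lin : linear twist.
Proof. exact: (env_lift_lin tw_lin tw_br). Qed.

Lemma twistM (u v : U) : twist (u * v) = twist u * twist v.
Proof. exact: (env_liftM tw_lin tw_br). Qed.

Lemma twist1 : twist 1 = 1.
Proof. exact: (env_lift1 tw_lin tw_br). Qed.

Lemma twist_Uvec b m : b \in pos_roots D ->
  twist (Uvec b m) = root_char q b *: Uvec b (m + root_shift ell b).
Proof.
move=> pb; apply: etrans (env_lift_in tw_lin tw_br _) _.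
by rewrite (twist_loop_nvec _ _ _ _ pb) U_inZ.
Qed.

Lemma twist_xalpha j m : twist (xalpha X j m) = q j *: xalpha X j (m + ell j).
Proof.
by rewrite xalphaE (twist_Uvec _ (pos_alpha j)) root_char_alpha root_shift_alpha.
Qed.
End TwistU.

End UNbar.

(** * Left ideals *)

Section Convolution.
Variable V : zmodType.
Implicit Types F G : nat -> nat -> V.

Definition conv_sum F (t : nat) : V := \sum_(1 <= k < t) F k (t - k)%N.

Lemma eq_conv_sum F G t : (forall a b, (0 < a)%N -> (0 < b)%N -> F a b = G a b) ->
  conv_sum F t = conv_sum G t.
Proof.
move=> FG; rewrite /conv_sum !big_nat; apply: eq_bigr => k /andP[k0 kt].
by apply: FG; rewrite // subn_gt0.
Qed.

Lemma conv_sumD F G t :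
  conv_sum (fun a b => F a b + G a b) t = conv_sum F t + conv_sum G t.
Proof. exact: big_split. Qed.

Lemma conv_sum_swap F t : conv_sum (fun a b => F b a) t = conv_sum F t.
Proof.
rewrite /conv_sum [RHS]big_nat_rev /= !big_nat; apply: eq_bigr => k /andP[k0 kt].
by congr (F _ _); lia.
Qed.

Lemma conv_sum_head F t : (0 < t)%N ->
  conv_sum F t.+1 = F 1%N t + conv_sum (fun a b => F a.+1 b) t.
Proof.
move=> t0; rewrite /conv_sum big_ltn // subSS subn0; congr (_ + _).
by rewrite big_add1 /= !big_nat; apply: eq_bigr => k _; rewrite subSS.
Qed.

Lemma conv_sum_ends F t : (0 < t)%N ->
  conv_sum F t.+2 = F 1%N t.+1 + conv_sum (fun a b => F a.+1 b.+1) t + F t.+1 1%N.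
Proof.
move=> t0; rewrite conv_sum_head // -addrA; congr (_ + _).
rewrite -conv_sum_swap conv_sum_head // addrC; congr (_ + _).
exact: conv_sum_swap.
Qed.
End Convolution.

Section LeftIdeals.
Variables (K : numFieldType) (A : algType K).

Definition left_ideal (L : A -> Prop) : Prop :=
  subspace L /\ forall u a, L a -> L (u * a).

Variable L : A -> Prop.
Hypothesis L_left : left_ideal L.
Let L_sub := L_left.1.
Let LM := L_left.2.

Lemma left_ideal_half a : L (a + a) -> L a.
Proof.
rewrite -mulr2n -scaler_nat; apply: (subspaceZr L_sub).
by rewrite pnatr_eq0.
Qed.

(** Here [x k] stands for $x_i(-k)$. In $x_i(-1)R_{t+4}$ the two outermost terms at each end contain
    $x_i(-1)^2=R_2$ or $x_i(-1)x_i(-2)=R_3/2$, which lie in [L]; what remains is the shifted sum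
    times $x_i(-1)$. *)
Lemma conv_square_shift (x : nat -> A) (t : nat) :
  (forall k l, x k * x l = x l * x k) ->
  (forall t, L (conv_sum (fun a b => x a * x b) t)) -> (0 < t)%N ->
  L (conv_sum (fun a b => x a.+2 * x b.+2) t * x 1%N).
Proof.
move=> xC LS t0; pose F a b := x a * x b.
have L11 : L (x 1%N * x 1%N) by have := LS 2; rewrite /conv_sum big_nat1.
have L12 : L (x 1%N * x 2).
  apply: left_ideal_half; have := LS 3.
  by rewrite /conv_sum big_ltn // big_nat1 [x 2 * _]xC.
have L11x k : L (x 1%N * (x 1%N * x k)).
  by rewrite (xC 1%N k) mulrA (xC 1%N k) -mulrA; apply: LM.
have L12x k : L (x 1%N * (x 2 * x k)).
  by rewrite (xC 2 k) mulrA (xC 1%N k) -mulrA; apply: LM.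
have := LM (x 1%N) (LS t.+4); rewrite !conv_sum_ends // !mulrDr.
rewrite [x t.+3 * _]xC [x t.+2 * _]xC.
move/(subspaceKr L_sub (L11x _))/(subspaceKl L_sub (L11x _)).
move/(subspaceKr L_sub (L12x _))/(subspaceKl L_sub (L12x _)).
congr L; rewrite /conv_sum mulr_suml mulr_sumr; apply: eq_bigr => k _.
by rewrite mulrA [x 1%N * _]xC -mulrA [x 1%N * _]xC mulrA.
Qed.

(** The end terms contain the factor $x(0)$, which can be moved to the right into [L], and the
    interior is $R_{t-2}$. *)
Lemma conv_square_unshift (x : int -> A) (t : nat) :
  (forall m n, x m * x n = x n * x m) -> L (x 0) ->
  (forall t, L (conv_sum (fun a b => x (- a%:Z) * x (- b%:Z)) t)) ->
  L (conv_sum (fun a b => x (1 - a%:Z) * x (1 - b%:Z)) t).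
Proof.
move=> xC L0 LS; case: t => [|[|[|t]]]; try by rewrite /conv_sum big_geq //; apply: L_sub.1.
  by rewrite /conv_sum big_nat1 subrr; apply: LM.
rewrite conv_sum_ends // subrr [x 0 * _]xC.
apply: (subspaceD L_sub); last exact: LM.
apply: (subspaceD L_sub); first exact: LM.
have := LS t.+1; congr L; apply: eq_conv_sum => a b _ _.
by congr (x _ * x _); lia.
Qed.

(* Here x, y and w, z stand for x_j, [x_j, x_i] and x_i(0), x_i(-1).          *)
Lemma conv_neighbor_shift (x y : int -> A) (w z : A) (t : nat) :
  (forall m n, x m * x n = x n * x m) -> (forall m n, x m * y n = y n * x m) ->
  (forall m, x m * w = w * x m + y m) ->
  (forall m, x m * z = z * x m + y (m - 1)) -> L (x 0) -> L w ->
  (forall t, L (conv_sum (fun a b => x (- a%:Z) * x (- b%:Z)) t)) ->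
  (0 < t)%N -> L (conv_sum (fun a b => x (1 - a%:Z) * x (1 - b%:Z)) t * z).
Proof.
move=> xC xyC xw xz L0 Lw LS t0.
have xxw m n : x m * x n * w = w * (x m * x n) + (x m * y n + x n * y m).
  rewrite -mulrA xw mulrDr mulrA xw mulrDl -(mulrA w) -addrA -(xyC n m).
  by rewrite [x n * y m + _]addrC.
have xxz m n : x m * x n * z = z * (x m * x n) + (x m * y (n - 1) + x n * y (m - 1)).
  rewrite -mulrA xz mulrDr mulrA xz mulrDl -(mulrA z) -addrA -(xyC n (m - 1)).
  by rewrite [x n * y _ + _]addrC.
have shift a : 1 - a.+1%:Z = - a%:Z by lia.
have LH s : L (conv_sum (fun a b => x (- a%:Z) * y (- b%:Z)) s).
  apply: left_ideal_half; rewrite -[X in _ + X]conv_sum_swap -conv_sumD.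
  pose F a b := x (- a%:Z) * x (- b%:Z).
  apply: (subspaceKl L_sub (LM w (LS s))).
  suff <- : conv_sum F s * w = w * conv_sum F s + conv_sum (fun a b =>
    x (- a%:Z) * y (- b%:Z) + x (- b%:Z) * y (- a%:Z)) s by apply: LM.
  rewrite /conv_sum mulr_suml mulr_sumr -big_split; apply: eq_bigr => k _ /=.
  exact: xxw.
have LG : L (conv_sum (fun a b => x (1 - a%:Z) * y (- b%:Z)) t).
  case: t t0 => [//|[|t] _]; first by rewrite /conv_sum big_geq //; apply: L_sub.1.
  rewrite conv_sum_head // subrr xyC; apply: (subspaceD L_sub); first exact: LM.
  by under eq_conv_sum => a b _ _ do rewrite shift.
have -> : conv_sum (fun a b => x (1 - a%:Z) * x (1 - b%:Z)) t * z =
    z * conv_sum (fun a b => x (1 - a%:Z) * x (1 - b%:Z)) t +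
    (conv_sum (fun a b => x (1 - a%:Z) * y (- b%:Z)) t +
     conv_sum (fun a b => x (1 - b%:Z) * y (- a%:Z)) t).
  rewrite -conv_sumD /conv_sum mulr_suml mulr_sumr -big_split.
  apply: eq_bigr => k _ /=; rewrite xxz.
  by rewrite (_ : 1 - k%:Z - 1 = - k%:Z) 1?(_ : 1 - (t - k)%N%:Z - 1 = - (t - k)%N%:Z) //; lia.
apply: (subspaceD L_sub); first by apply: LM; apply: conv_square_unshift.
by apply: (subspaceD L_sub) => //; rewrite (conv_sum_swap (fun a b => x (1 - a%:Z) * y (- b%:Z))).
Qed.
End LeftIdeals.

(** * The annihilator of the vacuum *)

(* A stands for U(nbar), v for its generators x_b(m), b a positive root, and  *)
(* T q ell for the automorphism x_b(m) |-> q(b) x_b(m + ell(b)), where q and  *)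
(* ell are extended from the simple roots to a character and a linear form.   *)
Section PrincipalCore.
Variables (K : numFieldType) (I : finType) (A : algType K).
Variables (x : I -> int -> A) (T : (I -> K) -> (I -> int) -> A -> A).
Variables (cartan : I -> I -> int) (B : Type) (v : B -> int -> A).
Variable I0 : A -> Prop.

Hypothesis x_ind : forall Q : A -> Prop, subspace Q -> Q 1 ->
  (forall j m a, Q a -> Q (x j m * a)) -> forall a, Q a.
Hypothesis T_lin : forall q ell, linear (T q ell).
Hypothesis TM : forall q ell a b, T q ell (a * b) = T q ell a * T q ell b.
Hypothesis T1 : forall q ell, T q ell 1 = 1.
Hypothesis Tx : forall q ell j m, T q ell (x j m) = q j *: x j (m + ell j).

Hypothesis cartan_id : forall i, cartan i i = 2.
Hypothesis cartan_neq : forall i j, i != j -> cartan i j = 0 \/ cartan i j = -1.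
Hypothesis x_comm : forall i j m n, i = j \/ cartan i j = 0 ->
  x i m * x j n = x j n * x i m.
Hypothesis x_bracket : forall i j, cartan i j = -1 ->
  exists y : int -> A, [/\ forall m n, x j m * x i n = x i n * x j m + y (m + n),
    forall m n, x j m * y n = y n * x j m & forall m : nat, I0 (y m)].
Hypothesis v_x : forall j, exists b, forall m, x j m = v b m.
Hypothesis v_bracket : forall b j, exists c a, forall m n,
  v b m * x j n = x j n * v b m + a *: v c (m + n).

Local Notation Rsum j t := (conv_sum (fun a b => x j (- a%:Z) * x j (- b%:Z)) t).

Hypothesis I0_left : left_ideal I0.
Hypothesis I0_Rsum : forall j t, I0 (Rsum j t).
Hypothesis I0_v : forall b (m : nat), I0 (v b m).
Hypothesis I0_min : forall L : A -> Prop, left_ideal L ->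
  (forall j t, (2 <= t)%N -> L (Rsum j t)) ->
  (forall j (m : nat), L (x j m)) -> forall a, I0 a -> L a.

Let I0_sub := I0_left.1.
Let I0M := I0_left.2.

Let TZ q ell c a : T q ell (c *: a) = c *: T q ell a.
Proof. exact: linZ. Qed.

Lemma I0_x j (m : nat) : I0 (x j m).
Proof. by have [b ->] := v_x j. Qed.

Lemma core_twist_comp q q' ell ell' a :
  T q ell (T q' ell' a) = T (fun j => q j * q' j) (fun j => ell' j + ell j) a.
Proof.
move: a; apply: x_ind => [||j m a IHa]; last first.
- by rewrite !TM !Tx TZ Tx scalerA IHa addrA [q' j * _]mulrC.
- by rewrite !T1.
split=> [|c a b IHa IHb]; first by rewrite !lin0 //.
by rewrite !T_lin IHa IHb.
Qed.

Lemma core_twist_id q ell a :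
  (forall j, q j = 1) -> (forall j, ell j = 0) -> T q ell a = a.
Proof.
move=> q1 ell0; move: a; apply: x_ind => [||j m a IHa]; last first.
- by rewrite TM Tx q1 ell0 scale1r addr0 IHa.
- by rewrite T1.
split=> [|c a b IHa IHb]; first by rewrite lin0.
by rewrite T_lin IHa IHb.
Qed.

Lemma left_ideal_twist q ell (L : A -> Prop) :
  left_ideal L -> left_ideal (fun a => L (T q ell a)).
Proof.
move=> [L_sub LM]; split=> [|u a La]; last by rewrite TM; apply: LM.
split=> [|c a b La Lb]; first by rewrite lin0 //; apply: L_sub.1.
by rewrite T_lin; apply: L_sub.2.
Qed.

Lemma left_ideal_mulr z (L : A -> Prop) :
  left_ideal L -> left_ideal (fun a => L (a * z)).
Proof.
move=> [L_sub LM]; split=> [|u a La]; last by rewrite -mulrA; apply: LM.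
split=> [|c a b La Lb]; first by rewrite mul0r; apply: L_sub.1.
by rewrite mulrDl -scalerAl; apply: L_sub.2.
Qed.

Lemma twist_Rsum q ell j t : T q ell (Rsum j t) =
  q j ^+ 2 *: conv_sum (fun a b => x j (ell j - a%:Z) * x j (ell j - b%:Z)) t.
Proof.
rewrite /conv_sum (lin_sum (T_lin q ell)) scaler_sumr.
apply: eq_bigr => k _; rewrite TM !Tx -scalerAl -scalerAr scalerA.
by rewrite ![_ + ell j]addrC.
Qed.

Lemma I0_twist0 q a : I0 a -> I0 (T q (fun=> 0) a).
Proof.
apply: (I0_min (left_ideal_twist q _ I0_left)) => [j t _|j m].
  rewrite twist_Rsum; apply: (subspaceZ I0_sub).
  have := I0_Rsum j t; congr I0; apply: eq_conv_sum => k l _ _.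
  by rewrite !sub0r.
by rewrite Tx addr0; apply: (subspaceZ I0_sub); apply: I0_x.
Qed.

(** Raising the letters [i] keeps nonnegative modes nonnegative and sends $R^i_t$ into the ideal by
    [conv_square_unshift]. *)
Lemma I0_twist_weight q i a : I0 a -> I0 (T q (fun j => (i == j)%:Z) a).
Proof.
apply: (I0_min (left_ideal_twist q _ I0_left)) => [j t _|j m]; last first.
  rewrite Tx; apply: (subspaceZ I0_sub); have := I0_x j (m + (i == j)).
  by rewrite PoszD.
rewrite twist_Rsum; apply: (subspaceZ I0_sub); case: (i == j).
  apply: (conv_square_unshift I0_left) => // [m n|]; last exact: (I0_x j 0).
  by apply: x_comm; left.
by have := I0_Rsum j t; congr I0; apply: eq_conv_sum => k l _ _; rewrite !sub0r.
Qed.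

(** The abstract form of $I_{\lambda_i}$. *)
Definition I0x i (a : A) : Prop := exists2 b, I0 b & exists c, a = b + c * x i (-1).

Lemma I0x_left i : left_ideal (I0x i).
Proof.
split=> [|u _ [b Ib [c ->]]]; last first.
  by exists (u * b); [apply: I0M | exists (u * c); rewrite mulrDr mulrA].
split=> [|k _ _ [b Ib [c ->]] [b' Ib' [c' ->]]].
  by exists 0; [exact: I0_sub.1 | exists 0; rewrite mul0r addr0].
exists (k *: b + b'); first exact: I0_sub.2.
by exists (k *: c + c'); rewrite scalerDr addrACA mulrDl scalerAl.
Qed.

Lemma I0_I0x i a : I0 a -> I0x i a.
Proof. by move=> Ia; exists a => //; exists 0; rewrite mul0r addr0. Qed.

Lemma I0x_mulx i u : I0x i (u * x i (-1)).
Proof. by exists 0; [exact: I0_sub.1 | exists u; rewrite add0r]. Qed.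

(** Lowering the letters [i] turns $R^i_t$ into the interior of $R^i_{t+2}$, whose two end terms are
    left multiples of $x_i(-1)$; likewise $x_i(0)$ becomes $x_i(-1)$ itself. *)
Lemma I0_untwist_weight q i a :
  I0 a -> I0x i (T q (fun j => - (i == j)%:Z) a).
Proof.
have [I_sub IM] := I0x_left i.
apply: (I0_min (left_ideal_twist q _ (I0x_left i))) => [j t t2|j m].
  rewrite twist_Rsum; apply: (subspaceZ I_sub).
  have [<-{j}|nij] := eqVneq i j; last first.
    have := I0_I0x i (I0_Rsum j t); congr I0x; apply: eq_conv_sum => k l _ _.
    by rewrite oppr0 !sub0r.
  have := I0_I0x i (I0_Rsum i t.+2); rewrite conv_sum_ends; last by apply: leq_trans t2.
  move/(subspaceKr I_sub (I0x_mulx i _)); rewrite x_comm; last by left.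
  move/(subspaceKl I_sub (I0x_mulx i _)); congr I0x.
  by apply: eq_conv_sum => k l _ _; congr (x i _ * x i _); lia.
rewrite Tx; apply: (subspaceZ I_sub).
have [<-{j}|nij] := eqVneq i j; last by rewrite addr0; apply/I0_I0x/I0_x.
case: m => [|m]; last by rewrite intS addrAC subrr add0r; apply/I0_I0x/I0_x.
by rewrite -[x i _]mul1r; apply: I0x_mulx.
Qed.

(** The twist by $-\alpha_i$ lowers the letters [i] by 2, raises those of neighbouring nodes by 1
    and fixes the degrees of the others. After right multiplication by $x_i(-1)$ the images of the
    quadratic relations are treated by [conv_square_shift], by [conv_neighbor_shift] and by
    commutation respectively. *)
Lemma I0_untwist_root q i a :
  I0 a -> I0 (T q (fun j => - cartan i j) a * x i (-1)).
Proof.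
have xC j m n : x j m * x j n = x j n * x j m by apply: x_comm; left.
have xSq t : (0 < t)%N -> I0 (conv_sum
    (fun a b => x i (- a.+2%:Z) * x i (- b.+2%:Z)) t * x i (- 1%N%:Z)).
  by apply: (conv_square_shift I0_left (x := fun k => x i (- k%:Z))).
apply: (I0_min (left_ideal_twist q _ (left_ideal_mulr (x i (-1)) I0_left))) => [j t t2|j m].
  rewrite twist_Rsum -scalerAl; apply: (subspaceZ I0_sub).
  have [<-{j}|nij] := eqVneq i j.
    rewrite cartan_id; have := xSq t (ltnW t2); congr (I0 (_ * _)).
    by apply: eq_conv_sum => k l _ _; congr (x i _ * x i _); lia.
  have [ij|ij] := cartan_neq nij.
    have -> : conv_sum (fun k l => x j (- cartan i j - k%:Z) * x j (- cartan i j - l%:Z)) t *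
        x i (-1) = x i (-1) * Rsum j t; last exact: I0M.
      rewrite /conv_sum mulr_suml mulr_sumr ij oppr0; apply: eq_bigr => k _.
      have ji m : x j m * x i (-1) = x i (-1) * x j m.
        by symmetry; apply: x_comm; right.
      by rewrite !sub0r -mulrA ji [LHS]mulrA ji mulrA.
  have [y [xy xyC y0]] := x_bracket ij; rewrite ij opprK.
  apply: (conv_neighbor_shift I0_left (w := x i 0) (y := y)) => //.
  - by move=> m; rewrite xy addr0.
  - exact: (I0_x j 0).
  - exact: (I0_x i 0).
  exact: ltnW.
rewrite Tx -scalerAl; apply: (subspaceZ I0_sub).
have [<-{j}|nij] := eqVneq i j.
  rewrite cartan_id.
  (* The modes $x_i(0)$ and $x_i(1)$ become $x_i(-2)$ and $x_i(-1)$; their products with $x_i(-1)$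
     are $R_3/2$ and $R_2$. Higher modes stay nonnegative and commute to the right. *)
  have := I0_Rsum i 2; rewrite /conv_sum big_nat1 => I11.
  have := I0_Rsum i 3; rewrite /conv_sum big_ltn // big_nat1 [x i (-2) * _]xC.
  move=> /(left_ideal_half I0_left); rewrite xC => I12.
  case: m => [//|[//|m]].
  by rewrite (_ : _ + _ = m%:Z) 1?xC; [apply: I0M; exact: I0_x | lia].
have [ij|ij] := cartan_neq nij.
  by rewrite ij oppr0 addr0 -x_comm; [apply: I0M; apply: I0_x | right].
have [y [xy xyC y0]] := x_bracket ij; rewrite ij opprK xy.
apply: (subspaceD I0_sub).
  by rewrite (_ : m%:Z + 1 = m.+1); [apply: I0M; apply: I0_x | lia].
by rewrite addrK.
Qed.

(** A mode of high degree is moved to the right through the letters of [a]. Each commutator changes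
    the degree by that of one letter, so all terms end in nonnegative modes. Brackets leave the
    simple roots, hence the bound is for all positive roots at once. *)
Lemma v_large a : exists M : nat, forall b (m : int), M%:Z <= m -> I0 (v b m * a).
Proof.
move: a; apply: x_ind => [||j n a [M IHa]].
- split=> [|c a a' [M IHa] [N IHa']].
    by exists 0%N => b m _; rewrite mulr0; apply: I0_sub.1.
  exists (maxn M N) => b m Mm; rewrite mulrDr -scalerAr.
  by apply: I0_sub.2; [apply: IHa | apply: IHa']; lia.
- by exists 0%N => b [] // m _; rewrite mulr1.
exists (M + `|n|)%N => b m Mm; have [c [k bj]] := v_bracket b j.
rewrite mulrA bj mulrDl -mulrA -scalerAl; apply: (subspaceD I0_sub).
  by apply: I0M; apply: IHa; lia.
by apply: (subspaceZ I0_sub); apply: IHa; lia.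
Qed.

(** * Words, contents and their separation *)

Local Notation word := (seq (I * int)).
Local Notation comb := (seq (K * word)).

Definition word_val (w : word) : A := \prod_(p <- w) x p.1 p.2.
Definition comb_val (r : comb) : A := \sum_(p <- r) p.1 *: word_val p.2.
Definition letter_count i (w : word) : nat := count (fun p => p.1 == i) w.

Lemma word_val_cons p w : word_val (p :: w) = x p.1 p.2 * word_val w.
Proof. exact: big_cons. Qed.

Lemma word_val_cat w w' : word_val (w ++ w') = word_val w * word_val w'.
Proof. exact: big_cat. Qed.

Lemma comb_val_cat r s : comb_val (r ++ s) = comb_val r + comb_val s.
Proof. exact: big_cat. Qed.

Lemma comb_valP a : exists r, a = comb_val r.
Proof.
move: a; apply: x_ind => [||j m _ [r ->]].
- split=> [|c _ _ [r ->] [s ->]]; first by exists [::]; rewrite /comb_val big_nil.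
  exists ([seq (c * p.1, p.2) | p <- r] ++ s).
  rewrite /comb_val big_cat big_map scaler_sumr; congr (_ + _).
  by apply: eq_bigr => p _; rewrite scalerA.
- by exists [:: (1, [::])]; rewrite /comb_val big_seq1 /word_val big_nil scale1r.
exists [seq (p.1, (j, m) :: p.2) | p <- r].
rewrite /comb_val big_map mulr_sumr; apply: eq_bigr => p _.
by rewrite word_val_cons scalerAr.
Qed.

Section Separate.
Variables (W : lmodType K) (f : A -> W) (S : W -> Prop).
Variables (N : I -> W -> W) (e : nat -> K).
Hypothesis f_lin : linear f.
Hypothesis S_sub : subspace S.
Hypothesis N_lin : forall i, linear (N i).
Hypothesis SN : forall i u, S u -> S (N i u).
Hypothesis e_inj : injective e.
Hypothesis Nf : forall i w, N i (f (word_val w)) = e (letter_count i w) *: f (word_val w).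

(** Words need not be linearly independent in [A], so the count of a letter belongs to the
    expression and not to its value. The operator [N i] has the words as eigenvectors with
    eigenvalue depending only on the count, and [eigen_separate] extracts one count. *)
Lemma separate_letter i r k : S (f (comb_val r)) ->
  S (f (comb_val [seq p <- r | letter_count i p.2 == k])).
Proof.
pose F k := f (comb_val [seq p <- r | letter_count i p.2 == k]).
pose n := (\max_(p <- r) letter_count i p.2).+1 => Sr.
have lt_n p : p \in r -> (letter_count i p.2 < n)%N.
  by move=> pr; rewrite ltnS; apply: leq_bigmax_seq.
have SF j : (j < n)%N -> S (F j).
  apply: (eigen_separate S_sub (N_lin i) (@SN i) e_inj) => [l|].
    rewrite /F /comb_val (lin_sum f_lin) (lin_sum (N_lin i)) scaler_sumr.
    rewrite !big_filter; apply: eq_bigr => p /eqP def_l.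
    by rewrite (linZ f_lin) (linZ (N_lin i)) Nf def_l !scalerA mulrC.
  have := Sr; congr S; rewrite /F -(lin_sum f_lin) /comb_val; congr f.
  under [RHS]eq_bigr => l _ do rewrite big_filter big_mkcond.
  rewrite [RHS]exchange_big [LHS]big_seq [RHS]big_seq; apply: eq_bigr => p pr.
  rewrite (bigD1 (Ordinal (lt_n p pr))) //= eqxx big1 ?addr0 // => l nl.
  by rewrite eq_sym; move: nl; rewrite -(inj_eq val_inj) => /negbTE ->.
have [/SF//|le_nk] := ltnP k n.
(* A count beyond the maximum occurs in no word. *)
rewrite (_ : [seq p <- r | _] = [::]) /comb_val ?big_nil ?(lin0 f_lin) //; first exact: S_sub.1.
rewrite -[RHS](filter_pred0 r); apply: eq_in_filter => p pr.
by apply/eqP => def_k; move: le_nk; rewrite -def_k leqNgt lt_n.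
Qed.

Definition has_content (c : I -> nat) (w : word) : bool :=
  [forall i, letter_count i w == c i].

Lemma separate_content c r : S (f (comb_val r)) ->
  S (f (comb_val [seq p <- r | has_content c p.2])).
Proof.
move=> Sr; suff: S (f (comb_val [seq p <- r |
    all (fun i => letter_count i p.2 == c i) (enum I)])).
  congr (S (f (comb_val _))); apply: eq_filter => p.
  apply/allP/forallP => [h i|h i _]; first by apply: h; rewrite mem_enum.
  exact: h.
elim: (enum I) => [|i s IHs]; first by rewrite /= filter_predT.
have := separate_letter i (c i) IHs; congr (S (f (comb_val _))).
by rewrite -filter_predI; apply: eq_filter => p.
Qed.
End Separate.

(** As [A] carries no chosen grading, homogeneity is the existence of an expression in words of
    content [c]. *)
Definition homogeneous c (a : A) : Prop :=
  exists2 r, forall p, p \in r -> has_content c p.2 & a = comb_val r.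

Definition shift_word (ell : I -> int) (w : word) : word :=
  [seq (p.1, p.2 + ell p.1) | p <- w].

Lemma twist_word q ell w :
  T q ell (word_val w) = (\prod_(p <- w) q p.1) *: word_val (shift_word ell w).
Proof.
elim: w => [|p w IHw]; first by rewrite /word_val !big_nil T1 scale1r.
rewrite /= !word_val_cons big_cons TM IHw Tx -scalerAl -scalerAr scalerA.
by rewrite mulrC.
Qed.

Lemma letter_count_shift i ell w : letter_count i (shift_word ell w) = letter_count i w.
Proof. by rewrite /letter_count count_map. Qed.

Lemma homogeneous_twist c q ell a : homogeneous c a -> homogeneous c (T q ell a).
Proof.
move=> [r rc ->].
exists [seq (p.1 * \prod_(l <- p.2) q l.1, shift_word ell p.2) | p <- r].
  move=> _ /mapP[p /rc/forallP pc ->] /=; apply/forallP => i.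
  by rewrite letter_count_shift.
rewrite /comb_val (lin_sum (T_lin q ell)) big_map; apply: eq_bigr => p _.
by rewrite TZ twist_word scalerA.
Qed.

(** Each word contains the letter [i]. The part to the right of its last occurrence is not shifted,
    so [v_large] applies to that occurrence, and the letters on the left are absorbed by the left
    ideal. *)
Lemma I0_shift_large i c a : (0 < c i)%N -> homogeneous c a ->
  exists N : nat, forall n, (N <= n)%N -> I0 (T (fun=> 1) (fun j => n%:Z *+ (i == j)) a).
Proof.
move=> ci [r rc ->]; elim: r rc => [|p r IHr] rc.
  by exists 0%N => n _; rewrite /comb_val big_nil lin0 //; apply: I0_sub.1.
have [N IHN] := IHr (fun p' rp' => rc p' (mem_behead (s := p :: r) rp')).
have [M wM] : exists M : nat, forall n, (M <= n)%N ->
    I0 (T (fun=> 1) (fun j => n%:Z *+ (i == j)) (word_val p.2)).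
  have /forallP/(_ i)/eqP pi := rc p (mem_head _ _).
  have : has (fun l => l.1 == i) p.2 by rewrite has_count [count _ _]pi.
  elim: (p.2) => //= l w IHw; rewrite -/(has _ _) orbC.
  (* If [w] has no letter [i], then [l] is the last one in the word. *)
  have [/IHw[M wM] _|no_i /= /eqP def_l] := boolP (has _ w).
    by exists M => n /wM Iw; rewrite word_val_cons TM; apply: I0M.
  have [b xb] := v_x i; have [M vM] := v_large (word_val w).
  exists (M + `|l.2|)%N => n le_n; rewrite word_val_cons TM Tx def_l eqxx scale1r.
  rewrite twist_word big1 ?scale1r // (_ : shift_word _ w = w); last first.
    rewrite -[RHS]map_id; apply/eq_in_map => l' wl' /=.
    have /negbTE nl' := hasPn no_i l' wl'.
    by rewrite eq_sym nl' mulr0n addr0; case: (l').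
  by rewrite xb; apply: vM; rewrite mulr1n; lia.
exists (maxn M N) => n; rewrite geq_max => /andP[Mn Nn].
rewrite /comb_val big_cons T_lin.
by apply: I0_sub.2; [apply: wM | apply: IHN].
Qed.

(** * The annihilator of the vacuum equals the ideal *)

Section Action.
Variables (V : lmodType K) (act : A -> V -> V) (H : I -> int -> V -> V).
Variables (vac : V) (e_root e_fund : I -> V).
Hypothesis act_linl : forall u, linear (act^~ u).
Hypothesis act_linr : forall a, linear (act a).
Hypothesis actM : forall a b u, act (a * b) u = act a (act b u).
Hypothesis act1 : forall u, act 1 u = u.
Hypothesis H_lin : forall i m, linear (H i m).
Hypothesis H_x : forall i j m n u,
  H i m (act (x j n) u) = act (x j n) (H i m u) + act (x j (n + m)) u *+ (i == j).
Hypothesis H_vac : forall i (m : nat), H i m vac = 0.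
Hypothesis vac_neq0 : vac != 0.
Hypothesis x_vac : forall j (m : nat), act (x j m) vac = 0.
Hypothesis R_vac : forall j t, (2 <= t)%N -> act (Rsum j t) vac = 0.
Hypothesis root_vac : forall i, exists2 c, c != 0 & act (x i (-1)) vac = c *: e_root i.
Hypothesis act_root : forall i, exists2 q : I -> K, forall j, q j != 0 &
  forall a, act a (e_root i) = 0 <-> act (T q (cartan i) a) vac = 0.
Hypothesis act_fund : forall i, exists2 q : I -> K, forall j, q j != 0 &
  forall a, act a (e_fund i) = 0 <-> act (T q (fun j => (i == j)%:Z) a) vac = 0.

Local Notation ann a := (act a vac = 0).

Lemma ann_left : left_ideal (fun a => ann a).
Proof.
split=> [|u a a0]; last by rewrite actM a0 lin0.
split=> [|c a b a0 b0]; first exact: (lin0 (act_linl vac)).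
by rewrite act_linl a0 b0 scaler0 addr0.
Qed.

Lemma I0_ann a : I0 a -> ann a.
Proof. exact: (I0_min ann_left). Qed.

Section Newton.
Variable i : I.

(* The k-th elementary symmetric function of the degree shifts of the         *)
(* letters i of w.                                                            *)
Fixpoint elem_shift (w : word) (k : nat) : A :=
  if w is p :: w' then
    x p.1 p.2 * elem_shift w' k +
    (if (i == p.1) && (0 < k)%N then x p.1 (p.2 + 1) * elem_shift w' k.-1 else 0)
  else (k == 0%N)%:R.

Lemma elem_shift0 w : elem_shift w 0 = word_val w.
Proof.
elim: w => [|p w IHw] /=; first by rewrite /word_val big_nil.
by rewrite andbF addr0 IHw word_val_cons.
Qed.

Lemma elem_shift_gt w k : (letter_count i w < k)%N -> elem_shift w k = 0.
Proof.
elim: w k => [|p w IHw] [|k] //=; rewrite /letter_count /= eq_sym.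
case: eqP => _ /=; rewrite ?add1n ?add0n ?ltnS => lt_k.
  by rewrite !IHw ?mulr0 ?addr0 // ltnW.
by rewrite IHw ?mulr0 ?addr0.
Qed.

Lemma elem_shift_top w :
  elem_shift w (letter_count i w) = word_val (shift_word (fun j => (i == j)%:Z) w).
Proof.
elim: w => [|p w IHw]; first by rewrite /= /word_val big_nil.
rewrite /= word_val_cons /= /letter_count /= [p.1 == i]eq_sym.
have [_|_] /= := eqVneq i p.1; rewrite ?add1n ?add0n.
  by rewrite -/(letter_count i w) elem_shift_gt // mulr0 add0r IHw.
by rewrite -/(letter_count i w) !addr0 IHw.
Qed.

(* Newton's identity: the Heisenberg modes H i j act as power sums.           *)
Lemma newton_shift w k : k%:R *: act (elem_shift w k) vac =
  \sum_(j < k) (-1) ^+ j *: H i j.+1 (act (elem_shift w (k - j.+1)) vac).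
Proof.
have act_lin := act_linl vac.
elim: w k => [|p w IHw] k.
  case: k => [|k]; first by rewrite big_ord0 scale0r.
  rewrite /= (lin0 act_lin) scaler0 big1 // => j _.
  case: eqP => _; rewrite ?act1 ?H_vac ?scaler0 //.
  by rewrite (lin0 act_lin) (lin0 (H_lin _ _)) scaler0.
pose s k := act (elem_shift w k) vac; pose Xm m := act (x p.1 m).
have sE k' : act (elem_shift (p :: w) k') vac =
    Xm p.2 (s k') + (if (i == p.1) && (0 < k')%N then Xm (p.2 + 1) (s k'.-1) else 0).
  rewrite /= (linD act_lin) actM; congr (_ + _).
  by case: ifP => _; rewrite ?actM ?(lin0 act_lin).
have Xm_lin m : linear (Xm m) by exact: act_linr.
under eq_bigr => j _ do rewrite sE.
rewrite sE; have [def_i|ni] /= := eqVneq i p.1; last first.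
  rewrite addr0 -(linZ (Xm_lin _)) IHw (lin_sum (Xm_lin _)); apply: eq_bigr => j _.
  by rewrite addr0 (linZ (Xm_lin _)) /Xm H_x (negbTE ni) addr0.
have HX j m u : H i j (Xm m u) = Xm m (H i j u) + Xm (m + j) u.
  by rewrite /Xm H_x def_i eqxx.
case: k => [|k]; first by rewrite big_ord0 scale0r.
have -> : \sum_(j < k.+1) (-1) ^+ j *: H i j.+1 (Xm p.2 (s (k.+1 - j.+1)%N) +
     (if (0 < k.+1 - j.+1)%N then Xm (p.2 + 1) (s (k.+1 - j.+1).-1) else 0)) =
   \sum_(j < k.+1) (-1) ^+ j *: H i j.+1 (Xm p.2 (s (k.+1 - j.+1)%N)) +
   \sum_(j < k) (-1) ^+ j *: H i j.+1 (Xm (p.2 + 1) (s (k - j.+1)%N)).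
  rewrite [X in _ = _ + X](_ : _ = \sum_(j < k.+1) (-1) ^+ j *: H i j.+1
    (if (0 < k.+1 - j.+1)%N then Xm (p.2 + 1) (s (k.+1 - j.+1).-1) else 0)).
    rewrite -big_split; apply: eq_bigr => j _ /=.
    by rewrite -scalerDr (linD (H_lin _ _)).
  rewrite [RHS]big_ord_recr /= subSS subnn /= (lin0 (H_lin _ _)) scaler0 addr0.
  apply: eq_bigr => j _; rewrite subSS subn_gt0 ltn_ord.
  by rewrite -subnS.
under eq_bigr => j _ do rewrite HX scalerDr.
rewrite big_split /=.
under [X in _ = _ + X]eq_bigr => j _ do rewrite HX scalerDr.
rewrite [X in _ = _ + X]big_split /=.
have X_sum m n : \sum_(j < n) (-1) ^+ j *: Xm m (H i j.+1 (s (n - j.+1)%N)) =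
    n%:R *: Xm m (s n).
  rewrite -(linZ (Xm_lin m)) IHw (lin_sum (Xm_lin m)).
  by apply: eq_bigr => j _; rewrite (linZ (Xm_lin m)).
rewrite !X_sum scalerDr -!addrA; congr (_ + _).
rewrite big_ord_recl /= expr0 scale1r subSS subn0 -addrA.
rewrite -natr1 scalerDl scale1r [LHS]addrC; congr (_ + _).
rewrite [RHS]addrCA -[LHS]addr0; congr (_ + _).
rewrite -big_split big1 //= => j _.
rewrite /bump leq0n add1n subSS exprS mulN1r scaleNr.
by rewrite (_ : p.2 + j.+2 = p.2 + 1 + j.+1) ?addNr //; lia.
Qed.

Lemma ann_shift c a : homogeneous c a -> ann a ->
  ann (T (fun=> 1) (fun j => (i == j)%:Z) a).
Proof.
move=> [r rc ->] r0; pose s k := act (\sum_(p <- r) p.1 *: elem_shift p.2 k) vac.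
have act_lin := act_linl vac.
have s_sum k : s k = \sum_(p <- r) p.1 *: act (elem_shift p.2 k) vac.
  by rewrite /s (lin_sum act_lin); apply: eq_bigr => p _; rewrite (linZ act_lin).
have s0 k : s k = 0.
  elim/ltn_ind: k => -[_|k IHk].
    by rewrite -[RHS]r0 /s; congr act; apply: eq_bigr => p _; rewrite elem_shift0.
  apply/eqP; have : k.+1%:R *: s k.+1 == 0; last first.
    by rewrite scaler_eq0 pnatr_eq0.
  have -> : k.+1%:R *: s k.+1 = \sum_(j < k.+1) (-1) ^+ j *: H i j.+1 (s (k.+1 - j.+1)%N).
    rewrite s_sum scaler_sumr.
    under [RHS]eq_bigr => j _ do rewrite s_sum (lin_sum (H_lin _ _)) scaler_sumr.
    rewrite exchange_big; apply: eq_bigr => p _ /=.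
    rewrite scalerA mulrC -scalerA newton_shift scaler_sumr; apply: eq_bigr => j _.
    by rewrite (linZ (H_lin _ _)) !scalerA mulrC.
  by rewrite big1 // => j _; rewrite IHk ?(lin0 (H_lin _ _)) ?scaler0 //; lia.
rewrite -(s0 (c i)) /s; congr act; rewrite /comb_val (lin_sum (T_lin _ _)).
rewrite [LHS]big_seq [RHS]big_seq; apply: eq_bigr => p /rc/forallP/(_ i)/eqP <-.
by rewrite TZ twist_word big1 // scale1r elem_shift_top.
Qed.
End Newton.

Lemma ann_shiftn i c a n : homogeneous c a -> ann a ->
  ann (T (fun=> 1) (fun j => n%:Z *+ (i == j)) a).
Proof.
move=> ha a0; elim: n => [|n IHn].
  by rewrite core_twist_id // => j; rewrite mul0rn.
have := ann_shift i (homogeneous_twist (fun=> 1) _ ha) IHn.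
rewrite core_twist_comp; congr (act (T _ _ a) _ = 0); apply/funext => j.
  by rewrite mulr1.
by case: eqP => _; rewrite ?mulr1n ?mulr0n //; lia.
Qed.

(** The twist that multiplies the letters [i] by 2 preserves the ideal and acts on a word by a power
    of 2, from which the count of [i] can be read. *)
Lemma I0_separate c r : I0 (comb_val r) ->
  I0 (comb_val [seq p <- r | has_content c p.2]).
Proof.
apply: (separate_content (W := A) (f := id) (S := I0)
  (N := fun i => T (fun j => if i == j then 2 else 1) (fun=> 0)) (e := fun k => 2 ^+ k)) => //.
- by move=> i u; apply: I0_twist0.
- by move=> k l /eqP; rewrite -!natrX eqr_nat eqn_exp2l // => /eqP.
move=> i w; rewrite twist_word; congr (_ *: word_val _).
  elim: w => [|p w IHw]; first by rewrite big_nil.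
  rewrite big_cons /letter_count /= IHw [i == _]eq_sym.
  by case: eqP => _; rewrite ?mul1r ?exprS.
by rewrite -[RHS]map_id; apply: eq_map => p; rewrite addr0; case: p.
Qed.

(** Induction on the number of letters, with a descent on the size [N] of the twist at a letter [i]
    that occurs. An element without letters is a scalar, and the vacuum is nonzero. *)
Lemma homogeneous_ann n c a : (\sum_i c i = n)%N -> homogeneous c a -> ann a -> I0 a.
Proof.
elim: n c a => [|n IHn] c a sum_c ha a0.
  have [r rc def_a] := ha.
  have [k def_k] : exists k, a = k *: 1.
    exists (\sum_(p <- r) p.1); rewrite def_a scaler_suml /comb_val.
    rewrite [LHS]big_seq [RHS]big_seq; apply: eq_bigr => p /rc/forallP pc.
    case: (p.2) pc => [|l w] pc; first by rewrite /word_val big_nil.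
    move/eqP: sum_c; rewrite sum_nat_eq0 => /forallP/(_ l.1)/eqP cl.
    by have := pc l.1; rewrite cl /letter_count /= eqxx.
  move: a0; rewrite def_k (linZ (act_linl vac)) act1 => /eqP.
  by rewrite scaler_eq0 (negbTE vac_neq0) orbF => /eqP->; rewrite scale0r; apply: I0_sub.1.
have [i ci] : exists i, (0 < c i)%N.
  apply: contrapT => /forallNP c0; move: sum_c; rewrite big1 // => i _.
  by apply/eqP; rewrite -leqn0 leqNgt; apply/negP/c0.
pose sh N := T (fun=> 1) (fun j => N%:Z *+ (i == j)).
have [N0 large] := I0_shift_large ci ha.
suff step N : I0 (sh N.+1 a) -> I0 (sh N a).
  have I_sh k N : (N0 <= N + k)%N -> I0 (sh N a).
    elim: k N => [|k IHk] N; first by rewrite addn0; apply: large.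
    by rewrite addnS -addSn => /IHk/step.
  have := I_sh N0 0%N (leqnn _); rewrite /sh core_twist_id // => j.
  by rewrite mul0rn.
move=> IN1; have hN : homogeneous c (sh N a) by apply: homogeneous_twist.
have aN : ann (sh N a) by apply: (ann_shiftn i N ha a0).
have [b Ib [d def_N]] : I0x i (sh N a).
  have := I0_untwist_weight (fun=> 1) i IN1; rewrite core_twist_comp.
  congr (I0x i (T _ _ a)); apply/funext => j; rewrite ?mulr1 //.
  by case: eqP => _; rewrite ?mulr1n ?mulr0n; lia.
have [r rc def_r] := hN; have [s def_d] := comb_valP d.
(* The cofactor [d] need not be homogeneous; only its words that acquire content [c] by appending
   $x_i(-1)$ are kept, which is legitimate because the ideal is stable under taking components. *)
pose s' := [seq p <- s | has_content c (rcons p.2 (i, -1))].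
have d_x t : comb_val [seq (- p.1, rcons p.2 (i, -1)) | p <- t] = - (comb_val t * x i (-1)).
  rewrite /comb_val big_map mulr_suml -sumrN; apply: eq_bigr => p _.
  by rewrite -cats1 word_val_cat {2}/word_val big_seq1 /= scaleNr scalerAl.
have Ib' : I0 (sh N a - comb_val s' * x i (-1)).
  have : I0 (comb_val (r ++ [seq (- p.1, rcons p.2 (i, -1)) | p <- s])).
    rewrite comb_val_cat d_x -def_r -def_d def_N addrK.
    exact: Ib.
  move/(I0_separate c); congr I0; rewrite filter_cat comb_val_cat def_r; congr (comb_val _ + _); first exact/all_filterP/allP.
  by rewrite filter_map -d_x.
have [k k0 x_root] := root_vac i; have [q q0 act_q] := act_root i.
(* Both the shifted [a] and its difference with the cofactor times $x_i(-1)$ kill the vacuum, and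
   $x_i(-1)$ sends the vacuum to a nonzero multiple of $e^{\alpha_i}$. *)
have s_root : act (comb_val s') (e_root i) = 0.
  have /eqP := I0_ann Ib'; rewrite (linB (act_linl vac)) aN sub0r oppr_eq0 actM x_root.
  by rewrite (linZ (act_linr _)) scaler_eq0 (negbTE k0) => /eqP.
have I_s : I0 (T q (cartan i) (comb_val s')).
  apply: (IHn (fun j => c j - (i == j))%N); last exact/act_q.
    apply/eqP; rewrite -eqSS -sum_c -addn1; apply/eqP.
    rewrite (bigD1 i) // [RHS](bigD1 i) //= eqxx addnAC subnK //; congr (_ + _)%N.
    by apply: eq_bigr => j /negbTE; rewrite eq_sym => ->; rewrite subn0.
  apply: homogeneous_twist; exists s' => // p; rewrite mem_filter => /andP[/forallP pc _].
  apply/forallP => j; have /eqP := pc j; rewrite /letter_count -cats1 count_cat /= addn0.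
  by move=> <-; rewrite addnK.
(* The inverse scalars make this twist undo the one by $\alpha_i$, leaving the cofactor itself times
   $x_i(-1)$. *)
have := I0_untwist_root (fun j => (q j)^-1) i I_s; rewrite core_twist_comp.
rewrite core_twist_id => [I_sx|j|j]; last 2 first.
- by rewrite mulVf.
- by rewrite subrr.
by rewrite -(subrK (comb_val s' * x i (-1)) (sh N a)); apply: (subspaceD I0_sub).
Qed.

Theorem core_annihilator a : ann a <-> I0 a.
Proof.
split=> [a0|]; last exact: I0_ann.
have [r def_a] := comb_valP a.
have sep c : ann (comb_val [seq p <- r | has_content c p.2]).
  apply: (separate_content (f := fun a => act a vac) (S := fun u => u = 0)
    (N := fun i => H i 0) (e := fun k => k%:R)) => //.
  - split=> // k u u' -> ->; by rewrite scaler0 addr0.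
  - by move=> i u ->; rewrite lin0.
  - by move=> k l /eqP; rewrite eqr_nat => /eqP.
  - move=> i; elim=> [|p w IHw]; first by rewrite /word_val big_nil act1 H_vac scale0r.
    rewrite word_val_cons actM H_x IHw (linZ (act_linr _)) /letter_count /= [p.1 == i]eq_sym.
    rewrite addr0 natrD scalerDl addrC; congr (_ + _).
    by case: eqP => _; rewrite ?scale1r ?scale0r.
  by rewrite -def_a.
(* Induction on the number of words: those sharing the content of the first word are split off. The
   hypothesis [sep] is generalized since it must pass to the remaining words. *)
rewrite def_a; elim: {r def_a}_.+1 {-2}r (ltnSn (size r)) sep => // n IHn r le_n sep.
case: r le_n sep => [|p r] le_n sep; first by rewrite /comb_val big_nil; apply: I0_sub.1.
pose c i := letter_count i p.2.
have -> : comb_val (p :: r) = comb_val [seq p' <- p :: r | has_content c p'.2] +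
    comb_val [seq p' <- p :: r | ~~ has_content c p'.2].
  by rewrite /comb_val !big_filter; apply: bigID.
apply: (subspaceD I0_sub).
  apply: (homogeneous_ann (c := c) erefl); last exact: sep.
  by exists [seq p' <- p :: r | has_content c p'.2] => // p'; rewrite mem_filter => /andP[].
have pc : has_content c p.2 by apply/forallP.
apply: IHn => [|d].
  rewrite /= pc /=; move: le_n; rewrite /= ltnS; apply: leq_ltn_trans.
  by rewrite size_filter count_size.
rewrite -filter_predI.
have [<-|ncd] := pselect (c = d).
  rewrite (_ : filter _ _ = [::]); first by rewrite /comb_val big_nil (lin0 (act_linl vac)).
  by rewrite -[RHS](filter_pred0 (p :: r)); apply: eq_filter => p' /=; rewrite andbN.
have := sep d; congr (act (comb_val _) _ = 0); apply: eq_filter => p' /=.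
case: (boolP (has_content d p'.2)) => //= /forallP pd; apply/esym/negP => /forallP pc'.
by apply: ncd; apply/funext => i; rewrite -(eqP (pc' i)) -(eqP (pd i)).
Qed.

(** The fundamental weight twist carries the annihilator of [e_fund i] to that of the vacuum.
    Untwisting the ideal lands in [I0x]; conversely the twist turns $x_i(-1)$ into a multiple of
    $x_i(0)$. *)
Theorem core_annihilator_fund i a : act a (e_fund i) = 0 <-> I0x i a.
Proof.
have [q q0 act_q] := act_fund i; rewrite act_q core_annihilator.
pose q' j := (q j)^-1.
have untw b : T q' (fun j => - (i == j)%:Z) (T q (fun j => (i == j)%:Z) b) = b.
  rewrite core_twist_comp core_twist_id // => j; first by rewrite mulVf.
  by rewrite subrr.
split=> [Ia|[b Ib [c ->]]]; first by rewrite -(untw a); apply: I0_untwist_weight.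
rewrite (linD (T_lin _ _)) TM Tx eqxx -scalerAr.
apply: (subspaceD I0_sub); first exact: I0_twist_weight.
by apply: (subspaceZ I0_sub); apply: I0M; apply: (I0_x i 0).
Qed.

Theorem core_annihilators : (forall a, ann a <-> I0 a) /\
  (forall i a, act a (e_fund i) = 0 <-> I0x i a).
Proof. by split; [exact: core_annihilator | exact: core_annihilator_fund]. Qed.
End Action.
End PrincipalCore.

(** * The ideal $I_{\lambda_0}$ and its generators *)

Section GeneratedLeftIdeals.
Variables (K : numFieldType) (A : algType K).
Implicit Types S : set A.

Definition left_span S : set A :=
  [set a | exists2 r : seq (A * A),
     forall p, p \in r -> S p.2 & a = \sum_(p <- r) p.1 * p.2].

Lemma left_span_left S : left_ideal (left_span S : A -> Prop).
Proof.
split=> [|u _ [r Sr ->]]; last first.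
  exists [seq (u * p.1, p.2) | p <- r] => [_ /mapP[p /Sr Sp ->] //|].
  by rewrite big_map mulr_sumr; apply: eq_bigr => p _; rewrite mulrA.
split=> [|a _ _ [r Sr ->] [s Ss ->]]; first by exists [::]; rewrite ?big_nil.
exists ([seq (a *: p.1, p.2) | p <- r] ++ s) => [p|].
  by rewrite mem_cat => /orP[/mapP[{}p /Sr Sp ->]|/Ss].
rewrite big_cat big_map scaler_sumr; congr (_ + _).
by apply: eq_bigr => p _; rewrite scalerAl.
Qed.

Lemma left_span_gen S a : S a -> left_span S a.
Proof.
by move=> Sa; exists [:: (1, a)] => [p|]; rewrite ?inE ?big_seq1 ?mul1r // => /eqP->.
Qed.

Lemma left_span_min S (L : A -> Prop) :
  left_ideal L -> (forall a, S a -> L a) -> forall a, left_span S a -> L a.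
Proof.
by move=> [L_sub LM] SL _ [r Sr ->]; apply: (subspace_sum L_sub) => p /Sr/SL/LM.
Qed.

Lemma left_ideal_sum (L L' : A -> Prop) : left_ideal L -> left_ideal L' ->
  left_ideal ([set a + b | a in (L : set A) & b in (L' : set A)] : set A).
Proof.
move=> [[L0 LD] LM] [[L'0 L'D] L'M].
split=> [|u _ [a La [b Lb <-]]]; last first.
  by exists (u * a); [apply: LM | exists (u * b); [apply: L'M | rewrite mulrDr]].
split=> [|c _ _ [a La [b Lb <-]] [a' La' [b' Lb' <-]]].
  by exists 0; [exact: L0 | exists 0; [exact: L'0 | rewrite addr0]].
exists (c *: a + a'); first exact: LD.
by exists (c *: b + b'); [exact: L'D | rewrite scalerDr addrACA].
Qed.
End GeneratedLeftIdeals.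

Lemma commZr (K : fieldType) (A : algType K) (a : K) (u w : A) :
  u * w = w * u -> u * (a *: w) = (a *: w) * u.
Proof. by move=> uw; rewrite -scalerAl -scalerAr uw. Qed.

Section IdealI0.
Variables (R : realType) (D : ade_lie_algebra R) (E : weight_cocycle D).
Variable X : affine_action E.
Local Notation C := R[i].
Local Notation P := (weights (rank D)).
Local Notation U := (Unbar X).
Local Notation x_ := (@xalpha R D E X).
Local Notation I0 := (@I0 R D E X : U -> Prop).
Implicit Types (b c : P) (i j : 'I_(rank D)).

Lemma lidealE (S : set U) : lideal S = @left_span C U S.
Proof. by []. Qed.

Lemma lideal_left (S : set U) : left_ideal (lideal S : U -> Prop).
Proof. by rewrite lidealE; apply: left_span_left. Qed.

Lemma I0_left : left_ideal I0.
Proof.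
exact: (@left_ideal_sum C U _ _
  (lideal_left [set r | exists j t, (2 <= t)%N /\ r = Rrel X j t])
  (lideal_left [set r | exists u : nbarp X, r = U_in (nbarp_in u)])).
Qed.

Lemma Jideal_I0 (a : U) : Jideal a -> I0 a.
Proof.
move=> Ja; exists a => //; exists 0; last exact: addr0.
exact: (lideal_left _).1.1.
Qed.

Lemma Uplus_I0 (a : U) : Uplus a -> I0 a.
Proof.
move=> Ua; exists 0; first exact: (lideal_left _).1.1.
by exists a => //; apply: add0r.
Qed.

Lemma I0_Rrel j t : I0 (Rrel X j t).
Proof.
case: (leqP 2 t) => [t2|t2].
  by apply: Jideal_I0; rewrite /Jideal lidealE; apply: left_span_gen; exists j, t.
have -> : Rrel X j t = 0 by rewrite /Rrel big_geq.
exact: I0_left.1.1.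
Qed.

Lemma nbarp_in_U (x : nilpart X) (m : nat) :
  nbarp_in (<< x *g m >> : nbarp X) = nterm x m.
Proof. by apply: (@loop_mapU _ _ _ _ _ id Posz (fun _ _ _ => erefl)). Qed.

Lemma nbarp_in_lin : linear (@nbarp_in R D E X).
Proof. by apply: (@loop_map_lin _ _ _ _ _ id Posz (fun _ _ _ => erefl)). Qed.

Lemma I0_nbarp (u : nbarp X) : I0 (U_in (nbarp_in u)).
Proof.
by apply: Uplus_I0; rewrite /Uplus lidealE; apply: left_span_gen; exists u.
Qed.

Lemma I0_Uvec b (m : nat) : I0 (Uvec X b m).
Proof.
by have := I0_nbarp << nvec X b *g m >>; rewrite nbarp_in_U.
Qed.

(** Climbing to a higher root by commutators with $x_j(0)$ keeps the degree and stays in the left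
    ideal, since both factors of the commutator lie in it. *)
Lemma nbarp_ideal (L : U -> Prop) : left_ideal L ->
  (forall j (m : nat), L (x_ j m)) -> forall u : nbarp X, L (U_in (nbarp_in u)).
Proof.
move=> [L_sub LM] Lx.
have Lin : subspace (fun u : nbar X => L (U_in u)).
  split=> [|a u w Lu Lw].
    by rewrite (lin0 (@U_in_lin R D E X)); apply: L_sub.1.
  by rewrite U_in_lin; apply: L_sub.2.
elim/loop_ind => [|x m].
  split=> [|a u w Lu Lw]; first by rewrite (lin0 nbarp_in_lin); apply: Lin.1.
  by rewrite nbarp_in_lin; apply: Lin.2.
rewrite nbarp_in_U; elim/nil_ind: x => [|b pb].
  split=> [|a y z Ly Lz]; first by rewrite (lin0 (nterm_lin m)); apply: Lin.1.
  by rewrite nterm_lin; apply: Lin.2.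
rewrite -/(Uvec X b m); move: m.
apply: (Uvec_ind (X := X) (Q := fun b => forall m : nat, L (Uvec X b m)) _ _ pb).
  by move=> j m; apply: Lx.
move=> {}b j {}pb IHb [a def_bj] m.
rewrite -[m%:Z]add0r def_bj; apply: (subspaceZ L_sub).
by apply: (subspaceB L_sub); apply: LM; [apply: IHb | apply: (Lx j 0%N)].
Qed.

Lemma I0_min (L : U -> Prop) : left_ideal L ->
  (forall j t, (2 <= t)%N -> L (Rrel X j t)) ->
  (forall j (m : nat), L (x_ j m)) -> forall a, I0 a -> L a.
Proof.
move=> L_left LR Lx _ [a + [b + <-]]; rewrite /Jideal /Uplus !lidealE => Ja Ub; apply: (subspaceD L_left.1).
  by apply: (left_span_min L_left _ Ja) => _ [j [t [t2 ->]]]; apply: LR.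
by apply: (left_span_min L_left _ Ub) => _ [u ->]; apply: nbarp_ideal.
Qed.

Lemma xalpha_comm j k m n : j = k \/ cartan_mx D j k = 0 ->
  x_ j m * x_ k n = x_ k n * x_ j m.
Proof.
move=> jk; rewrite !xalphaE Uvec_br (Ubr0 _ _ (pos_alpha j) (pos_alpha k)).
  by rewrite addr0.
apply: (@br_rvec0 _ _ _ X _ _ (cartan_mx D j k)); try exact: root_alpha.
  by rewrite !wt_alpha cartan_mxP.
by case: jk => [->|->] //; rewrite cartan_diag.
Qed.

(** The pairing $\langle\alpha_j,\alpha_j+\alpha_i\rangle=2-1$ is nonnegative, so the bracket
    vanishes by [br_rvec0]. *)
Lemma xalpha_Ubr_comm i j m n : cartan_mx D j i = -1 ->
  x_ j m * Ubr X (alpha_wt j) (alpha_wt i) n =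
  Ubr X (alpha_wt j) (alpha_wt i) n * x_ j m.
Proof.
move=> ji.
have [->|[pji [a ->]]] := Ubr_cases X n (pos_alpha j) (pos_alpha i).
  by rewrite mulr0 mul0r.
apply: (@commZr C U); rewrite xalphaE Uvec_br.
rewrite (Ubr0 _ _ (pos_alpha j) pji); first by rewrite addr0.
apply: (@br_rvec0 _ _ _ X _ _ 1 (root_alpha j) (pos_root pji)) => //.
by rewrite wt_lin formDr !wt_alpha !cartan_mxP cartan_diag ji -rmorphD.
Qed.

Lemma xalpha_bracket i j : cartan_mx D i j = -1 ->
  exists y : int -> U, [/\ forall m n, x_ j m * x_ i n = x_ i n * x_ j m + y (m + n),
    forall m n, x_ j m * y n = y n * x_ j m & forall m : nat, I0 (y m)].
Proof.
move=> ij; exists (Ubr X (alpha_wt j) (alpha_wt i)); split=> [m n|m n|m].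
- exact: Uvec_br.
- by apply: xalpha_Ubr_comm; rewrite cartan_sym.
have [->|[_ [c ->]]] := Ubr_cases X m (pos_alpha j) (pos_alpha i).
  exact: I0_left.1.1.
by apply: (subspaceZ I0_left.1); apply: I0_Uvec.
Qed.

Lemma Uvec_bracket (b : {b | b \in pos_roots D}) j :
  exists (c : {b | b \in pos_roots D}) (a : C), forall m n,
  Uvec X (val b) m * x_ j n = x_ j n * Uvec X (val b) m + a *: Uvec X (val c) (m + n).
Proof.
have nterm0 m : nterm (0 : nilpart X) m = 0 by exact: (lin0 (nterm_lin m)).
case: (nbr_nvec_cases X (valP b) (pos_alpha j)) => [bj0|[pbj [a bj]]].
  (* For a zero bracket the root is arbitrary, with coefficient 0. *)
  exists b, 0 => m n; rewrite xalphaE Uvec_br scale0r /Ubr bj0 nterm0.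
  by rewrite (lin0 (@U_in_lin R D E X)).
exists (exist (fun b => b \in pos_roots D) _ pbj), a => m n; rewrite xalphaE Uvec_br /Ubr bj ntermZ.
by rewrite U_inZ.
Qed.
End IdealI0.

Lemma scale_eq (K : fieldType) (V : lmodType K) (a b : K) (v : V) :
  a = b -> a *: v = b *: v.
Proof. by move=> ->. Qed.

(** * The Fock space and the vertex operators *)

Section MalgLinear.
Variables (K : fieldType) (T : choiceType).
Local Notation M := {malg K[T]}.

Lemma malgUZ (c : K) t : << c *g t >> = c *: << t >> :> M.
Proof. by apply/malgP => k; rewrite mcoeffZ !mcoeffU mulrnAr mulr1. Qed.

Lemma malg_lin_eq (W : lmodType K) (f g : M -> W) :
  linear f -> linear g -> (forall t, f << t >> = g << t >>) -> f =1 g.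
Proof.
move=> f_lin g_lin fg v; rewrite [v]monalgE (lin_sum f_lin) (lin_sum g_lin).
by apply: eq_bigr => t _; rewrite malgUZ (linZ f_lin) (linZ g_lin) fg.
Qed.

Lemma malg_coef_lin t : linear (fun v : M => v@_t : K^o).
Proof. by move=> a u v; rewrite mcoeffD mcoeffZ. Qed.

Lemma malg_coefU t t' : (<< t >> : M)@_t' = (t == t')%:R.
Proof. exact: mcoeffU. Qed.
End MalgLinear.

Lemma cmonom_divK (T : choiceType) (m : {cmonom T}) (p : T) :
  (0 < m p)%N -> mulcm (ucm p) (divcm m (ucm p)) = m.
Proof.
move=> mp; apply/eqP/cmP => q; rewrite mulcmE divcmE ucmE.
by case: eqP => [<-|_]; [rewrite subnKC | rewrite subn0].
Qed.

Lemma cmonom_mulK (T : choiceType) (m : {cmonom T}) (p : T) :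
  divcm (mulcm (ucm p) m) (ucm p) = m.
Proof. by apply/eqP/cmP => q; rewrite divcmE mulcmE addnC addnK. Qed.

Section MonomialWeight.
Variables (T : choiceType) (wgt : T -> nat).

Definition cmonom_weight (m : {cmonom T}) : nat := (\sum_(p <- finsupp m) m p * wgt p)%N.

Lemma cmonom_weightEw (m : {cmonom T}) (d : {fset T}) : (finsupp m `<=` d)%fset ->
  cmonom_weight m = (\sum_(p <- d) m p * wgt p)%N.
Proof.
move=> le; rewrite /cmonom_weight (big_fset_incl _ le) // => p _.
by rewrite -cmE_neq0 negbK => /eqP ->.
Qed.

Lemma cmonom_weightM m m' :
  cmonom_weight (mulcm m m') = (cmonom_weight m + cmonom_weight m')%N.
Proof.
set d := (finsupp m `|` finsupp m')%fset.
have dE : (finsupp (mulcm m m') `<=` d)%fset.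
  by rewrite -[finsupp (mulcm m m')]/(finsupp (mmul m m')) mdomD.
rewrite (cmonom_weightEw dE) (cmonom_weightEw (fsubsetUl _ (finsupp m'))).
rewrite (cmonom_weightEw (fsubsetUr (finsupp m) _)) -big_split /=.
by apply: eq_bigr => p _; rewrite mulcmE mulnDl.
Qed.

Lemma cmonom_weightU p : cmonom_weight (ucm p) = wgt p.
Proof.
have dE : (finsupp (ucm p) `<=` [fset p])%fset by rewrite mdomU.
by rewrite (cmonom_weightEw dE) big_seq_fset1 ucmE eqxx mul1n.
Qed.

Lemma cmonom_weight1 : cmonom_weight (onecm T) = 0%N.
Proof. by rewrite /cmonom_weight big1 // => p _; rewrite onecmE. Qed.
End MonomialWeight.

Section FockSpace.
Variables (R : realType) (D : ade_lie_algebra R).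
Local Notation C := R[i].
Local Notation P := (weights (rank D)).
Local Notation form := (invform D).
Local Notation VP := (VP D).
Local Notation mono := (fock_monomial D).
Implicit Types (mu : mono) (b c : P) (j : 'I_(rank D)) (v : VP).

(* A locked copy of the basis: comparing two basis vectors of VP by            *)
(* conversion unfolds the finitely supported functions behind them.           *)
Definition fock_basis : mono -> P -> VP := locked (@fock_vec R D).

Lemma fock_basisE mu b : fock_basis mu b = fock_vec mu b.
Proof. by rewrite /fock_basis -lock. Qed.

Lemma VP_eq (W : lmodType C) (f g : VP -> W) :
  linear f -> linear g -> (forall mu b, f (fock_basis mu b) = g (fock_basis mu b)) ->
  f =1 g.
Proof.
move=> f_lin g_lin fg; apply: (malg_lin_eq f_lin g_lin) => -[mu b].
by have := fg mu b; rewrite fock_basisE.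
Qed.

Lemma VP_ext_lin (f : mono * P -> VP) : linear (lext f : VP -> VP).
Proof. exact: lext_is_linear. Qed.

Lemma VP_extE (f : mono * P -> VP) mu b : lext f (fock_basis mu b) = f (mu, b).
Proof. by rewrite fock_basisE; apply: lextU. Qed.

Lemma fock_coef mu b nu c : (fock_basis mu b)@_(nu, c) = ((mu == nu) && (b == c))%:R :> C.
Proof. by rewrite fock_basisE malg_coefU xpair_eqE. Qed.

Lemma expvE b : expv b = fock_basis (onecm _) b.
Proof. by rewrite fock_basisE. Qed.

Lemma coef_lin nu c : linear (fun v : VP => v@_(nu, c) : C^o).
Proof. exact: malg_coef_lin. Qed.

Lemma expv_neq0 b : expv b != 0.
Proof.
apply/eqP => /(congr1 (fun v : VP => v@_(onecm _, b))).
rewrite expvE fock_coef !eqxx mcoeff0 => /eqP; exact/negP/oner_neq0.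
Qed.

Section Series.
Variable A : nat -> VP -> VP.
Hypothesis A_lin : forall n, linear (A n).

Lemma series_pow_lin k a : linear (series_pow A k a).
Proof.
elim: k a => [|k IHk] a /=.
  by case: eqP => _ c u v; rewrite ?scaler0 ?addr0.
by apply: lin_sumf => n; apply: comp_lin (A_lin n) (IHk _).
Qed.

Lemma series_exp_lin a : linear (series_exp A a).
Proof. by apply: lin_sumf => k; apply: lin_scaler; apply: series_pow_lin. Qed.

Lemma series_exp0 v : series_exp A 0 v = v.
Proof. by rewrite /series_exp big_ord1 /= invr1 scale1r. Qed.

Lemma series_exp1 v : series_exp A 1 v = A 1 v.
Proof.
rewrite /series_exp big_ord_recl big_ord1 /= scaler0 add0r big_nat1 /=.
by rewrite invr1 scale1r.
Qed.

Lemma series_exp_vanish v a : (forall n, (0 < n)%N -> A n v = 0) -> (0 < a)%N ->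
  series_exp A a v = 0.
Proof.
move=> Av a0; have pow0 k l : (0 < l)%N -> series_pow A k l v = 0.
  elim: k l => [|k IHk] l l0 /=; first by case: l l0.
  rewrite big_nat big1 // => n /andP[n0 nl].
  have [nl0|nl0] := posnP (l - n)%N; last by rewrite IHk ?(lin0 (A_lin n)).
  rewrite nl0; case: k {IHk} => [|k] /=; first by rewrite Av.
  by rewrite big_geq ?(lin0 (A_lin n)).
by rewrite /series_exp big1 // => k _; rewrite pow0 ?scaler0.
Qed.

(* If each A_n shifts the grading operator T by n c, so does every            *)
(* coefficient of exp A; c = 0 gives operators commuting with A.              *)
Lemma series_exp_grade (T : VP -> VP) (c : C) :
  linear T ->
  (forall n v, (0 < n)%N -> T (A n v) = A n (T v) + (c * n%:R) *: A n v) ->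
  forall a v, T (series_exp A a v) =
    series_exp A a (T v) + (c * a%:R) *: series_exp A a v.
Proof.
move=> T_lin TA a v; have pow_grade k l u : T (series_pow A k l u) =
    series_pow A k l (T u) + (c * l%:R) *: series_pow A k l u.
  elim: k l u => [|k IHk] l u /=.
    by case: eqP => [->|_]; rewrite ?mulr0 ?scale0r ?addr0 // (lin0 T_lin) scaler0 addr0.
  rewrite (lin_sum T_lin) scaler_sumr -big_split !big_nat.
  apply: eq_bigr => n /andP[n0]; rewrite ltnS => nl /=.
  rewrite (TA _ _ n0) IHk (linD (A_lin n)) (linZ (A_lin n)) -addrA -scalerDl.
  by rewrite -mulrDr -natrD (subnK nl).
rewrite /series_exp (lin_sum T_lin) scaler_sumr -big_split.
apply: eq_bigr => k _ /=.
by rewrite (linZ T_lin) pow_grade scalerDr !scalerA [_ * (_^-1)]mulrC.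
Qed.
End Series.

Lemma heis_lin h m : linear (heis_op h m : VP -> VP).
Proof. exact: VP_ext_lin. Qed.

Lemma heis0_fock h mu b : heis_op h 0 (fock_basis mu b) = form h (wt b) *: fock_basis mu b.
Proof. by apply: etrans (VP_extE _ mu b) _; rewrite fock_basisE. Qed.

Lemma heisS_fock h k mu b : heis_op h k.+1 (fock_basis mu b) =
  \sum_j (k.+1%:R * form h (alpha D j) * (mu (j, k))%:R)
     *: fock_basis (divcm mu (ucm (j, k))) b.
Proof.
apply: etrans (VP_extE _ mu b) _; apply: eq_bigr => j _; congr (_ *: _); exact/esym/fock_basisE.
Qed.

Lemma heisN_fock h k mu b : heis_op h (Negz k) (fock_basis mu b) =
  \sum_j form h (fweight D j) *: fock_basis (mulcm (ucm (j, k)) mu) b.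
Proof.
apply: etrans (VP_extE _ mu b) _; apply: eq_bigr => j _; congr (_ *: _); exact/esym/fock_basisE.
Qed.

Lemma heis_expv h (n : nat) b : (0 < n)%N -> heis_op h n (expv b) = 0.
Proof.
case: n => // n _; rewrite expvE heisS_fock big1 // => j _.
by rewrite onecmE mulr0 scale0r.
Qed.

Definition label_op (f : P -> C) (g : P -> P) : VP -> VP :=
  lext (fun mb : mono * P => f mb.2 *: fock_vec mb.1 (g mb.2)).

Lemma label_lin f g : linear (label_op f g).
Proof. exact: VP_ext_lin. Qed.

Lemma label_fock f g mu b : label_op f g (fock_basis mu b) = f b *: fock_basis mu (g b).
Proof. by apply: etrans (VP_extE _ mu b) _; rewrite -fock_basisE. Qed.

Lemma label_heis f g h m v : m != 0 ->
  label_op f g (heis_op h m v) = heis_op h m (label_op f g v).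
Proof.
move=> m0; move: v; apply: VP_eq => [||mu b].
- exact: comp_lin (label_lin f g) (heis_lin h m).
- exact: comp_lin (heis_lin h m) (label_lin f g).
rewrite label_fock (linZ (heis_lin h m)).
case: m m0 => [[|k]|k] m0; first by rewrite eqxx in m0.
  rewrite !heisS_fock (lin_sum (label_lin f g)) scaler_sumr; apply: eq_bigr => j _.
  by rewrite (linZ (label_lin f g)) label_fock !scalerA mulrC.
rewrite !heisN_fock (lin_sum (label_lin f g)) scaler_sumr; apply: eq_bigr => j _.
by rewrite (linZ (label_lin f g)) label_fock !scalerA mulrC.
Qed.

Lemma label_inj f g v : (forall b, f b != 0) -> injective g ->
  label_op f g v = 0 -> v = 0.
Proof.
move=> f0 g_inj fv0; apply/malgP => -[mu b]; rewrite mcoeff0.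
have coefE : forall v, (label_op f g v)@_(mu, g b) = f b * v@_(mu, b).
  apply: (VP_eq (W := C^o)) => [||nu c].
  - exact: (comp_lin (coef_lin mu (g b)) (label_lin f g)).
  - by move=> a u w; rewrite mcoeffD mcoeffZ mulrDr [X in _ + _ = X + _]mulrCA.
  rewrite label_fock mcoeffZ !fock_coef (inj_eq g_inj).
  by case: (eqVneq c b) => [->//|]; rewrite andbF !mulr0.
have := coefE v; rewrite fv0 mcoeff0 => /esym/eqP.
by rewrite mulf_eq0 (negbTE (f0 b)) => /eqP.
Qed.

(* The conformal weight: deg mu + <b, b> / 2.                                 *)
Definition energy : VP -> VP :=
  lext (fun mb : mono * P =>
    ((cmonom_weight (fun p : 'I_(rank D) * nat => p.2.+1) mb.1)%:R +
     wt_form mb.2 mb.2 / 2) *: fock_vec mb.1 mb.2).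

Lemma energy_lin : linear energy.
Proof. exact: VP_ext_lin. Qed.

Lemma energy_fock mu b : energy (fock_basis mu b) =
  ((cmonom_weight (fun p : 'I_(rank D) * nat => p.2.+1) mu)%:R +
     wt_form b b / 2) *: fock_basis mu b.
Proof. by apply: etrans (VP_extE _ mu b) _; rewrite -fock_basisE. Qed.

Lemma energy_heis h m v : m != 0 ->
  energy (heis_op h m v) = heis_op h m (energy v) - m%:~R *: heis_op h m v.
Proof.
move=> m0; move: v; apply: VP_eq => [||mu b].
- exact: comp_lin energy_lin (heis_lin h m).
- move=> a u v; rewrite energy_lin !heis_lin !scalerDr !opprD addrACA.
  by rewrite scalerN !scalerA [_ * a]mulrC.
rewrite energy_fock (linZ (heis_lin h m)) -scalerBl.
case: m m0 => [[|k]|k] m0; first by rewrite eqxx in m0.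
  rewrite !heisS_fock (lin_sum energy_lin) scaler_sumr; apply: eq_bigr => j _.
  rewrite (linZ energy_lin) energy_fock !scalerA.
  have [->|mu0] := posnP (mu (j, k)); first by rewrite mulr0 !mul0r mulr0 scale0r.
  apply: scale_eq; rewrite [RHS]mulrC; apply: (f_equal (fun z => _ * z)).
  rewrite -{2}(cmonom_divK mu0) cmonom_weightM cmonom_weightU natrD.
  by rewrite -[k.+1%:~R]/(k.+1%:R); ring.
rewrite !heisN_fock (lin_sum energy_lin) scaler_sumr; apply: eq_bigr => j _.
rewrite (linZ energy_lin) energy_fock !scalerA.
apply: scale_eq; rewrite [RHS]mulrC; apply: (f_equal (fun z => _ * z)).
rewrite cmonom_weightM cmonom_weightU natrD NegzE mulrNz.
by rewrite -[k.+1%:~R]/(k.+1%:R); ring.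
Qed.

(** As $\lambda_j$ is dual to $\alpha_j$, its positive mode is $k+1$ times the partial derivative in
    the single variable $(j,k)$. Hence a vector killed by all these modes involves no variable, as
    [fock_vacuum] records. *)
Lemma heis_coef j k v nu c :
  (heis_op (fweight D j) k.+1 v)@_(nu, c) =
  (k.+1%:R * (nu (j, k)).+1%:R) * v@_(mulcm (ucm (j, k)) nu, c).
Proof.
move: v; apply: (VP_eq (W := C^o)) => [||mu b].
- exact: (comp_lin (coef_lin nu c) (heis_lin _ _)).
- by move=> a u w; rewrite mcoeffD mcoeffZ mulrDr [X in _ + _ = X + _]mulrCA.
rewrite heisS_fock (bigD1 j) //= big1 => [|l nlj]; last first.
  by rewrite fweightP eq_sym (negbTE nlj) mulr0 mul0r scale0r.
rewrite addr0 mcoeffZ !fock_coef fweightP eqxx mulr1.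
have [mu0|mu0] := posnP (mu (j, k)).
  rewrite mu0 mulr0 mul0r (_ : mu == _ = false) ?mulr0 //.
  by apply/negbTE/cmP => /(_ (j, k)); rewrite mu0 mulcmE ucmE eqxx.
have -> : (divcm mu (ucm (j, k)) == nu) = (mu == mulcm (ucm (j, k)) nu).
  apply/eqP/eqP => [<-|->]; last exact: cmonom_mulK.
  by rewrite cmonom_divK.
by case: eqP => [->|_]; rewrite ?mulr0 // mulcmE ucmE eqxx add1n.
Qed.

Lemma fock_vacuum v mu b : (forall j k, heis_op (fweight D j) k.+1 v = 0) ->
  mu != onecm _ -> v@_(mu, b) = 0.
Proof.
move=> hv mu1; have [[j k] mujk] : exists p, (0 < mu p)%N.
  apply: contrapT => /forallNP mu0; case/cmP: mu1 => p; rewrite onecmE.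
  by apply/eqP; rewrite -leqn0 leqNgt; apply/negP/mu0.
have := heis_coef j k v (divcm mu (ucm (j, k))) b.
rewrite hv mcoeff0 cmonom_divK // => /esym/eqP.
by rewrite !mulf_eq0 !pnatr_eq0 => /eqP.
Qed.
End FockSpace.

Section FiniteSupportSums.
Variables (K : fieldType) (V : lmodType K) (J : choiceType) (S : set J) (F : J -> V).
Variable T : V -> V.
Hypothesis T_lin : linear T.

(** A sum of infinite support is 0 by convention, so a linear map commutes with it only if the
    support is preserved; injectivity ensures this. In [fsbig_eigen] the map is applied to the sum
    and not to its terms, so the support does not change. *)
Lemma fsbig_lin_inj : (forall v, T v = 0 -> v = 0) ->
  T (\sum_(j \in S) F j) = \sum_(j \in S) T (F j).
Proof.
move=> T_inj; rewrite (lin_sum T_lin); congr bigop; rewrite /finite_support.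
congr (locked_with _ (fset_set (S `&` _))); apply/seteqP; split=> j /= Fj; apply: contra_not Fj.
  exact: T_inj.
by move=> ->; rewrite (lin0 T_lin).
Qed.

Lemma fsbig_eigen (e : K) : (forall j, S j -> T (F j) = e *: F j) ->
  T (\sum_(j \in S) F j) = e *: \sum_(j \in S) F j.
Proof.
move=> TF; rewrite (lin_sum T_lin) scaler_sumr; apply: eq_big_seq => j.
by case: finite_supportP => // Y YS _ _ /YS/TF.
Qed.
End FiniteSupportSums.

Lemma scale2_eq (K : fieldType) (V : lmodType K) (a b a' b' : K) (v : V) :
  a * b = a' * b' -> a *: (b *: v) = a' *: (b' *: v).
Proof. by rewrite !scalerA => ->. Qed.

Section VertexOperators.
Variables (R : realType) (D : ade_lie_algebra R) (E : weight_cocycle D).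
Local Notation C := R[i].
Local Notation P := (weights (rank D)).
Local Notation form := (invform D).
Local Notation VP := (VP D).
Implicit Types (mu : fock_monomial D) (b c : P) (j : 'I_(rank D)) (v : VP).

Lemma wt_formDl b c d : wt_form (b + c) d = wt_form b d + wt_form c d.
Proof. by rewrite /wt_form wt_lin formDl. Qed.

Lemma wt_formC b c : wt_form b c = wt_form c b.
Proof. exact: formC. Qed.

Definition Aminus b (n : nat) v : VP := - ((- n%:Z)%:~R : C)^-1 *: heis_op (wt b) (- n%:Z) v.
Definition Aplus b (n : nat) v : VP := - (n%:Z%:~R : C)^-1 *: heis_op (wt b) n%:Z v.

Lemma Aminus_lin b n : linear (Aminus b n).
Proof. exact: lin_scaler (heis_lin (wt b) _). Qed.
Lemma Aplus_lin b n : linear (Aplus b n).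
Proof. exact: lin_scaler (heis_lin (wt b) _). Qed.

Lemma Eminus_lin b p : linear (Eminus b p : VP -> VP).
Proof. exact: (series_exp_lin (Aminus_lin b)). Qed.

Lemma Eplus_lin b p : linear (Eplus b p : VP -> VP).
Proof. exact: (series_exp_lin (Aplus_lin b)). Qed.

Lemma Eminus0 b v : Eminus b 0 v = v.
Proof. exact: series_exp0. Qed.

Lemma Eplus0 b v : Eplus b 0 v = v.
Proof. exact: series_exp0. Qed.

Lemma Eminus1 b v : Eminus b 1 v = heis_op (wt b) (-1) v.
Proof.
apply: etrans (series_exp1 (Aminus b) v) _; rewrite /Aminus.
have -> : - ((- 1%:Z)%:~R : C)^-1 = 1 by rewrite mulrNz invrN opprK invr1.
exact: scale1r.
Qed.

Lemma Eplus_expv b c p : (0 < p)%N -> Eplus b p (expv c) = 0 :> VP.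
Proof.
move=> p0; apply: (series_exp_vanish (Aplus_lin b) _ p0) => n n0.
by rewrite /Aplus (heis_expv _ _ n0) scaler0.
Qed.

Lemma Aminus_grade (T : VP -> VP) (a : C) b : linear T ->
  (forall m v, m != 0 ->
    T (heis_op (wt b) m v) = heis_op (wt b) m (T v) - (a * m%:~R) *: heis_op (wt b) m v) ->
  forall p v, T (Eminus b p v) = Eminus b p (T v) + (a * p%:R) *: Eminus b p v.
Proof.
move=> T_lin Th; apply: (series_exp_grade (Aminus_lin b) T_lin) => n v n0.
rewrite /Aminus (linZ T_lin) Th; last by lia.
rewrite scalerBr; congr (_ + _); rewrite -scaleNr !scalerA; apply: scale_eq.
by rewrite mulNr -mulrN mulrC; congr (_ * _); rewrite mulrNz mulrN opprK.
Qed.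

Lemma Aplus_grade (T : VP -> VP) (a : C) b : linear T ->
  (forall m v, m != 0 ->
    T (heis_op (wt b) m v) = heis_op (wt b) m (T v) - (a * m%:~R) *: heis_op (wt b) m v) ->
  forall p v, T (Eplus b p v) = Eplus b p (T v) + (- a * p%:R) *: Eplus b p v.
Proof.
move=> T_lin Th; apply: (series_exp_grade (Aplus_lin b) T_lin) => n v n0.
rewrite /Aplus (linZ T_lin) Th; last by lia.
rewrite scalerBr; congr (_ + _); rewrite -scaleNr !scalerA; apply: scale_eq.
by rewrite mulNr -mulrN mulrC; congr (_ * _); rewrite mulNr.
Qed.

Lemma label_Eminus f g b p v :
  label_op f g (Eminus b p v) = Eminus b p (label_op f g v).
Proof.
rewrite (Aminus_grade (T := label_op f g) (a := 0) (label_lin f g)).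
  by rewrite mul0r scale0r addr0.
by move=> m w m0; rewrite (label_heis _ _ _ _ m0) mul0r scale0r subr0.
Qed.

Lemma label_Eplus f g b p v :
  label_op f g (Eplus b p v) = Eplus b p (label_op f g v).
Proof.
rewrite (Aplus_grade (T := label_op f g) (a := 0) (label_lin f g)).
  by rewrite oppr0 mul0r scale0r addr0.
by move=> m w m0; rewrite (label_heis _ _ _ _ m0) mul0r scale0r subr0.
Qed.

Lemma energy_Eminus b p v :
  energy (Eminus b p v) = Eminus b p (energy v) + p%:R *: Eminus b p v.
Proof.
rewrite (Aminus_grade (T := @energy R D) (a := 1) (@energy_lin R D)) ?mul1r //.
by move=> m w m0; rewrite (energy_heis _ _ m0) mul1r.
Qed.

Lemma energy_Eplus b p v :
  energy (Eplus b p v) = Eplus b p (energy v) - p%:R *: Eplus b p v.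
Proof.
rewrite (Aplus_grade (T := @energy R D) (a := 1) (@energy_lin R D)).
  by rewrite mulN1r scaleNr.
by move=> m w m0; rewrite (energy_heis _ _ m0) mul1r.
Qed.

(* Locked for the same reason as fock_basis.                                  *)
Definition vertex_factor : P -> nat -> nat -> VP -> VP :=
  locked (fun b p q v => Eminus b p (Eplus b q v)).

Lemma vertex_factorE b p q v : vertex_factor b p q v = Eminus b p (Eplus b q v).
Proof. by rewrite /vertex_factor -lock. Qed.

Lemma vertex_factor_lin b p q : linear (vertex_factor b p q).
Proof.
rewrite /vertex_factor -lock; exact: comp_lin (Eminus_lin b p) (Eplus_lin b q).
Qed.

Lemma vertex_factorZ b p q (k : C) v :
  vertex_factor b p q (k *: v) = k *: vertex_factor b p q v.
Proof. exact: (linZ (vertex_factor_lin b p q)). Qed.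

Lemma label_vertex_factor f g b p q v :
  label_op f g (vertex_factor b p q v) = vertex_factor b p q (label_op f g v).
Proof. by rewrite !vertex_factorE label_Eminus label_Eplus. Qed.

Lemma energy_vertex_factor b p q v : energy (vertex_factor b p q v) =
  vertex_factor b p q (energy v) + (p%:R - q%:R) *: vertex_factor b p q v.
Proof.
rewrite !vertex_factorE energy_Eminus energy_Eplus (linB (Eminus_lin b p)).
by rewrite (linZ (Eminus_lin b p)) scalerBl addrAC addrA.
Qed.

Lemma vertex_factor_expv b c p q : (0 < q)%N -> vertex_factor b p q (expv c) = 0.
Proof.
by move=> q0; rewrite vertex_factorE (Eplus_expv _ _ q0) (lin0 (Eminus_lin b p)).
Qed.

Lemma vertex_lin b m : linear (vertex_op E b m : VP -> VP).
Proof. exact: VP_ext_lin. Qed.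

Definition vertex_dom b (m : int) c : set (nat * nat) :=
  [set pq : nat * nat | (pq.1%:Z - pq.2%:Z)%:~R + wt_form b c = (- m - 1)%:~R :> C].

Lemma vertex_fock b m mu c : vertex_op E b m (fock_basis mu c) =
  \sum_(pq \in vertex_dom b m c)
    vertex_factor b pq.1 pq.2 (E b c *: fock_basis mu (b + c)).
Proof.
apply: etrans (VP_extE _ mu c) _; rewrite -fock_basisE.
by apply: eq_fsbigr => pq _; rewrite vertex_factorE.
Qed.

Lemma eps_neq0 b c : E b c != 0.
Proof.
apply/eqP => e0; have := eps_root E b c; rewrite e0 expr0n.
by rewrite eqn0Ngt eps_order_gt0 => /eqP; rewrite eq_sym oner_eq0.
Qed.

Definition translate (l : P) : VP -> VP := label_op (E l) (+%R l).

Lemma translate_lin l : linear (translate l).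
Proof. exact: label_lin. Qed.

Lemma translate_eq0 l v : translate l v = 0 -> v = 0.
Proof. by apply: label_inj => [b|]; [exact: eps_neq0 | exact: addrI]. Qed.

Lemma translate_vac l : translate l (expv 0) = expv l.
Proof. by rewrite !expvE /translate label_fock eps0r scale1r addr0. Qed.

Lemma translate_vertex_factor l b p q (k : C) mu c :
  translate l (vertex_factor b p q (k *: fock_basis mu c)) =
  (k * E l c) *: vertex_factor b p q (fock_basis mu (l + c)).
Proof.
rewrite [translate l _]label_vertex_factor (linZ (label_lin _ _)) label_fock.
by rewrite scalerA vertex_factorZ.
Qed.

(** Passing $e_l$ through $x^b$ changes the exponent by $\langle b,l\rangle=n$, hence the mode by
    [n]; passing it through $e_b$ produces the commutator of the cocycle. The exponentials commute
    with $e_l$. *)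
Lemma vertex_translate b l (m n : int) v : wt_form b l = n%:~R ->
  vertex_op E b m (translate l v) =
  (E b l / E l b) *: translate l (vertex_op E b (m + n) v).
Proof.
move=> bl; move: v; apply: VP_eq => [||mu c].
- exact: comp_lin (vertex_lin b m) (translate_lin l).
- by apply: lin_scaler; apply: comp_lin (translate_lin l) (vertex_lin b (m + n)).
rewrite {1}/translate label_fock (linZ (vertex_lin b m)) !vertex_fock.
have -> : vertex_dom b m (l + c) = vertex_dom b (m + n) c.
  apply/seteqP; split=> -[p q]; rewrite /vertex_dom /= [wt_form b (_ + _)]wt_formC.
    rewrite wt_formDl [wt_form l b]wt_formC bl [wt_form c b]wt_formC => h.
    apply: (addIr n%:~R); rewrite -addrA [wt_form b c + _]addrC h -rmorphD.
    by apply: (f_equal (fun z : int => z%:~R)); lia.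
  move=> h; rewrite wt_formDl [wt_form l b]wt_formC bl [wt_form c b]wt_formC.
  rewrite [n%:~R + _]addrC addrA h -rmorphD.
  by apply: (f_equal (fun z : int => z%:~R)); lia.
rewrite (fsbig_lin_inj _ _ (translate_lin l) (@translate_eq0 l)).
have sc_lin (k : C) : linear (fun v : VP => k *: v).
  by move=> a u w; rewrite scalerDr !scalerA mulrC.
have sc_inj (k : C) : k != 0 -> forall v : VP, k *: v = 0 -> v = 0.
  by move=> k0 v /eqP; rewrite scaler_eq0 (negbTE k0) => /eqP.
rewrite (fsbig_lin_inj _ _ (sc_lin _) (sc_inj _ (eps_neq0 l c))).
rewrite (fsbig_lin_inj _ _ (sc_lin _) (sc_inj (E b l / E l b) _)); last first.
  by rewrite mulf_neq0 ?invr_eq0 ?eps_neq0.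
apply: eq_fsbigr => -[p q] _ /=.
apply: etrans (f_equal (fun z => _ *: z) (vertex_factorZ _ _ _ _ _)) _.
apply/esym; apply: etrans (f_equal (fun z => _ *: z) (translate_vertex_factor _ _ _ _ _ _ _)) _.
rewrite (addrCA l b c); apply: scale2_eq.
have := eps_cocycle E b l c; have := eps_cocycle E l b c.
have := eps_neq0 l b; rewrite [l + b]addrC.
move: (E b l) (E l b) (E (b + l) c) (E l c) (E b (l + c)) (E b c) (E l (b + c)).
move=> x y z s t u w y0 h1 h2; rewrite -h1 -h2.
by rewrite -mulrA mulKf.
Qed.

(** The factors of the two exponentials change the energy by $p-q$ and $e_b$ by $\langle
    b,c\rangle+1$, as [b] has norm 2. The terms in the mode [m] are those with $p-q+\langle
    b,c\rangle=-m-1$, so the total change is $-m$. *)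
Lemma vertex_energy b m v : wt_form b b = 2 ->
  energy (vertex_op E b m v) =
  vertex_op E b m (energy v) - m%:~R *: vertex_op E b m v.
Proof.
move=> bb; move: v; apply: VP_eq => [||mu c].
- exact: comp_lin (@energy_lin R D) (vertex_lin b m).
- move=> a u w; rewrite energy_lin !vertex_lin !scalerDr !opprD addrACA.
  by rewrite scalerN !scalerA [_ * a]mulrC.
rewrite energy_fock (linZ (vertex_lin b m)) -scalerBl vertex_fock.
apply: (fsbig_eigen (@energy_lin R D)) => -[p q]; rewrite /vertex_dom /= => pq.
rewrite vertex_factorZ (linZ (@energy_lin R D)) energy_vertex_factor.
rewrite energy_fock vertex_factorZ -scalerDl !scalerA.
apply: scale_eq; rewrite !wt_formDl ![wt_form _ (b + c)]wt_formC !wt_formDl bb.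
rewrite [wt_form c b]wt_formC.
have -> : wt_form b c = (- m - 1)%:~R - (p%:Z - q%:Z)%:~R by rewrite -pq addrC addKr.
by rewrite !rmorphB rmorphN /=; field.
Qed.

(** On a group-like vector the annihilating exponential reduces to its constant term, so only the
    index pair with $q=0$ survives. *)
Lemma vertex_expv_cases b c (n m : int) : wt_form b c = n%:~R ->
  vertex_op E b m (expv c) =
  if - m - 1 - n is Posz p then E b c *: Eminus b p (expv (b + c)) else 0.
Proof.
move=> bc; rewrite expvE vertex_fock -expvE.
have domE p q : vertex_dom b m c (p, q) <-> - m - 1 - n = p%:Z - q%:Z.
  rewrite /vertex_dom /= bc -rmorphD; split=> [/intr_inj h|h]; first by lia.
  by apply: (f_equal (fun z : int => z%:~R)); lia.
have F0 p q : (0 < q)%N -> vertex_factor b p q (E b c *: expv (b + c)) = 0.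
  by move=> q0; rewrite vertex_factorZ (vertex_factor_expv _ _ _ q0) scaler0.
case def_p: (- m - 1 - n) => [p|p].
  rewrite -(fsbig_widen [set (p, 0%N)] (vertex_dom b m c)) => [||[p' q] /=].
  - by rewrite fsbig_set1 vertex_factorZ vertex_factorE Eplus0.
  - by move=> _ ->; apply/domE; rewrite def_p subr0.
  move=> [/domE pq npq]; apply: F0; rewrite lt0n; apply/eqP => q0; apply: npq.
  by rewrite q0 in pq *; rewrite def_p subr0 in pq; case: pq => <-.
apply: fsbig1 => -[p' q] /domE pq /=; apply: F0.
by move: pq; rewrite def_p; case: q => // /eqP; rewrite subr0.
Qed.

Lemma vertex_expv b c (n m : int) (p : nat) : wt_form b c = n%:~R ->
  - m - 1 - n = p%:Z ->
  vertex_op E b m (expv c) = E b c *: Eminus b p (expv (b + c)).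
Proof. by move=> /(vertex_expv_cases m) -> ->. Qed.

Lemma vertex_expv_eq0 b c (n m : int) : wt_form b c = n%:~R ->
  - m - 1 - n < 0 -> vertex_op E b m (expv c) = 0.
Proof. by move=> /(vertex_expv_cases m) ->; case: (- m - 1 - n). Qed.

(* Locked for the same reason as fock_basis.                                  *)
Definition mode : 'I_(rank D) -> int -> VP -> VP :=
  locked (fun j => vertex_op E (alpha_wt j)).

Lemma modeE j m v : mode j m v = vertex_op E (alpha_wt j) m v.
Proof. by rewrite /mode -lock. Qed.

Lemma mode_lin j m : linear (mode j m).
Proof. by rewrite /mode -lock; apply: vertex_lin. Qed.
End VertexOperators.

Lemma loop_map_coef (K : fieldType) (V W : lmodType K) (T : choiceType) (f : V -> W)
    (u : loops V T) m :
  linear f -> (loop_map f id u : loops W T)@_m = f u@_m.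
Proof.
move=> f_lin; move: u; apply: loop_eq => [a u v|a u v|x k].
- by rewrite (loop_map_lin id f_lin) mcoeffD loop_coefZ.
- by rewrite mcoeffD loop_coefZ f_lin.
rewrite (loop_mapU id f_lin) !mcoeffU.
by case: eqP; rewrite ?mulr1n // !mulr0n (lin0 f_lin).
Qed.

(** * The action of U(nbar) on V_P *)

Section AffineAction.
Variables (R : realType) (D : ade_lie_algebra R) (E : weight_cocycle D).
Variable X : affine_action E.
Local Notation C := R[i].
Local Notation P := (weights (rank D)).
Local Notation form := (invform D).
Local Notation VP := (VP D).
Local Notation U := (Unbar X).
Local Notation n := (nilpart X).
Local Notation nbbr := (@nbar_bracket R D E X).
Implicit Types (b c : P) (j : 'I_(rank D)) (v : VP).

(** By invariance two root vectors pair to zero unless their roots are opposite. Hence the central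
    term of the affine bracket vanishes on the nilpotent loops. *)
Lemma nil_form0 (x y : n) : form (vsval x) (vsval y) = 0.
Proof.
apply: (nil_eq2 (W := C^o) (f := fun x y : n => form (vsval x) (vsval y))
  (g := fun _ _ => 0)) => [z|z|z|z|b c pb pc].
- by move=> a u v; rewrite vsval_lin form_linl.
- by move=> a u v; rewrite vsval_lin form_linr.
- by move=> a u v; rewrite scaler0 addr0.
- by move=> a u v; rewrite scaler0 addr0.
rewrite !vsval_nvec //; apply/eqP/negPn/negP => bc0.
case/eqP: (pos_rootD_neq0 pb pc).
apply: (csa_nondegenerate (brP D) (csaP D) (formP D)) => [|H hH]; first exact: wt_csa.
case: (formP D) => _ _ _ inv; have := inv (rvec X b) H (rvec X c).
rewrite (br_anti (brP D)) (rvec_weight X (pos_root pb) hH).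
rewrite (rvec_weight X (pos_root pc) hH) -scaleNr formZl formZr.
by move/(mulIf bc0) => e; rewrite wt_lin formDl -e subrr.
Qed.

Lemma csa_rvec_form0 h b : h \in csa D -> root_wt b -> form h (rvec X b) = 0.
Proof.
move=> hh rb; case: (formP D) => _ _ _ inv; have := inv h (wt b) (rvec X b).
case: (csaP D) => abel _ _; rewrite (abel _ _ hh (wt_csa b)) form0l.
rewrite (rvec_weight X rb (wt_csa b)) formZr (form_normalized rb) => /esym/eqP.
by rewrite mulf_eq0 pnatr_eq0 => /eqP.
Qed.

Lemma affine_elt_bracket (x y : lie D) (m k : int) : form x y = 0 ->
  affine_bracket (affine_elt x m) (affine_elt y k) = affine_elt (br D x y) (m + k).
Proof.
have [br_linr br_linl _ _] := brP D; move=> xy0; rewrite /affine_bracket /affine_elt.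
congr pair; first exact: (loop_bracketU br_linl br_linr).
rewrite big1 // => m' _; rewrite big1 // => k' _; case: ifP => // _.
rewrite !mcoeffU; case: eqP => _; last by rewrite mulr0n form0l mulr0.
by case: eqP => _; rewrite ?mulr1n ?xy0 ?mulr0n ?mulr0 // formC form0l mulr0.
Qed.

Lemma nbar_in_lin : linear (@nbar_in R D E X : nbar X -> affine D).
Proof.
move=> a u v; rewrite /nbar_in (loop_map_lin id (@vsval_lin R D E X)).
by congr pair; rewrite /= scaler0 addr0.
Qed.

Lemma nbar_in_nterm (x : n) m : nbar_in (nterm x m) = affine_elt (vsval x) m.
Proof. by congr pair; apply: (loop_mapU id (@vsval_lin R D E X)). Qed.

Lemma nbar_in_br (u v : nbar X) : nbar_in (nbbr u v) = affine_bracket (nbar_in u) (nbar_in v).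
Proof.
have [br_linr br_linl _ _] := brP D; rewrite /affine_bracket /nbar_in.
congr pair; last first.
  rewrite big1 // => m _; rewrite big1 // => k _ /=.
  by rewrite !(loop_map_coef _ _ (@vsval_lin R D E X)) nil_form0 mulr0 if_same.
pose lm := loop_map (vsval : n -> lie D) (id : int -> int) : nbar X -> loops (lie D) int.
have lm_lin : linear lm by apply: loop_map_lin; apply: vsval_lin.
have lb_linl w : linear ((@loop_bracket C (lie D) int (br D))^~ w).
  exact: loop_bracket_linl br_linl w.
have lb_linr w : linear (@loop_bracket C (lie D) int (br D) w).
  exact: loop_bracket_linr br_linr w.
pose f (u v : nbar X) := lm (nbbr u v).
pose g (u v : nbar X) := @loop_bracket C (lie D) int (br D) (lm u) (lm v).
suff fg : forall u v : nbar X, f u v = g u v by exact: fg.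
have f1 w : linear (f^~ w) by exact: comp_lin lm_lin (nbbr_linl w).
have f2 w : linear (f w) by exact: comp_lin lm_lin (nbbr_linr w).
have g1 w : linear (g^~ w) by exact: comp_lin (lb_linl _) lm_lin.
have g2 w : linear (g w) by exact: comp_lin (lb_linr _) lm_lin.
apply: (loop_eq2 f1 f2 g1 g2) => x m y k; rewrite /f /g.
have lmU (z : n) (l : int) : lm << z *g l >> = << vsval z *g l >>.
  exact: (loop_mapU id (@vsval_lin R D E X)).
rewrite -/(nterm x m) -/(nterm y k) nbbr_nterm !lmU.
by rewrite (loop_bracketU br_linl br_linr) vsval_nbr.
Qed.

Lemma nbar_module : lie_module nbbr (fun u : nbar X => aact X (nbar_in u)).
Proof.
have [act1 act2 act3] := aact_module X.
split=> [v|u|u w v]; last by rewrite nbar_in_br act3.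
  exact: comp_lin (act1 v) nbar_in_lin.
exact: act2.
Qed.

Lemma U_act_linl v : linear (@U_act R D E X ^~ v).
Proof. exact: env_act_linl nbar_module v. Qed.

Lemma U_act_linr (a : U) : linear (U_act a).
Proof. exact: env_act_linr nbar_module a. Qed.

Lemma U_actM (a b : U) v : U_act (a * b) v = U_act a (U_act b v).
Proof. exact: env_actM nbar_module a b v. Qed.

Lemma U_act1 v : U_act (1 : U) v = v.
Proof. exact: env_act1 nbar_module v. Qed.

Lemma U_act_xalpha j m v :
  U_act (xalpha X j m) v = mode E j m v.
Proof.
rewrite modeE -(aact_rvec X _ _ (root_alpha j)) xalphaE.
apply: etrans (env_act_in nbar_module _ v) _.
by rewrite nbar_in_nterm vsval_nvec ?pos_alpha.
Qed.

(** This is the module axiom for the affine bracket; the central term drops out because the Cartan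
    subalgebra is orthogonal to the root vectors. *)
Lemma heis_mode h (m k : int) j v : h \in csa D ->
  heis_op h m (mode E j k v) =
  mode E j k (heis_op h m v) + form h (alpha D j) *: mode E j (k + m) v.
Proof.
move=> hh; have ra := root_alpha j; have [act1 act2 act3] := aact_module X.
have := act3 (affine_elt h m) (affine_elt (rvec X (alpha_wt j)) k) v.
rewrite (affine_elt_bracket _ _ (csa_rvec_form0 hh ra)) (rvec_weight X ra hh) wt_alpha.
have -> : affine_elt (form (alpha D j) h *: rvec X (alpha_wt j)) (m + k) =
    form h (alpha D j) *: affine_elt (rvec X (alpha_wt j)) (k + m).
  rewrite addrC formC; congr pair; last by rewrite /= scaler0.
  exact: (linZ (@loopU_lin C (lie D) int (k + m))).
have actE l w : aact X (affine_elt (rvec X (alpha_wt j)) l) w = mode E j l w.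
  by rewrite modeE (aact_rvec X _ _ ra).
rewrite (linZ (act1 v)) !actE !(aact_heis X _ _ hh) => ->.
by rewrite addrC subrK.
Qed.
End AffineAction.

Lemma conv_sum_shift (V : zmodType) (G : int -> int -> V) (n t : nat) :
  (forall (a : nat) b, G a b = 0) ->
  conv_sum (fun a b => G (n%:Z - a%:Z) (- b%:Z)) t =
  conv_sum (fun a b => G (- a%:Z) (- b%:Z)) (t - n).
Proof.
move=> G0; elim: n t => [|n IHn] t.
  by rewrite subn0; apply: eq_conv_sum => a b _ _; rewrite sub0r.
case: t => [|[|t]].
- by rewrite /conv_sum !big_geq.
- by rewrite /conv_sum !big_geq // subSS sub0n.
rewrite conv_sum_head // subSS -IHn [n.+1%:Z - _]addrC.
rewrite (_ : - 1%N%:Z + n.+1%:Z = n%:Z) ?G0 ?add0r; last by lia.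
by apply: eq_conv_sum => a b _ _; congr G; lia.
Qed.

(** * The quadratic relations on the vacuum and the translation to $e^\lambda$ *)

Section VacuumRelations.
Variables (R : realType) (D : ade_lie_algebra R) (E : weight_cocycle D).
Variable X : affine_action E.
Local Notation C := R[i].
Local Notation P := (weights (rank D)).
Local Notation form := (invform D).
Local Notation VP := (VP D).
Local Notation U := (Unbar X).
Local Notation vac := (expv 0 : VP).
Local Notation Xv := (mode E).
Implicit Types (i j : 'I_(rank D)) (v : VP).

Lemma coef_heis0 h v mu b : (heis_op h 0 v)@_(mu, b) = form h (wt b) * v@_(mu, b).
Proof.
move: v; apply: (VP_eq (W := C^o)) => [||nu c].
- exact: (comp_lin (coef_lin mu b) (heis_lin h 0)).
- by move=> a u w; rewrite mcoeffD mcoeffZ mulrDr [X in _ + _ = X + _]mulrCA.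
rewrite heis0_fock mcoeffZ !fock_coef.
by case: (eqVneq c b) => [->//|]; rewrite andbF !mulr0.
Qed.

Lemma coef_energy v b :
  (energy v)@_(onecm _, b) = wt_form b b / 2 * v@_(onecm _, b).
Proof.
move: v; apply: (VP_eq (W := C^o)) => [||nu c].
- exact: (comp_lin (coef_lin (onecm _) b) (@energy_lin R D)).
- by move=> a u w; rewrite mcoeffD mcoeffZ mulrDr [X in _ + _ = X + _]mulrCA.
rewrite energy_fock mcoeffZ !fock_coef.
have [->|] := eqVneq nu (onecm _); last by rewrite !mulr0.
by have [->|] := eqVneq c b; rewrite ?mulr0 // cmonom_weight1 add0r.
Qed.

Lemma wt_form_alpha j k : wt_form (alpha_wt j) (alpha_wt k) = (cartan_mx D j k)%:~R.
Proof. by rewrite /wt_form !wt_alpha cartan_mxP. Qed.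

Lemma wt_form0 (b : P) : wt_form b 0 = 0.
Proof. by rewrite /wt_form wt0 formC form0l. Qed.

Lemma vertex_vac_ge0 j (m : nat) : Xv j m vac = 0.
Proof.
have h : wt_form (alpha_wt j) 0 = 0%:~R by rewrite wt_form0.
by rewrite modeE; apply: (vertex_expv_eq0 E h); lia.
Qed.

Lemma vertex_vac1 j : Xv j (-1) vac = expv (alpha_wt j).
Proof.
have h : wt_form (alpha_wt j) 0 = 0%:~R by rewrite wt_form0.
rewrite modeE (vertex_expv E (p := 0) h) //.
by rewrite eps0r scale1r Eminus0 addr0.
Qed.

Lemma vertex_vac2 j : Xv j (-2) vac = heis_op (alpha D j) (-1) (expv (alpha_wt j)).
Proof.
have h : wt_form (alpha_wt j) 0 = 0%:~R by rewrite wt_form0.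
rewrite modeE (vertex_expv E (p := 1) h) //.
by rewrite eps0r scale1r Eminus1 addr0 wt_alpha.
Qed.

Lemma vertex_alpha2 j : Xv j (-2) (expv (alpha_wt j)) = 0.
Proof.
have h : wt_form (alpha_wt j) (alpha_wt j) = 2%:~R by rewrite wt_form_alpha cartan_diag.
by rewrite modeE (vertex_expv_eq0 E h).
Qed.

Lemma vertex_comm j (m k : int) v : Xv j m (Xv j k v) = Xv j k (Xv j m v).
Proof.
have actE (a b : int) : U_act (xalpha X j a * xalpha X j b) v = Xv j a (Xv j b v).
  apply: etrans (U_actM _ _ _) _; apply: etrans (U_act_xalpha _ _ _ _) _.
  by apply: f_equal; apply: U_act_xalpha.
apply: etrans (esym (actE m k)) _; apply: etrans _ (actE k m).
by apply: (f_equal (fun a : U => U_act a v)); apply: xalpha_comm; left.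
Qed.

Section Square.
Variable j : 'I_(rank D).

Let G (a b : int) : VP := Xv j a (Xv j b vac).
Definition square_vac (t : nat) : VP := conv_sum (fun a b => G (- a%:Z) (- b%:Z)) t.

Let G_comm (a b : int) : G a b = G b a.
Proof. exact: vertex_comm. Qed.

Let G_ge0 (a : nat) (b : int) : G a b = 0.
Proof.
rewrite G_comm /G vertex_vac_ge0; exact: (lin0 (mode_lin E j b)).
Qed.

(** The mode $h(m)$ raises either factor by [m]. The terms in which a mode becomes nonnegative
    vanish on the vacuum, which is what [conv_sum_shift] uses to reindex. *)
Lemma heis_square h (m : nat) t : h \in csa D ->
  heis_op h m (square_vac t) =
  form h (alpha D j) *: (square_vac (t - m) + square_vac (t - m)).
Proof.
move=> hh; have vac0 : heis_op h m vac = 0.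
  case: m => [|m]; last exact: heis_expv.
  by rewrite expvE heis0_fock wt0 formC form0l scale0r.
have hG (a b : int) : heis_op h m (G a b) = form h (alpha D j) *: (G (m%:Z + a) b + G a (m%:Z + b)).
  rewrite /G heis_mode // heis_mode // vac0 (lin0 (mode_lin _ _ _)) add0r.
  by rewrite (linZ (mode_lin _ _ _)) -scalerDr addrC [a + _]addrC [b + _]addrC.
rewrite /square_vac -(conv_sum_shift m t G_ge0).
rewrite -[X in _ *: (_ + X)]conv_sum_swap -conv_sumD /conv_sum.
rewrite (lin_sum (heis_lin h m)) scaler_sumr; apply: eq_bigr => k _.
by rewrite hG [G (- _) _]G_comm.
Qed.

Lemma energy_square t : energy (square_vac t) = t%:R *: square_vac t.
Proof.
have nrm : wt_form (alpha_wt j) (alpha_wt j) = 2 by rewrite wt_form_alpha cartan_diag.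
have vac0 : energy vac = 0.
  by rewrite expvE energy_fock cmonom_weight1 wt_form0 mul0r addr0 scale0r.
have eG (a b : int) : energy (G a b) = - (a + b)%:~R *: G a b.
  have em l v : energy (Xv j l v) = Xv j l (energy v) - l%:~R *: Xv j l v.
    by rewrite !modeE (vertex_energy _ _ _ nrm).
  have e1 : energy (Xv j b vac) = - b%:~R *: Xv j b vac.
    by rewrite em vac0 (lin0 (mode_lin E j b)) sub0r scaleNr.
  rewrite /G em e1 (linZ (mode_lin E j a)) -scalerBl.
  by apply: scale_eq; rewrite rmorphD opprD addrC.
rewrite /square_vac /conv_sum (lin_sum (@energy_lin R D)) scaler_sumr !big_nat.
apply: eq_bigr => k /andP[k0 kt]; rewrite eG; apply: scale_eq.
rewrite -opprD rmorphN opprK -PoszD subnKC //; exact: ltnW.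
Qed.

(** In weight 4 the vector $e^{2\alpha}$ has the right energy and cannot be excluded by degree.
    Applying $\alpha(-1)$ to $x(-2)e^\alpha=0$ gives $x(-2)^2e^0=-2x(-3)x(-1)e^0$, and the three
    terms of the sum cancel. *)
Lemma square_vac4 : square_vac 4 = 0.
Proof.
have aj := alpha_csa j.
have key : G (- 2%N%:Z) (- 2%N%:Z) = - (G (- 3%N%:Z) (- 1%N%:Z) + G (- 3%N%:Z) (- 1%N%:Z)).
  rewrite /G vertex_vac1 vertex_vac2; have := heis_mode X (-1) (-2) j (expv (alpha_wt j)) aj.
  rewrite vertex_alpha2 (lin0 (heis_lin _ _)) => /esym/eqP; rewrite addr_eq0 => /eqP ->.
  by rewrite cartan_mxP cartan_diag -mulr2n -scaler_nat.
rewrite /square_vac /conv_sum 3?big_ltn // big_geq // addr0.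
rewrite -[(4 - 1)%N]/3%N -[(4 - 2)%N]/2%N -[(4 - 3)%N]/1%N key.
rewrite (G_comm (- 1%N%:Z)); move: (G _ _) => g.
by rewrite opprD -addrA addNr addr0 subrr.
Qed.

Lemma square_vacuum t : square_vac t = 0.
Proof.
elim/ltn_ind: t => t IHt.
case: t IHt => [|t] IHt; first by rewrite /square_vac /conv_sum big_geq.
have [->|t4] := eqVneq t.+1 4%N; first exact: square_vac4.
set w := square_vac t.+1; have hw h (m : nat) : h \in csa D -> heis_op h m.+1 w = 0.
  by move=> hh; rewrite (heis_square _ _ hh) subSS IHt ?ltnS ?leq_subr // addr0 scaler0.
apply/malgP => -[mu c]; rewrite mcoeff0.
have [->{mu}|mu1] := eqVneq mu (onecm _); last first.
  by apply: fock_vacuum => // k m; apply: hw; apply: fweight_csa.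
apply/eqP/negPn/negP => wc; case/eqP: t4.
(* The positive modes leave only multiples of $e^c$; the zero modes identify [c] as $2\alpha_j$. *)
have wt_c : wt c = alpha D j + alpha D j.
  apply: csa_eq => [||k]; [exact: wt_csa | by rewrite rpredD ?alpha_csa |].
  have := coef_heis0 (alpha D k) w (onecm _) c.
  rewrite (heis_square 0 _ (alpha_csa k)) subn0 mcoeffZ mcoeffD -/w -mulr2n mulrnAr.
  rewrite -mulrnAl => /(mulIf wc) e.
  by rewrite formC -e mulr2n formC -formDl.
(* The energy of $e^{2\alpha_j}$ is $\langle 2\alpha_j,2\alpha_j\rangle/2=4$, which contradicts the
   excluded value. *)
have := coef_energy w c; rewrite /w energy_square mcoeffZ -/w => /(mulIf wc).
rewrite /wt_form wt_c formDl !formDr cartan_mxP cartan_diag => e.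
by apply/eqP; rewrite -(eqr_nat C) e; apply/eqP; field.
Qed.
End Square.

Lemma Rrel_vac j t : U_act (Rrel X j t) vac = 0.
Proof.
rewrite /Rrel (lin_sum (@U_act_linl _ _ _ X _)); apply: etrans (square_vacuum j t).
apply: eq_bigr => k _; apply: etrans (U_actM _ _ _) _.
by apply: etrans (U_act_xalpha _ _ _ _) _; apply: f_equal; apply: U_act_xalpha.
Qed.

(** The vector $e^l$ is the translate of the vacuum, and moving the injective translation operator
    out of the action of [a] shifts the modes of $x_j$ by $\langle l,\alpha_j\rangle$ and multiplies
    them by the commutator of the cocycle. *)
Lemma U_act_expv (l : P) : exists2 q : 'I_(rank D) -> C, forall j, q j != 0 &
  forall a : U, U_act a (expv l) = 0 <-> U_act (twist q (fun j => l 0 j) a) vac = 0.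
Proof.
pose q j := E (alpha_wt j) l / E l (alpha_wt j).
exists q => [j|a]; first by rewrite mulf_neq0 ?invr_eq0 ?eps_neq0.
suff tr : forall a : U, U_act a (expv l) =
    translate E l (U_act (twist q (fun j => l 0 j) a) vac).
  rewrite tr; split=> [/translate_eq0//|->]; exact: (lin0 (translate_lin E l)).
move=> {a}; apply: U_ind => [||j m a IHa].
- split=> [|k a a' IHa IHa'].
    rewrite (lin0 (@U_act_linl _ _ _ X _)) (lin0 (twist_lin _ _)) (lin0 (@U_act_linl _ _ _ X _)).
    by rewrite (lin0 (translate_lin E l)).
  by rewrite twist_lin !U_act_linl translate_lin IHa IHa'.
- apply: etrans (U_act1 _ _) _; apply: etrans (esym (translate_vac E l)) _.
  by apply: f_equal; rewrite twist1; apply: esym; apply: U_act1.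
have lj : wt_form (alpha_wt j) l = (l 0 j)%:~R.
  by rewrite /wt_form formC wt_alpha form_wt_alpha.
rewrite U_actM IHa U_act_xalpha modeE (vertex_translate _ _ _ lj) -modeE.
rewrite twistM twist_xalpha U_actM (linZ (@U_act_linl _ _ _ X _)) U_act_xalpha.
by rewrite (linZ (translate_lin E l)).
Qed.
End VacuumRelations.

Section Annihilators.
Variables (R : realType) (D : ade_lie_algebra R) (E : weight_cocycle D).
Variable X : affine_action E.
Local Notation C := R[i].
Local Notation P := (weights (rank D)).
Local Notation VP := (VP D).
Local Notation U := (Unbar X).
Local Notation x_ := (@xalpha R D E X).
Local Notation I0 := (@I0 R D E X : U -> Prop).

Lemma RrelE j t : Rrel X j t =
  @conv_sum U (fun a b => x_ j (- a%:Z) * x_ j (- b%:Z)) t.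
Proof. by []. Qed.

Lemma vacuum_annihilators :
  (forall a : U, U_act a (expv 0) = 0 <-> I0 a) /\
  (forall i (a : U), U_act a (expv (delta_mx 0 i)) = 0 <-> @I0x C 'I_(rank D) U x_ I0 i a).
Proof.
apply: (@core_annihilators C 'I_(rank D) U x_ (@twist R D E X) (cartan_mx D)
  {b | b \in pos_roots D} (fun b => Uvec X (val b)) I0 _ _ _ _ _ _ _ _ _ _ _ _ _ _ _
  VP (@U_act R D E X) (fun i => heis_op (fweight D i)) (expv 0)
  (fun i => expv (alpha_wt i)) (fun i => expv (delta_mx 0 i))).
- exact: U_ind.
- exact: twist_lin.
- exact: twistM.
- exact: twist1.
- exact: twist_xalpha.
- exact: cartan_diag.
- exact: cartan_offdiag.
- by move=> i j m n; apply: xalpha_comm.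
- exact: xalpha_bracket.
- by move=> j; exists (exist (fun b => b \in pos_roots D) _ (pos_alpha j)).
- exact: Uvec_bracket.
- exact: I0_left.
- by move=> j t; rewrite -RrelE; apply: I0_Rrel.
- by move=> b m; apply: I0_Uvec.
- move=> L L_left LR Lx; apply: (I0_min L_left _ Lx) => j t t2.
  by rewrite RrelE; apply: LR.
- exact: U_act_linl.
- exact: U_act_linr.
- exact: U_actM.
- exact: U_act1.
- by move=> i m; apply: heis_lin.
- move=> i j m n v.
  have act_x k u : U_act (x_ j k) u = mode E j k u by exact: U_act_xalpha.
  rewrite (act_x n v) (heis_mode X m n j v (fweight_csa i)) fweightP scaler_nat.
  by rewrite (act_x n (heis_op _ _ _)) (act_x (n + m) v).
- move=> i [|m]; last exact: heis_expv.
  by rewrite expvE heis0_fock wt0 formC form0l scale0r.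
- exact: expv_neq0.
- by move=> j m; rewrite U_act_xalpha vertex_vac_ge0.
- by move=> j t _; rewrite -RrelE; apply: Rrel_vac.
- by move=> i; exists 1; rewrite ?oner_neq0 // U_act_xalpha vertex_vac1 scale1r.
- move=> i; have [q q0] := U_act_expv X (alpha_wt i).
  have -> : (fun j => alpha_wt i 0 j) = cartan_mx D i by apply/funext => j; rewrite mxE.
  by move=> qE; exists q; [exact: q0 | exact: qE].
move=> i; have [q q0] := U_act_expv X (delta_mx 0 i).
have -> : (fun j => (delta_mx 0 i : P) 0 j) = (fun j => (i == j)%:Z).
  by apply/funext => j; rewrite mxE eqxx /= eq_sym; case: eqP.
by move=> qE; exists q; [exact: q0 | exact: qE].
Qed.
End Annihilators.

(** * The induced module and the map $\pi_{\lambda_i}$ *)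

Section InducedModule.
Variables (R : realType) (D : ade_lie_algebra R) (E : weight_cocycle D).
Variable X : affine_action E.
Variable i : 'I_(rank D).+1.
Local Notation C := R[i].
Local Notation VP := (VP D).
Local Notation U := (Unbar X).
Local Notation Up := (Unbarp X).
Local Notation nbarp_br := (@nbarp_bracket R D E X).
Local Notation pure a z := (@pure_tensor C Up U C^o
  (fun (u : U) (s : Up) => u * Unbarp_in s) (@triv_act R D E X) a z : WN X).

Lemma kernel_f (a : U) : f_ i a = 0 <-> I_ i a.
Proof.
have [ann0 annf] := vacuum_annihilators X.
rewrite /f_ /vlambda /I_ /lambda_wt; case: unliftP => [j|] _; last exact: ann0.
split=> [/annf[b Ib [c ->]]|[b Ib [c _ <-]]]; first by exists b => //; exists c.
by apply/annf; exists b => //; exists c.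
Qed.

Lemma f_I0 (a : U) : I0 a -> f_ i a = 0.
Proof.
have [ann0 annf] := vacuum_annihilators X.
rewrite /f_ /vlambda /lambda_wt => Ia; case: unliftP => [j|] _; last exact/ann0.
by apply/annf; exists a => //; exists 0; rewrite mul0r addr0.
Qed.

Lemma nbarp_in_br (u v : nbarp X) :
  nbarp_in (nbarp_br u v) = nbar_bracket (nbarp_in u) (nbarp_in v).
Proof.
have br_linl w : linear (nbarp_br^~ w) by exact: (loop_bracket_linl (@nbr_linl R D E X)).
have br_linr w : linear (nbarp_br w) by exact: (loop_bracket_linr (@nbr_linr R D E X)).
have in_lin := @nbarp_in_lin R D E X.
pose f (u v : nbarp X) := nbarp_in (nbarp_br u v).
pose g (u v : nbarp X) := nbar_bracket (nbarp_in u) (nbarp_in v).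
have f1 w : linear (f^~ w) by exact: comp_lin in_lin (br_linl w).
have f2 w : linear (f w) by exact: comp_lin in_lin (br_linr w).
have g1 w : linear (g^~ w) by exact: comp_lin (nbbr_linl _) in_lin.
have g2 w : linear (g w) by exact: comp_lin (nbbr_linr _) in_lin.
apply: (loop_eq2 f1 f2 g1 g2) => x m y k; rewrite /f /g !nbarp_in_U nbbr_nterm.
have -> : nbarp_br << x *g m >> << y *g k >> = << nil_bracket x y *g (m + k)%N >>.
  exact: (loop_bracketU (@nbr_linl R D E X) (@nbr_linr R D E X)).
by rewrite nbarp_in_U.
Qed.

Let Up_gen (u : nbarp X) : U := U_in (nbarp_in u).

Let Up_gen_lin : linear Up_gen.
Proof. by move=> a u v; rewrite /Up_gen nbarp_in_lin U_in_lin. Qed.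

Let Up_gen_br u v : Up_gen (nbarp_br u v) = Up_gen u * Up_gen v - Up_gen v * Up_gen u.
Proof. by rewrite /Up_gen nbarp_in_br U_in_br. Qed.

Lemma triv_module : lie_module nbarp_br (fun (_ : nbarp X) (_ : C^o) => 0 : C^o).
Proof.
by split=> [z a u v|u a y z|u v z]; rewrite ?scaler0 ?addr0 ?subr0.
Qed.

Lemma triv_actZ (s : Up) (z : C^o) : triv_act s z = z * triv_act s 1.
Proof.
have -> : z = z *: (1 : C^o) by rewrite [RHS]mulr1.
rewrite {1}/triv_act (linZ (env_act_linr triv_module s)).
by rewrite -[in RHS](_ : z = z *: (1 : C^o)) //; apply/esym/mulr1.
Qed.

(** The positive loops lie in the ideal and so kill the vector; thus they act on it as on the
    trivial module. This is the balancing condition that makes $\pi_{\lambda_i}$ well defined on the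
    tensor product. *)
Lemma Unbarp_act (s : Up) :
  U_act (Unbarp_in s) (vlambda i) = triv_act s 1 *: vlambda i.
Proof.
have Uin : forall s, Unbarp_in s = env_lift Up_gen s by [].
rewrite Uin; elim/env_ind: s => [|| u s IHs].
- apply: equalizer_subspace.
    exact: comp_lin (U_act_linl _) (env_lift_lin Up_gen_lin Up_gen_br).
  by move=> a s s'; rewrite /triv_act (env_act_linl triv_module) scalerDl scalerA.
- rewrite (env_lift1 Up_gen_lin Up_gen_br) U_act1 /triv_act (env_act1 triv_module).
  by rewrite scale1r.
rewrite (env_liftM Up_gen_lin Up_gen_br) (env_lift_in Up_gen_lin Up_gen_br) U_actM IHs.
rewrite (linZ (U_act_linr _)).
apply: etrans (f_equal (fun v => _ *: v) (f_I0 (I0_nbarp u))) _; rewrite scaler0.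
by rewrite /triv_act (env_actM triv_module) (env_act_in triv_module) scale0r.
Qed.

(** Scalars move across the tensor sign, so $a\otimes z=(za)\otimes 1$, and such tensors are closed
    under linear combinations. *)
Lemma WN_pure (w : WN X) : exists a : U, w = pure a 1.
Proof.
move: w; apply: tensor_ind => [|a z]; last first.
  exists (z *: a); apply: etrans _ (esym (linZ (pure_linl _ _ (1 : C^o)) z a)).
  apply: etrans _ (linZ (pure_linr _ _ a) z (1 : C^o)).
  by apply: f_equal; apply/esym/mulr1.
split=> [|k _ _ [a ->] [b ->]]; first by exists 0; rewrite (lin0 (pure_linl _ _ _)).
by exists (k *: a + b); rewrite pure_linl.
Qed.

Lemma WN_actE (a b : U) : WN_act a (pure b 1) = pure (a * b) 1.
Proof.
apply: (tensor_liftE (f := fun b z => pure (a * b) z : WN X)) => [z|b'|b' s z].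
- move=> k u u'; rewrite mulrDr -scalerAr; exact: pure_linl.
- exact: pure_linr.
rewrite mulrA; apply/eqP; rewrite -subr_eq0; apply/eqP.
have := tensor_rel0 (TensorBalanced (fun (a : U) (s : Up) => a * Unbarp_in s)
  (@triv_act R D E X) (a * b') s z).
by move=> <-; apply/esym/qpiB.
Qed.

Lemma pi_pure (a : U) : pi_ i (pure a 1) = f_ i a.
Proof.
apply: etrans (scale1r _).
apply: (tensor_liftE (f := fun (a : U) (z : C^o) => z *: U_act a (vlambda i) : VP))
  => [z|b|b s z].
- exact: lin_scaler (U_act_linl _).
- by move=> k z z'; rewrite scalerDl scalerA.
rewrite U_actM Unbarp_act (linZ (U_act_linr _)) [in RHS]triv_actZ scalerA.
by [].
Qed.
End InducedModule.

Theorem theorem4p1 (R : realType) (D : ade_lie_algebra R)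
    (E : weight_cocycle D) (X : affine_action E) (i : 'I_(rank D).+1) :
  [set a : Unbar X | f_ i a = 0] = I_ i /\
  [set w : WN X | pi_ i w = 0] = [set WN_act a (vN X) | a in I_ i].
Proof.
split; first by apply/seteqP; split=> a /kernel_f.
apply/seteqP; split=> [w|_ [a Ia <-]] /=.
  have [a ->] := WN_pure w; rewrite pi_pure => /kernel_f Ia.
  by exists a => //; apply: etrans (WN_actE a 1) _; rewrite mulr1.
have -> : WN_act a (vN X) = pure_tensor _ _ a 1.
  by apply: etrans (WN_actE a 1) _; rewrite mulr1.
by rewrite pi_pure; apply/kernel_f.
Qed.
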